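(* Let $\Phi$ be a sequence of nonzero vectors lying in an open half-space of $V$ and spanning the lattice $\Gamma$ (i.e. $\mathbb{Z}\Phi=\Gamma$). Let $W$ be a wall of $\Phi$, $W=\{a\in V:\langle a,E\rangle=0\}$ with $E\in\Gamma^*$ primitive, and let $\mathfrak{c}_1,\mathfrak{c}_2$ be two chambers of $\Phi$ adjacent along $W$ and separated by $W$, with $\langle E,\mathfrak{c}_1\rangle>0$. Let $\Phi_0=\Phi\cap W$, and assume that $\langle\phi,E\rangle>0$ for at least one $\phi\in\Phi\setminus\Phi_0$. Let $\mathfrak{c}_{12}$ be the chamber of $\Phi_0$ in $W$ whose closure contains $\overline{\mathfrak{c}_1}\cap\overline{\mathfrak{c}_2}$, and let $k_{12}=k(\Phi_0,\mathfrak{c}_{12})$ be the associated quasi-polynomial function on $\Gamma_0=W\cap\Gamma$. Then, as functions on $\Gamma$, $$k(\Phi,\mathfrak{c}_1)-k(\Phi,\mathfrak{c}_2)=\mathrm{Para}(k_{12},\Phi\setminus\Phi_0,E).$$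
   Context: Setting. $U$ is an $r$-dimensional real vector space, $V=U^*$, $\Gamma\subset V$ a lattice of full rank, $\Gamma^*\subset U$ the dual lattice, $\Gamma_0=W\cap\Gamma$. $T=U/\Gamma^*$, $T_0=W^*/\Gamma_0^*$, and $r:T\to T_0$ is the surjective homomorphism induced by the restriction map $U=V^*\to W^*$. For $y\in T$ and $a\in\Gamma$, $e_y(a)=e^{2i\pi\langle y,a\rangle}$. A quasi-polynomial function on $\Gamma$ is a function $Q(a)=\sum_{y\in T}e_y(a)Q_y(a)$ where $Q_y$ are polynomial functions on $V$, nonzero only for finitely many $y$, all of finite order in $T$; similarly on $\Gamma_0$. Chambers. $C(\nu)$ is the closed convex cone generated by $\nu$; $C(\Phi)_{\mathrm{sing}}$ is the union of the $C(\nu)$ over subsets $\nu\subset\Phi$ of cardinality $<\dim V$; chambers are the connected components of $V\setminus C(\Phi)_{\mathrm{sing}}$. The exterior of $C(\Phi)$ is a chamber $\mathfrak{c}_{\mathrm{ext}}$; the others, contained in $C(\Phi)$, are interior. The same applies to $\Phi_0$ in $W$. A wall is a hyperplane generated by $r-1$ linearly independent elements of $\Phi$. ''Adjacent and separated by $W$, with $\langle E,\mathfrak{c}_1\rangle>0$'' means: $\langle a,E\rangle>0$ for $a\in\mathfrak{c}_1$; either $\langle a,E\rangle<0$ for all $a\in\mathfrak{c}_2$, or $\mathfrak{c}_2=\mathfrak{c}_{\mathrm{ext}}$; and $\overline{\mathfrak{c}_1}\cap\overline{\mathfrak{c}_2}\cap W$ has non-empty interior in $W$ (when $\mathfrak{c}_2=\mathfrak{c}_{\mathrm{ext}}$,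 read $\overline{\mathfrak{c}_1}\cap\overline{\mathfrak{c}_2}$ as $\overline{\mathfrak{c}_1}\cap\overline{\mathfrak{c}_2}\cap W$). Partition function. $k(\Phi)(a)$ is the number of $(n_\phi)_{\phi\in\Phi}\in\mathbb{Z}_{\ge0}^{\Phi}$ with $\sum_\phi n_\phi\phi=a$. For an interior chamber $\mathfrak{c}$, $k(\Phi,\mathfrak{c})$ is the unique quasi-polynomial function on $\Gamma$ equal to $k(\Phi)$ on $\overline{\mathfrak{c}}\cap\Gamma$; $k(\Phi,\mathfrak{c}_{\mathrm{ext}})=0$. Likewise $k(\Phi_0,\mathfrak{c}_{12})$ is a quasi-polynomial function on $\Gamma_0$. The function Para. For a polynomial $P$ on $V$, $P(\partial_x)$ is the constant coefficient differential operator in $x\in U$ with $P(\partial_x)e^{\langle a,x\rangle}=P(a)e^{\langle a,x\rangle}$. For a quasi-polynomial $Q=\sum_{y\in T}e_yQ_y$ on $\Gamma$ and a finite sequence $\Psi$ of vectors of $\Gamma$ not in $W$, for $a\in\Gamma$, $$\mathrm{Para}(Q,\Psi,E)(a)=\sum_{y\in T}\ \sum_{g\in T:\,r(g)=r(y)}\mathrm{Res}_{z=0}\left(Q_y(\partial_x)\cdot\frac{e^{\langle a,x+2i\pi g+zE\rangle}}{\prod_{\psi\in\Psi}(1-e^{-\langle\psi,x+2i\pi g+zE\rangle})}\right)_{x=0},$$ where only finitely many $g$ give a nonzero residue. This depends only on the restriction of $Q$ to $\Gamma_0$; for a quasi-polynomial $q$ on $\Gamma_0$, $\mathrm{Para}(q,\Psi,E):=\mathrm{Para}(Q,\Psi,E)$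 for any quasi-polynomial $Q$ on $\Gamma$ extending $q$. *)

(* Defs.v *)
From HB Require Import structures.
From mathcomp Require Import all_boot all_order all_algebra.
From mathcomp Require Import generic_quotient ring_quotient.
From mathcomp Require Import finmap complex.
From mathcomp Require Import all_classical all_reals all_analysis.
(* the notations of mpoly clash with those of MathComp-Analysis *)
From mathcomp Require mpoly.
Import (canonicals, coercions) mpoly.

Set Implicit Arguments.
Unset Strict Implicit.
Unset Printing Implicit Defensive.

Import Order.TTheory GRing.Theory Num.Theory.
Import numFieldNormedType.Exports.

Local Open Scope classical_set_scope.
Local Open Scope ring_scope.
Local Open Scope complex_scope.

(* Conventions.  V is a finite-dimensional real vector space and U = V^* is its
   dual, so that <a, x> is written x a for a : V and x : U.  All the notions are
   set up for an arbitrary V, so that they apply verbatim to a hyperplane W of V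
   (seen as the vector space subvs_of W).  Finite sequences of vectors are lists:
   multiplicities count. *)

Section Complex.
Variable R : realType.
Local Notation C := R[i].

Definition cexp (z : C) : C :=
  (expR (complex.Re z))%:C * (cos (complex.Im z) +i* sin (complex.Im z)).

(* c is the coefficient of 1/z in the Laurent expansion at 0 of f, assumed to
   be meromorphic at 0: f is a principal part plus a holomorphic function h. *)
Definition is_residue (f : C -> C) (c : C) : Prop :=
  exists (N : nat) (b : nat -> C) (h : C^o -> C^o),
    (\forall z \near (0 : C^o), derivable h z 1) /\
    (\forall z \near (0 : C^o)^',
       f z = c / z + \sum_(k < N) b k / z ^+ k.+2 + h z).

Definition residue0 (f : C -> C) : C := xget 0 (is_residue f).

End Complex.

Section Lattice.
Variables (R : realType) (V : vectType R).

Definition zspan (s : seq V) : set V :=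
  [set a | exists n : 'I_(size s) -> int, a = \sum_(i < size s) s`_i *~ n i].

Definition full_lattice (Gamma : set V) : Prop :=
  exists2 b : seq V, basis_of fullv b & Gamma = zspan b.

Definition dual_lattice (Gamma : set V) : {pred 'Hom(V, R^o)} :=
  fun x => `[< forall a, Gamma a -> (x a : R) \is a Num.int >].

Lemma dual_lattice_zmod_closed (Gamma : set V) :
  zmod_closed (dual_lattice Gamma).
Proof.
split=> [|x y /asboolP xG /asboolP yG]; apply/asboolP => a Ga.
  by rewrite zero_lfunE rpred0.
by rewrite add_lfunE opp_lfunE rpredB ?xG ?yG.
Qed.

HB.instance Definition _ (Gamma : set V) :=
  GRing.isZmodClosed.Build _ (dual_lattice Gamma)
    (dual_lattice_zmod_closed Gamma).

Definition primitive_dual (Gamma : set V) (E : 'Hom(V, R^o)) : Prop :=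
  E \in dual_lattice Gamma /\
  forall (F : 'Hom(V, R^o)) (n : nat),
    F \in dual_lattice Gamma -> E = F *+ n -> n = 1%N.

Definition torus (Gamma : set V) : zmodType := {ideal_quot (dual_lattice Gamma)}.

(* e_y(a); the value depends on the representative of y unless a is in Gamma. *)
Definition character (Gamma : set V) (y : torus Gamma) (a : V) : R[i] :=
  cexp (0 +i* (2 * pi * (repr y) a)).

End Lattice.

(* A polynomial function on V with complex coefficients is a polynomial in the
   coordinates of V in the basis vbasis fullv. *)
Section Polynomial.
Variables (R : realType) (V : vectType R).
Local Notation U := 'Hom(V, R^o).
Local Notation n := (\dim {:V}).

Local Notation polyfun := (mpoly.mpoly n R[i]).

Definition polyfun_val (P : polyfun) (a : V) : R[i] :=
  mpoly.meval (fun i => (coord (vbasis {:V}) i a)%:C) P.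

(* derivative of f at x in the direction u; it maps the function
   x |-> e^<a, x> to <a, u> e^<a, x> *)
Definition dirder (u : U) (f : U -> R[i]) (x : U) : R[i] :=
  lim ((h^-1)%:C * (f (x + h *: u) - f x) @[h --> (0 : R)^'] : set_system R[i]^o).

Definition coordform (i : 'I_n) : U := linfun (coord (vbasis {:V}) i : V -> R^o).

(* P(d/dx): the monomial in the coordinates of exponents m acts as the product
   of the partial derivatives along the coordinate forms, so that
   P(d/dx) e^<a, x> = P(a) e^<a, x>. *)
Definition polyfun_diff (P : polyfun) (f : U -> R[i]) (x : U) : R[i] :=
  \sum_(m <- mpoly.msupp P) mpoly.mcoeff m P *
    foldr (fun i g => iter (m i) (dirder (coordform i)) g) f (enum 'I_n) x.

End Polynomial.

Section QuasiPolynomial.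
Variables (R : realType) (V : vectType R) (Gamma : set V).

Record quasipoly := QuasiPoly {
  qp_coef : torus Gamma -> mpoly.mpoly (\dim {:V}) R[i];
  qp_finite : finite_set [set y | qp_coef y != 0];
  qp_torsion : forall y, qp_coef y != 0 ->
    exists2 N : nat, (0 < N)%N & y *+ N = 0 }.

(* only meaningful for a in Gamma *)
Definition qp_val (Q : quasipoly) (a : V) : R[i] :=
  \sum_(y \in [set: torus Gamma]) character y a * polyfun_val (qp_coef Q y) a.

End QuasiPolynomial.

Section Chambers.
Variables (R : realType) (V : vectType R).

(* V with its canonical topology, transported from R^n by the coordinates *)
Definition vtop : topologicalType :=
  initial_topology (passmx.rVof (vbasis {:V}) : V -> 'rV[R]_(\dim {:V})).

Definition cone (nu : seq V) : set V :=
  [set a | exists2 t : 'I_(size nu) -> R,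
     forall i, 0 <= t i & a = \sum_(i < size nu) t i *: nu`_i].

Definition cone_sing (Phi : seq V) : set V :=
  \bigcup_(nu in [set nu | subseq nu Phi /\ (size nu < \dim {:V})%N]) cone nu.

Definition chamber (Phi : seq V) (c : set V) : Prop :=
  exists2 x, ~ cone_sing Phi x &
    c = connected_component (~` cone_sing Phi : set vtop) x.

Definition ext_chamber (Phi : seq V) : set V := ~` cone Phi.

Definition vclosure (A : set V) : set V := closure (A : set vtop).

Definition vinterior (A : set V) : set V := interior (A : set vtop).

(* k(Phi)(a); the set is finite when Phi lies in an open half-space *)
Definition partition_fun (Phi : seq V) (a : V) : nat :=
  #|` fset_set [set m : {ffun 'I_(size Phi) -> nat} |
                 a = \sum_(i < size Phi) Phi`_i *+ m i] |.

(* Q is the quasi-polynomial function k(Phi, c), which is characterised by the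
   following properties when c is a chamber of Phi *)
Definition is_chamber_qp (Gamma : set V) (Phi : seq V) (c : set V)
    (Q : quasipoly Gamma) : Prop :=
  (c = ext_chamber Phi -> forall a, Gamma a -> qp_val Q a = 0) /\
  (c <> ext_chamber Phi -> forall a, Gamma a -> vclosure c a ->
     qp_val Q a = (partition_fun Phi a)%:R).

End Chambers.

Section Wall.
Variables (R : realType) (V : vectType R) (W : {vspace V}).

Definition is_wall (Phi : seq V) : Prop :=
  exists2 nu : seq V, subseq nu Phi &
    [/\ free nu, (size nu).+1 = \dim {:V} & W = <<nu>>%VS].

(* c1 and c2 are adjacent along W and separated by W = ker E, with <E, c1> > 0 *)
Definition separated_by (Phi : seq V) (E : 'Hom(V, R^o)) (c1 c2 : set V) : Prop :=
  [/\ forall a, c1 a -> 0 < E a :> R,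
      (forall a, c2 a -> E a < 0 :> R) \/ c2 = ext_chamber Phi
    & vinterior ((vsval : subvs_of W -> V) @^-1` (vclosure c1 `&` vclosure c2))
        !=set0].

Definition lattice_in (Gamma : set V) : set (subvs_of W) := vsval @^-1` Gamma.

Definition vectors_in (Phi : seq V) : seq (subvs_of W) :=
  [seq vsproj W phi | phi <- Phi & phi \in W].

Definition vectors_out (Phi : seq V) : seq V := [seq phi <- Phi | phi \notin W].

Definition dual_restr (x : 'Hom(V, R^o)) : 'Hom(subvs_of W, R^o) :=
  (x \o linfun vsval)%VF.

(* r : T -> T_0 *)
Definition torus_restr (Gamma : set V) (y : torus Gamma) :
    torus (lattice_in Gamma) := \pi_(torus (lattice_in Gamma))%qT (dual_restr (repr y)).

(* <a, x + 2 i pi g + z E> *)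
Definition pairing (a : V) (x g E : 'Hom(V, R^o)) (z : R[i]) : R[i] :=
  (x a)%:C + (0 +i* (2 * pi * g a)) + z * (E a)%:C.

Definition para_kernel (Psi : seq V) (E g : 'Hom(V, R^o)) (a : V)
    (x : 'Hom(V, R^o)) (z : R[i]) : R[i] :=
  cexp (pairing a x g E z) /
    \prod_(psi <- Psi) (1 - cexp (- pairing psi x g E z)).

(* The sum over g has finite support, and does not depend on the choice of
   representatives in U of the points of the torus when a and Psi are in Gamma. *)
Definition para (Gamma : set V) (Q : quasipoly Gamma) (Psi : seq V)
    (E : 'Hom(V, R^o)) (a : V) : R[i] :=
  \sum_(y \in [set: torus Gamma])
    \sum_(g \in [set g | torus_restr g = torus_restr y])
      residue0 (fun z => polyfun_diff (qp_coef Q y)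
                           (fun x => para_kernel Psi E (repr g) a x z) 0).

End Wall.

Arguments is_wall {R V} W Phi.
Arguments separated_by {R V} W Phi E c1 c2.
Arguments lattice_in {R V} W Gamma.
Arguments vectors_in {R V} W Phi.
Arguments vectors_out {R V} W Phi.
Arguments torus_restr {R V} W {Gamma} y.
Arguments para {R V} W {Gamma} Q Psi E a.

(* Main.v *)
Require Import Defs.
From mathcomp Require Import all_boot all_order all_algebra.
From mathcomp Require Import generic_quotient ring_quotient finmap.
From mathcomp Require Import complex ring lra.
From mathcomp Require Import all_classical all_reals all_analysis.
From mathcomp Require mpoly.
Import (canonicals, coercions) mpoly.

(** Write nabla_psi h(a) = h(a) - h(a - psi), and Psi for the vectors of Phi
    outside W.  A solution counted by k(Phi)(a) either does not use psi or uses
    it at least once; so nabla_psi k(Phi) is the partition function of Phi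
    without psi, and applying nabla_psi for all psi in Psi turns k(Phi) into
    k(Phi_0), extended by 0 outside W ([nabs_partition]).  This system of
    difference equations has one solution operator K+ for functions that vanish
    where E is very negative, and one, K-, where E is very positive: they are
    [invnabs] for the forms E and -E.

    The geometry provides a lattice vector w of W such that, for n large,
    a + n w lies in c1 if <a, E> > 0, in c2 if <a, E> < 0, and in c12 if
    <a, E> = 0 ([wall_germ]).  On such half-lines k(Phi) coincides with k1 and
    k2 respectively, and k(Phi_0) with k12.  Quasi-polynomials satisfy linear
    recurrences on each line, and are thus determined by their germs at infinity
    in the direction w ([recseq_eventually0]); in particular the differences of
    k2 for all psi in Psi vanish, since they do far below W.  Hence k(Phi) - k2, whose germs vanish below W, has the germs
    of K+ f, where f is k12 on W and 0 outside; in the same way k(Phi) - k1 has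
    those of K- f.  Subtracting, k1 - k2 = K+ f - K- f
    ([wall_crossing_convolution]).

    It remains to recognize Para in K+ f - K- f ([para_convolution]).  Suppose
    first that Q = e_y.  Let E v = 1 and u = rho e^z.  The points g of T with
    r(g) = r(y) are the y + t E, they are parametrized by rho = e^(2 i pi t) on
    the unit circle, and the residue for g becomes, up to the factor e_y(a), the
    residue at rho of u^j / prod (1 - c u^-m) du / u, with j = <a, E>,
    m = <psi, E> and c = e_y(-psi).  The sum of these residues is the difference of the
    coefficients of the expansions at infinity and at 0, and these expansions
    are K+ and K- on the integers ([defect_eq0], [coset_sum]).  This
    residue theorem holds because both sides satisfy the same recursions in j:
    partial fractions reduce to factors with m = 1, where these recursions leave
    at most one value of j to compute.

    A linear factor in Q acts on K+ f - K- f by the same formula as the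
    corresponding derivative acts on the kernel of Para ([invnabs_deriv],
    [lined_kern]); it only involves the case of constants, for lists in which
    vectors of Psi are repeated.  This gives the case of e_y times a
    polynomial ([para_coset]), and then all quasi-polynomials by
    linearity. *)

Set Implicit Arguments.
Unset Strict Implicit.
Unset Printing Implicit Defensive.

Import Order.TTheory GRing.Theory Num.Theory.
Import numFieldNormedType.Exports.

Local Open Scope classical_set_scope.
Local Open Scope ring_scope.
Local Open Scope complex_scope.

(** * Difference operators and their one-sided inverses *)

Lemma ler_mem_sum (R : numDomainType) (T : eqType) (s : seq T) (F : T -> R) (x : T) :
  (forall y, 0 <= F y) -> x \in s -> F x <= \sum_(y <- s) F y.
Proof.
move=> F0; elim: s => //= y s ih; rewrite in_cons big_cons => /orP[/eqP ->|/ih h].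
  by rewrite lerDl sumr_ge0.
by apply: (le_trans h); rewrite lerDr.
Qed.

Section Subgroup.
Variables (M : zmodType) (G : set M).
Hypothesis GB : forall a b, G a -> G b -> G (a - b).

Lemma subgroup0 a : G a -> G 0.
Proof. by move=> Ga; rewrite -(subrr a); exact: GB. Qed.

Lemma subgroupN a : G a -> G (- a).
Proof. by move=> Ga; rewrite -sub0r; apply: GB => //; exact: (subgroup0 Ga). Qed.

Lemma subgroupD a b : G a -> G b -> G (a + b).
Proof. by move=> Ga Gb; rewrite -[b]opprK; apply: GB => //; exact: subgroupN. Qed.

Lemma subgroupMz a (n : int) : G a -> G (a *~ n).
Proof.
move=> Ga; have GM k : G (a *+ k).
  elim: k => [|k ih]; first by rewrite mulr0n; exact: (subgroup0 Ga).
  by rewrite mulrSr; exact: subgroupD.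
by case: n => k; rewrite ?NegzE ?mulrNz; [|apply: subgroupN]; exact: GM.
Qed.

Lemma subgroupMn a n : G a -> G (a *+ n).
Proof. exact: (@subgroupMz a n). Qed.

End Subgroup.

Section Conv.
Variables (M : zmodType) (K : fieldType) (R : realType).
Implicit Types (p q : M * K) (h g : M -> K) (a b : M) (L : seq (M * K)) (e : M -> R).

(** A pair [(psi, c)] stands for the operator [1 - c T], where [T] translates
    by [psi]; the weight [c] is needed because, against a character, a plain
    difference operator becomes a weighted one.  The form [e] below plays the
    part of the linear form of the wall: it decides in which direction
    [1 - c T] is inverted. *)
Definition nab p h a := h a - p.2 * h (a - p.1).
Definition nabs L h := foldl (fun h p => nab p h) h L.

(** The geometric series of [(1 - c T)^-1], in the powers of [T] or of [T^-1]
    according to the sign of [e psi].  For [h] supported in [e >= 0] the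
    terms of order larger than [|e a|] vanish, whence a finite sum. *)
Definition invnab e p h a :=
  let N := (Num.truncn `|e a|).+1 in
  if 0 < e p.1 then \sum_(n < N) p.2 ^+ n * h (a - p.1 *+ n)
  else - \sum_(n < N) p.2 ^- n.+1 * h (a + p.1 *+ n.+1).
Definition invnabs e L h := foldr (invnab e) h L.

Definition supp e (s : R) h := forall a, e a < s -> h a = 0.

(** With [1 <= |e psi|], [n] translations move [e] by at least [n], so that the
    truncation order in [invnab] is large enough. *)
Definition good e p := (1 <= `|e p.1|) && (p.2 != 0).

Lemma nabC p q h : nab p (nab q h) = nab q (nab p h).
Proof. by apply/funext => a; rewrite /nab [a - q.1 - _]addrAC; ring. Qed.

Lemma nabs_nab L p h : nabs L (nab p h) = nab p (nabs L h).
Proof. by elim: L h => //= q L ih h; rewrite nabC ih. Qed.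

Lemma nabs_cat L L' h : nabs (L ++ L') h = nabs L' (nabs L h).
Proof. exact: foldl_cat. Qed.

Lemma nabsC L L' h : nabs L (nabs L' h) = nabs L' (nabs L h).
Proof. by elim: L h => //= p L ih h; rewrite -nabs_nab ih. Qed.

Lemma nabs_perm L L' : perm_eq L L' -> nabs L = nabs L'.
Proof.
move=> LL'; apply: (catCA_perm_subst _ LL') => {L LL'} L1 L2 L3.
by apply/funext => h; rewrite !nabs_cat [nabs L2 (nabs L1 h)]nabsC.
Qed.

Lemma nab_lin p (I : Type) (s : seq I) (c : I -> K) (h : I -> M -> K) :
  nab p (fun a => \sum_(i <- s) c i * h i a) = fun a => \sum_(i <- s) c i * nab p (h i) a.
Proof.
apply/funext => a; rewrite /nab mulr_sumr -sumrB; apply: eq_bigr => i _; ring.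
Qed.

Lemma nabB p h1 h2 : nab p (fun a => h1 a - h2 a) = fun a => nab p h1 a - nab p h2 a.
Proof. by apply/funext => a; rewrite /nab; ring. Qed.

Lemma nabsB L h1 h2 : nabs L (fun a => h1 a - h2 a) = fun a => nabs L h1 a - nabs L h2 a.
Proof. by elim: L h1 h2 => //= p L ih h1 h2; rewrite nabB ih. Qed.

Section Theory.
Variable e : M -> R.
Hypothesis eB : {morph e : x y / x - y}.

Lemma e_0 : e 0 = 0.
Proof. by rewrite -(subrr 0) eB subrr. Qed.
Lemma e_N a : e (- a) = - e a.
Proof. by rewrite -sub0r eB e_0 sub0r. Qed.
Lemma e_D a b : e (a + b) = e a + e b.
Proof. by rewrite -[b]opprK eB e_N !opprK. Qed.
Lemma e_Mn a n : e (a *+ n) = e a *+ n.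
Proof. by elim: n => [|n ih]; rewrite ?e_0 // !mulrS e_D ih. Qed.

Lemma good_cases p : good e p -> (0 < e p.1 /\ 1 <= e p.1) \/ (e p.1 < 0 /\ e p.1 <= -1).
Proof.
move=> /andP[]; have [h|h|<-] := ltgtP 0 (e p.1).
- by rewrite gtr0_norm // => ? _; left.
- by rewrite ltr0_norm // => ? _; right; split=> //; lra.
- by rewrite normr0 ler10.
Qed.

(** Any truncation order larger than [e a] gives the same value, since the
    additional terms evaluate [h] below its support; this freedom makes the
    sums at [a] and at [a - psi] comparable. *)
Lemma invnab_pos p h a N : good e p -> 0 < e p.1 -> supp e 0 h ->
  e a < N%:R -> invnab e p h a = \sum_(n < N) p.2 ^+ n * h (a - p.1 *+ n).
Proof.
move=> /good_cases[[_ p1]|[p1 _]] pp sh aN; last by have := lt_trans p1 pp; rewrite ltxx.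
rewrite /invnab pp.
have key N1 N2 : (N1 <= N2)%N -> e a < N1%:R ->
    \sum_(n < N1) p.2 ^+ n * h (a - p.1 *+ n) = \sum_(n < N2) p.2 ^+ n * h (a - p.1 *+ n).
  move=> le hN; rewrite (big_ord_widen N2 (fun n => p.2 ^+ n * h (a - p.1 *+ n)) le).
  rewrite big_mkcond; apply: eq_bigr => i _; case: ltnP => // iN.
  rewrite sh ?mulr0 // eB e_Mn subr_lt0; apply: (lt_le_trans hN).
  apply: (@le_trans _ _ (i%:R)); first by rewrite ler_nat.
  by rewrite -[X in _ <= X]mulr_natl ler_peMr.
have aT : e a < (Num.truncn `|e a|).+1%:R.
  by apply: (le_lt_trans (ler_norm _)); exact: truncnS_gt.
case: (leqP (Num.truncn `|e a|).+1 N) => [le|/ltnW le]; first exact: key.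
by rewrite [RHS](key _ _ le).
Qed.

Lemma invnab_neg p h a N : good e p -> e p.1 < 0 -> supp e 0 h ->
  e a < N%:R -> invnab e p h a = - \sum_(n < N) p.2 ^- n.+1 * h (a + p.1 *+ n.+1).
Proof.
move=> /good_cases[[p1 _]|[_ p1]] pp sh aN; first by have := lt_trans p1 pp; rewrite ltxx.
rewrite /invnab ltNge (ltW pp) /=; congr (- _).
have key N1 N2 : (N1 <= N2)%N -> e a < N1%:R ->
    \sum_(n < N1) p.2 ^- n.+1 * h (a + p.1 *+ n.+1) = \sum_(n < N2) p.2 ^- n.+1 * h (a + p.1 *+ n.+1).
  move=> le hN; rewrite (big_ord_widen N2 (fun n => p.2 ^- n.+1 * h (a + p.1 *+ n.+1)) le).
  rewrite big_mkcond; apply: eq_bigr => i _; case: ltnP => // iN.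
  rewrite sh ?mulr0 // e_D e_Mn.
  have iN' : N1%:R <= i%:R :> R by rewrite ler_nat.
  have : e p.1 *+ i.+1 <= (-1) *+ i.+1 by exact: ler_wMn2r.
  rewrite mulNrn -[in X in _ <= X]nat1r; lra.
have aT : e a < (Num.truncn `|e a|).+1%:R.
  by apply: (le_lt_trans (ler_norm _)); exact: truncnS_gt.
case: (leqP (Num.truncn `|e a|).+1 N) => [le|/ltnW le]; first exact: key.
by rewrite [RHS](key _ _ le).
Qed.

Lemma invnab_supp p h s : good e p -> supp e s h -> supp e (s + Num.max 0 (- e p.1)) (invnab e p h).
Proof.
move=> gp sh a; have [[pp p1]|[pp p1]] := good_cases gp; rewrite /invnab.
- rewrite pp max_l ?addr0 ?oppr_le0 ?(ltW pp) // => ea.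
  rewrite big1 // => n _; rewrite sh ?mulr0 // eB e_Mn; apply: le_lt_trans ea.
  by rewrite gerBl mulrn_wge0 // ltW.
- rewrite (lt_gtF pp) max_r ?oppr_ge0 ?(ltW pp) // => ea.
  rewrite big1 ?oppr0 // => n _; rewrite sh ?mulr0 // e_D e_Mn mulrS.
  have : e p.1 *+ n <= 0 by rewrite mulrn_wle0 // ltW.
  lra.
Qed.

Lemma invnab_supp0 p h : good e p -> supp e 0 h -> supp e 0 (invnab e p h).
Proof.
move=> gp sh a a0; apply: (invnab_supp gp sh); rewrite add0r.
by rewrite lt_max a0.
Qed.

Lemma nab_invnab p h : good e p -> supp e 0 h -> nab p (invnab e p h) = h.
Proof.
move=> gp sh; apply/funext => a; rewrite /nab.
have p20 : p.2 != 0 by case/andP: gp.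
pose N := (Num.truncn (Num.max `|e a| `|e (a - p.1)|)).+1.
have hN : Num.max `|e a| `|e (a - p.1)| < N%:R by exact: truncnS_gt.
have N1 : e a < N%:R by apply: le_lt_trans hN; rewrite le_max ler_norm.
have N2 : e (a - p.1) < N%:R by apply: le_lt_trans hN; rewrite le_max [X in _ || X]ler_norm orbT.
have N1' : e a < N.+1%:R by apply: (lt_trans N1); rewrite ltr_nat.
have N2' : e (a - p.1) < N.+1%:R by apply: (lt_trans N2); rewrite ltr_nat.
have [[pp _]|[pp _]] := good_cases gp.
- rewrite (invnab_pos gp pp sh N1') (invnab_pos gp pp sh N2) big_ord_recl expr0 mul1r mulr0n subr0.
  rewrite mulr_sumr -addrA -[RHS]addr0; congr (_ + _); apply/eqP; rewrite subr_eq0; apply/eqP.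
  by apply: eq_bigr => i _; rewrite /= exprS mulrS opprD addrA mulrA.
- rewrite (invnab_neg gp pp sh N1) (invnab_neg gp pp sh N2') [in X in _ - X]big_ord_recl.
  rewrite expr1 mulr1n subrK mulrN opprK mulrDr mulVKf // addrCA -[RHS]addr0; congr (_ + _).
  rewrite addrC mulr_sumr -sumrB big1 // => i _.
  rewrite /= /bump /= add1n [p.1 *+ i.+2]mulrS addrA subrK mulrA [p.2 ^+ i.+2]exprS invfM mulVKf //.
  by rewrite subrr.
Qed.

Lemma invnabs_supp L h : all (good e) L -> supp e 0 h -> supp e 0 (invnabs e L h).
Proof. by move=> + sh; elim: L => //= p L ih /andP[gp gL]; apply: invnab_supp0 => //; exact: ih. Qed.

Lemma nab_invnabs p L h : all (good e) (p :: L) -> supp e 0 h ->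
  nab p (invnabs e (p :: L) h) = invnabs e L h.
Proof. by move=> /= /andP[gp gL] sh; apply: nab_invnab => //; exact: invnabs_supp. Qed.

Lemma nabs_invnabs L h : all (good e) L -> supp e 0 h -> nabs L (invnabs e L h) = h.
Proof.
move=> + sh; elim: L => //= p L ih /andP[gp gL].
by rewrite nab_invnab //; [exact: ih|exact: invnabs_supp].
Qed.

Section Germ.
Variables (G : set M) (w : M).
Hypothesis GB : forall a b, G a -> G b -> G (a - b).

(** Functions are compared through their germs at infinity in the direction
    [w].  [low0] is the corresponding weakening of vanishing for [e] very
    negative. *)
Definition germ0 h := forall a, G a -> \forall n \near \oo, h (a + w *+ n) = 0.
Definition low0 h := exists C : R, forall a, G a -> e a < C -> \forall n \near \oo, h (a + w *+ n) = 0.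

(** The equation [h(a) = c h(a - psi)] carries the vanishing of [h] from one
    level of [e] to another, in steps of length at least 1: upwards by [psi] if
    [e psi > 0], by [- psi] otherwise. *)
Lemma germ_uniq1 p h : good e p -> G p.1 -> germ0 (nab p h) -> low0 h -> germ0 h.
Proof.
move=> gp Gp hn [C hC].
have p20 : p.2 != 0 by case/andP: gp.
have key (k : nat) a : G a -> e a < C + k%:R -> \forall n \near \oo, h (a + w *+ n) = 0.
  elim: k a => [|k ih] a Ga; first by rewrite addr0; exact: hC.
  rewrite -natr1 => ea; have [[pp p1]|[pp p1]] := good_cases gp.
  - have ih1 := ih (a - p.1) (GB Ga Gp); have {}ih1 := ih1 (ltac:(rewrite eB; lra)).
    have hna := hn a Ga.
    near=> n.
    have A : nab p h (a + w *+ n) = 0 by near: n.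
    have B : h (a - p.1 + w *+ n) = 0 by near: n.
    by move: A; rewrite /nab addrAC B mulr0 subr0.
  - have ih1 := ih (a + p.1) (subgroupD GB Ga Gp); have {}ih1 := ih1 (ltac:(rewrite e_D; lra)).
    have hna := hn (a + p.1) (subgroupD GB Ga Gp).
    near=> n.
    have A : nab p h (a + p.1 + w *+ n) = 0 by near: n.
    have B : h (a + p.1 + w *+ n) = 0 by near: n.
    move: A; rewrite /nab B sub0r addrAC addrK => /eqP; rewrite oppr_eq0 mulf_eq0 (negbTE p20).
    by move=> /eqP.
move=> a Ga; apply: (key (Num.truncn `|e a - C|).+1 a Ga).
have := truncnS_gt `|e a - C|; have := ler_norm (e a - C); lra.
Unshelve. all: by end_near. Qed.

Lemma low0_nab p h : G p.1 -> low0 h -> low0 (nab p h).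
Proof.
move=> Gp [C hC]; exists (Num.min C (C + e p.1)) => a Ga; rewrite lt_min => /andP[a1 a2].
have h1 := hC a Ga a1.
have h2 := hC (a - p.1) (GB Ga Gp); have {}h2 := h2 (ltac:(rewrite eB; lra)).
near=> n; rewrite /nab addrAC.
have -> : h (a + w *+ n) = 0 by near: n.
have -> : h (a - p.1 + w *+ n) = 0 by near: n.
by rewrite mulr0 subr0.
Unshelve. all: by end_near. Qed.

Lemma low0_nabs L h : (forall p, p \in L -> G p.1) -> low0 h -> low0 (nabs L h).
Proof.
elim: L h => //= p L ih h GL hl; apply: ih => [q qL|].
  by apply: GL; rewrite in_cons qL orbT.
by apply: low0_nab => //; apply: GL; rewrite mem_head.
Qed.

Lemma germ_uniq L h : all (good e) L -> (forall p, p \in L -> G p.1) ->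
  germ0 (nabs L h) -> low0 h -> germ0 h.
Proof.
elim: L h => //= p L ih h /andP[gp gL] GL hn hl.
have Gp : G p.1 by apply: GL; rewrite mem_head.
apply: (germ_uniq1 gp) => //; apply: ih => //.
  by move=> q qL; apply: GL; rewrite in_cons qL orbT.
exact: low0_nab.
Qed.

End Germ.

(** The direction [w = 0] turns germs into values. *)
Lemma nabs_inj L h1 h2 s : all (good e) L -> supp e s h1 -> supp e s h2 ->
  nabs L h1 = nabs L h2 -> h1 = h2.
Proof.
move=> gL s1 s2 E; apply/funext => a; apply/eqP; rewrite -subr_eq0; apply/eqP.
have := @germ_uniq setT 0 (fun _ _ _ _ => I) L (fun a => h1 a - h2 a) gL (fun _ _ => I).
have g0 : germ0 setT 0 (nabs L (fun a => h1 a - h2 a)).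
  by move=> b _; apply: nearW => n; rewrite nabsB E subrr.
have l0 : low0 setT 0 (fun a => h1 a - h2 a).
  by exists s => b _ bs; apply: nearW => n; rewrite mul0rn addr0 s1 // s2 // subrr.
move=> /(_ g0 l0 a I)[N _ /(_ N)]; rewrite mul0rn addr0; apply; exact: leqnn.
Qed.

Lemma invnabs_uniq L h g : all (good e) L -> supp e 0 h -> supp e 0 g -> nabs L h = g ->
  h = invnabs e L g.
Proof.
move=> gL sh sg E; apply: (@nabs_inj L _ _ 0) => //; first exact: invnabs_supp.
by rewrite nabs_invnabs.
Qed.

Lemma supp_lin s (I : Type) (r : seq I) (c : I -> K) (h : I -> M -> K) :
  (forall i, supp e s (h i)) -> supp e s (fun a => \sum_(i <- r) c i * h i a).
Proof. by move=> sh a ea; rewrite big1 // => i _; rewrite sh // mulr0. Qed.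

Lemma invnabs_lin L (I : Type) (r : seq I) (c : I -> K) (h : I -> M -> K) :
  all (good e) L -> (forall i, supp e 0 (h i)) ->
  invnabs e L (fun a => \sum_(i <- r) c i * h i a) = fun a => \sum_(i <- r) c i * invnabs e L (h i) a.
Proof.
move=> gL sh; apply/esym; apply: invnabs_uniq => //.
- by apply: supp_lin => i; exact: invnabs_supp.
- exact: supp_lin.
- have aux (k : I -> M -> K) : nabs L (fun a => \sum_(i <- r) c i * k i a) =
      fun a => \sum_(i <- r) c i * nabs L (k i) a.
    by elim: L k {gL} => //= p L ih k; rewrite nab_lin ih.
  rewrite aux; apply/funext => a; apply: eq_bigr => i _; by rewrite nabs_invnabs.
Qed.

Lemma invnabs_swap p q L h : all (good e) (p :: q :: L) -> supp e 0 h ->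
  invnabs e (p :: q :: L) h = invnabs e (q :: p :: L) h.
Proof.
move=> gL sh; have gL' : all (good e) (q :: p :: L) by rewrite /= andbCA.
apply: invnabs_uniq => //; first exact: invnabs_supp.
by have := nabs_invnabs gL sh; rewrite /= nabC.
Qed.

Lemma invnabs_perm L L' h : all (good e) L -> supp e 0 h -> perm_eq L L' ->
  invnabs e L h = invnabs e L' h.
Proof.
move=> gL sh LL'; have gL' : all (good e) L' by rewrite -(perm_all _ LL').
apply: invnabs_uniq => //; first exact: invnabs_supp.
by rewrite -(nabs_perm LL') nabs_invnabs.
Qed.

(** Multiplication by an additive function [u] and the solution operator commute
    up to terms in which one vector [psi] is repeated.  Both sides solve the
    same difference equation and vanish for [e] very negative.  The kernel of the
    residue obeys the same rule with [u] replaced by a derivative, see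
    [lined_kern]; this is what reduces polynomials to constants. *)
Lemma invnabs_deriv (u : M -> K) L h : {morph u : x y / x - y} -> all (good e) L -> supp e 0 h ->
  forall a, invnabs e L (fun b => u b * h b) a =
    u a * invnabs e L h a - \sum_(p <- L) u p.1 * p.2 * invnabs e (p :: L) h (a - p.1).
Proof.
move=> uB + sh; have su : supp e 0 (fun b => u b * h b) by move=> a a0; rewrite sh ?mulr0.
elim: L => [|p L ih] gL a; first by rewrite big_nil subr0.
pose k := invnabs e (p :: L) h.
pose rhs b := u b * k b - \sum_(q <- p :: L) u q.1 * q.2 * invnabs e (q :: p :: L) h (b - q.1).
suff E : rhs = invnabs e (p :: L) (fun b => u b * h b) by rewrite -E.
have [gp gL'] := andP gL.
have good_in q : q \in p :: L -> good e q by move/(allP gL).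
have sk : supp e 0 k by exact: invnabs_supp.
apply: (@nabs_inj [:: p] _ _ (Num.min 0 (- \sum_(q <- p :: L) `|e q.1|))) => /=.
- by rewrite gp.
- move=> b; rewrite lt_min => /andP[b0 b1]; rewrite /rhs sk // mulr0 sub0r big_seq big1 ?oppr0 // => q qL.
  rewrite (invnabs_supp (L := q :: p :: L) _ sh) ?mulr0 //=.
    by rewrite good_in //= gp.
  have qs : `|e q.1| <= \sum_(q <- p :: L) `|e q.1| by exact: (@ler_mem_sum _ _ _ (fun q => `|e q.1|)).
  have := ler_norm (- e q.1); rewrite normrN eB; lra.
- move=> b; rewrite lt_min => /andP[b0 b1].
  by apply: invnab_supp0 => //; exact: invnabs_supp.
rewrite nab_invnab //; last exact: invnabs_supp.
apply/funext => b; rewrite ih // /rhs /nab mulrBr.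
set S1 := \sum_(q <- p :: L) _; set S2 := \sum_(q <- p :: L) _; set S3 := \sum_(q <- L) _.
have ES : S1 - p.2 * S2 = u p.1 * p.2 * k (b - p.1) + S3.
  rewrite mulr_sumr -sumrB.
  rewrite [LHS](_ : _ = \sum_(q <- p :: L) u q.1 * q.2 * nab p (invnabs e (q :: p :: L) h) (b - q.1)); last first.
    by apply: eq_bigr => q _; rewrite /nab [b - p.1 - q.1]addrAC; ring.
  rewrite big_cons nab_invnabs //; last by rewrite /= gp.
  congr (_ + _); rewrite big_seq [RHS]big_seq; apply: eq_bigr => q qL.
  have gq : good e q by apply: good_in; rewrite in_cons qL orbT.
  by rewrite invnabs_swap ?nab_invnabs //= gp gq.
have Ek : k b = invnabs e L h b + p.2 * k (b - p.1).
  by have /(congr1 (fun f => f b)) := nab_invnabs gL sh; rewrite /nab -/k => <-; rewrite subrK.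
have -> : S1 = p.2 * S2 + (u p.1 * p.2 * k (b - p.1) + S3) by rewrite -ES addrC subrK.
by rewrite Ek uB; ring.
Qed.

End Theory.
End Conv.

(** * Complex differentiability and the exponential *)

Lemma near_all (T : topologicalType) (x : T) (P : set T) :
  (forall y, P y) -> \forall y \near x, P y.
Proof. by move=> h; apply: filterE. Qed.

Lemma near_imp2 (T : topologicalType) (x : T) (P Q S : set T) :
  (forall y, P y -> Q y -> S y) -> (\forall y \near x, P y) ->
  (\forall y \near x, Q y) -> \forall y \near x, S y.
Proof. exact: filterS2. Qed.

Lemma near_imp (T : topologicalType) (x : T) (P Q : set T) :
  (forall y, P y -> Q y) -> (\forall y \near x, P y) -> \forall y \near x, Q y.
Proof. exact: filterS. Qed.

Section CDeriv.
Variable K : numFieldType.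
Implicit Types (f g : K -> K) (z l : K).

Lemma contD (T : topologicalType) (f g : T -> K^o) (x : T) :
  {for x, continuous f} -> {for x, continuous g} -> {for x, continuous (fun y => f y + g y : K^o)}.
Proof. exact: continuousD. Qed.

Lemma contB (T : topologicalType) (f g : T -> K^o) (x : T) :
  {for x, continuous f} -> {for x, continuous g} -> {for x, continuous (fun y => f y - g y : K^o)}.
Proof. exact: continuousB. Qed.

Lemma contM (T : topologicalType) (f g : T -> K^o) (x : T) :
  {for x, continuous f} -> {for x, continuous g} -> {for x, continuous (fun y => f y * g y : K^o)}.
Proof. exact: continuousM. Qed.

Lemma cont_cst (T : topologicalType) (c : K^o) (x : T) : {for x, continuous (fun=> c : K^o)}.
Proof. exact: cst_continuous. Qed.

(** Caratheodory's form of the derivative: sums, products and composites are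
    then handled by continuity alone, without difference quotients. *)
Definition cderiv f z l := exists g : K^o -> K^o,
  [/\ \forall w \near (z : K^o), f w - f z = g w * (w - z),
      {for z, continuous g} & g z = l].

Lemma cderiv_congr f1 f2 z l :
  (\forall w \near (z : K^o), f1 w = f2 w) -> cderiv f1 z l -> cderiv f2 z l.
Proof.
move=> e [g [h1 h2 h3]]; exists g; split=> //.
have ez := nbhs_singleton e.
by near=> w; rewrite -ez -(near e w) // (near h1 w).
Unshelve. all: by end_near. Qed.

Lemma near_continuous (f1 f2 : K^o -> K^o) (z : K^o) :
  (\forall w \near z, f1 w = f2 w) -> {for z, continuous f1} -> {for z, continuous f2}.
Proof.
move=> e c A nA; have ez := nbhs_singleton e; rewrite -ez in nA.
by apply: filterS2 e (c A nA) => w e1 /= h1; rewrite /= -e1.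
Qed.

Lemma cderiv_cont f z l : cderiv f z l -> {for z, continuous (f : K^o -> K^o)}.
Proof.
move=> [g [h1 h2 h3]].
have h : {for z, continuous (fun w : K^o => f z + g w * (w - z) : K^o)}.
  apply: continuousD; first exact: cst_continuous.
  apply: continuousM => //; apply: continuousB; first by move=> A.
  exact: cst_continuous.
apply: (near_continuous _ h).
by apply: filterS h1 => w <-; rewrite addrC subrK.
Qed.

Lemma cderiv_cst c z : cderiv (fun=> c) z 0.
Proof.
exists (fun=> 0); split=> //; last exact: cst_continuous.
by near=> w; rewrite subrr mul0r.
Unshelve. all: by end_near. Qed.

Lemma cderiv_id z : cderiv id z 1.
Proof.
exists (fun=> 1); split=> //; last exact: cst_continuous.
by near=> w; rewrite mul1r.
Unshelve. all: by end_near. Qed.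

Lemma cderivD f1 f2 z l1 l2 : cderiv f1 z l1 -> cderiv f2 z l2 ->
  cderiv (fun w => f1 w + f2 w) z (l1 + l2).
Proof.
move=> [g1 [a1 b1 <-]] [g2 [a2 b2 <-]]; exists (fun w => g1 w + g2 w); split=> //.
  near=> w; rewrite mulrDl -(near a1 w) // -(near a2 w) //; ring.
exact: continuousD.
Unshelve. all: by end_near. Qed.

Lemma cderivM f1 f2 z l1 l2 : cderiv f1 z l1 -> cderiv f2 z l2 ->
  cderiv (fun w => f1 w * f2 w) z (l1 * f2 z + f1 z * l2).
Proof.
move=> h1 h2; have c2 := cderiv_cont h2.
case: h1 => g1 [a1 b1 <-]; case: h2 => g2 [a2 b2 <-].
exists (fun w => g1 w * f2 w + f1 z * g2 w); split=> //.
  near=> w; rewrite mulrDl mulrAC -(near a1 w) // -mulrA -(near a2 w) //; ring.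
by apply: continuousD; apply: continuousM => //; exact: cst_continuous.
Unshelve. all: by end_near. Qed.

Lemma cderivV f z l : f z != 0 -> cderiv f z l ->
  cderiv (fun w => (f w)^-1) z (- l / f z ^+ 2).
Proof.
move=> f0 h; have c := cderiv_cont h; case: h => g [a b <-].
exists (fun w => - g w * ((f w)^-1 * (f z)^-1)); split=> //.
- have n0 : \forall w \near (z : K^o), f w != 0.
    exact: (cvgr_neq0 _ c f0).
  near=> w; have fw : f w != 0 by near: w.
  have e := near a w; rewrite mulrAC mulNr -e //; field; exact/andP.
- apply: continuousM; first exact: continuousN.
  by apply: continuousM; [exact: continuousV|exact: cst_continuous].
- by rewrite expr2 invfM.
Unshelve. all: by end_near. Qed.

Lemma cderiv_comp f1 f2 z l1 l2 : cderiv f2 z l2 -> cderiv f1 (f2 z) l1 ->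
  cderiv (fun w => f1 (f2 w)) z (l1 * l2).
Proof.
move=> h2 h1; have c2 := cderiv_cont h2.
case: h1 => g1 [a1 b1 <-]; case: h2 => g2 [a2 b2 <-].
exists (fun w => g1 (f2 w) * g2 w); split=> //.
  have a1' : \forall w \near (z : K^o), f1 (f2 w) - f1 (f2 z) = g1 (f2 w) * (f2 w - f2 z).
    exact: (c2 _ a1).
  by near=> w; rewrite (near a1' w) // -mulrA (near a2 w).
by apply: continuousM => //; apply: continuous_comp.
Unshelve. all: by end_near. Qed.

Lemma cderiv_punct f1 f2 z l1 l2 : (\forall w \near (z : K^o)^', f1 w = f2 w) ->
  f1 z = f2 z -> cderiv f1 z l1 -> cderiv f2 z l2 -> l1 = l2.
Proof.
move=> e ez [g1 [a1 b1 <-]] [g2 [a2 b2 <-]].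
have c1 : g1 w @[w --> (z : K^o)^'] --> (g1 z : K^o) by move=> A /b1; apply: nbhs_dnbhs.
have c2 : g2 w @[w --> (z : K^o)^'] --> (g2 z : K^o) by move=> A /b2; apply: nbhs_dnbhs.
have c12 : g2 w @[w --> (z : K^o)^'] --> (g1 z : K^o).
  apply: cvg_trans c1; apply: near_eq_cvg.
  near=> w.
  have nz : w - z != 0 by rewrite subr_eq0; near: w; exact: nbhs_dnbhs_neq.
  apply: (mulIf nz).
  have A1 : f1 w - f1 z = g1 w * (w - z) by near: w; exact: nbhs_dnbhs.
  have A2 : f2 w - f2 z = g2 w * (w - z) by near: w; exact: nbhs_dnbhs.
  by rewrite -A1 -A2 ez; congr (_ - _); near: w.
exact: (cvg_unique _ c12 c2).
Unshelve. all: by end_near. Qed.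

Lemma cderiv_derivable f z l : cderiv f z l ->
  is_derive (z : K^o) 1 (f : K^o -> K^o) l.
Proof.
move=> [g [a b <-]].
have c : (h : K^o)^-1 *: ((f \o shift z) (h *: (1 : K^o)) - f z) @[h --> (0 : K)^'] --> (g z : K^o).
  have s : {for 0, continuous (fun h : K^o => g (h + z) : K^o)}.
    apply: (@continuous_comp _ _ _ (fun h : K^o => h + z : K^o) g).
      by apply: continuousD; [move=> A|exact: cst_continuous].
    by rewrite add0r.
  have s' : g (h + z) @[h --> (0 : K)^'] --> (g z : K^o).
    by move=> A nA; apply: nbhs_dnbhs; apply: s; rewrite add0r.
  apply: cvg_trans s'; apply: near_eq_cvg.
  have a0 : \forall h \near (0 : K^o), f (h + z) - f z = g (h + z) * (h + z - z).
    have : {for 0, continuous (fun h : K^o => h + z : K^o)}.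
      by apply: continuousD; [move=> A|exact: cst_continuous].
    move=> /(_ [set w | f w - f z = g w * (w - z)]); apply.
    by rewrite /= add0r.
  near=> h.
  have h0 : h != 0 by near: h; exact: nbhs_dnbhs_neq.
  rewrite /= /shift /= -[h *: 1]/(h * 1) mulr1.
  have -> : f (h + z) - f z = g (h + z) * (h + z - z) by near: h; exact: nbhs_dnbhs.
  by rewrite addrK /GRing.scale /= mulrC mulfK.
by apply: DeriveDef; [apply/cvg_ex; exists (g z)|exact: cvg_lim].
Unshelve. all: by end_near. Qed.

End CDeriv.

Section Cexp.
Variable R : realType.
Local Notation C := (R[i]).
Local Notation re := (@complex.Re R).
Local Notation im := (@complex.Im R).
Implicit Types z w : C.

Lemma cexp0 : cexp (0 : C) = 1.
Proof. by rewrite /cexp /= expR0 cos0 sin0 mul1r. Qed.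

Lemma cexpD z w : cexp (z + w) = cexp z * cexp w.
Proof.
case: z w => a b [c d]; rewrite /cexp /= expRD cosD sinD; simpc; congr (_ +i* _); ring.
Qed.

Lemma cexpN z : cexp (- z) = (cexp z)^-1.
Proof.
have e : cexp z * cexp (- z) = 1 by rewrite -cexpD subrr cexp0.
have n0 : cexp z != 0 by apply/eqP => e0; move: e; rewrite e0 mul0r => /eqP; rewrite eq_sym oner_eq0.
by apply: (mulfI n0); rewrite e divff.
Qed.

Lemma cexp_neq0 z : cexp z != 0.
Proof.
apply/eqP => e0; have := cexpD z (- z).
by rewrite subrr cexp0 e0 mul0r => /eqP; rewrite oner_eq0.
Qed.

Lemma cexpMn z n : cexp (z *+ n) = cexp z ^+ n.
Proof. by elim: n => [|n ih]; rewrite ?mulr0n ?cexp0 // mulrS cexpD ih exprS. Qed.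

Lemma cexpMz z (n : int) : cexp (z *~ n) = cexp z ^ n.
Proof. by case: n => n; rewrite ?pmulrn ?cexpMn // NegzE mulrNz cexpN -pmulrn cexpMn. Qed.

Lemma norm_cexp_i (x : R) : `|cexp (0 +i* x)| = 1.
Proof. by rewrite /cexp /= expR0 mul1r normc_def /= cos2Dsin2 sqrtr1. Qed.

Lemma norm_real (x : R) : `|x%:C| = `|x|%:C :> C.
Proof. by rewrite normc_def /= expr0n /= addr0 sqrtr_sqr. Qed.

Lemma norm_Re_le z : `|re z|%:C <= `|z|.
Proof. exact: normc_ge_Re. Qed.

Lemma norm_Im_le z : `|im z|%:C <= `|z|.
Proof.
rewrite normc_def lecR -(sqrtr_sqr (im z)); apply: ler_wsqrtr.
by rewrite lerDr sqr_ge0.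
Qed.

Lemma gt0_real (e : C) : 0 < e -> exists2 r : R, 0 < r & e = r%:C.
Proof.
case: e => a b; rewrite ltcE /= => /andP[/eqP b0 ?]; exists a => //.
by rewrite b0.
Qed.

Lemma Re_continuous : continuous (fun z : C^o => re z : R^o).
Proof.
move=> z; apply/(@cvgrPdist_lt _ _ _ (nbhs (z : C^o)) (nbhs_filter _)) => e e0.
have : \forall w \near (z : C^o), `|z - w| < e%:C.
  by exists e%:C => //=; rewrite ltcR.
apply: filterS => w h.
have := le_lt_trans (norm_Re_le (z - w)) h; rewrite ltcR.
by case: (z) (w) => a b [c d].
Qed.

Lemma Im_continuous : continuous (fun z : C^o => im z : R^o).
Proof.
move=> z; apply/(@cvgrPdist_lt _ _ _ (nbhs (z : C^o)) (nbhs_filter _)) => e e0.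
have : \forall w \near (z : C^o), `|z - w| < e%:C.
  by exists e%:C => //=; rewrite ltcR.
apply: filterS => w h.
have := le_lt_trans (norm_Im_le (z - w)) h; rewrite ltcR.
by case: (z) (w) => a b [c d].
Qed.

Lemma real_complex_continuous : continuous (fun x : R^o => x%:C : C^o).
Proof.
move=> x; apply/cvgrPdist_lt => e /gt0_real[r r0 ->].
have : \forall w \near (x : R^o), `|x - w| < r.
  by exists r.
by apply: filterS => w h; rewrite -rmorphB /= norm_real ltcR.
Qed.

(** The real Caratheodory quotients [A], [B], [S] of exp, cos and sin at 0 give
    [cexp w - 1 - w = p w * Re w + q w * Im w] with [p] and [q] tending to 0. *)
Lemma cexp_cderiv0 : cderiv (@cexp R) 0 1.
Proof.
have [A [eA cA A0]] := (is_derive1_caratheodory _ _ _).1 (is_derive_expR (0 : R)).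
have [B [eB cB B0]] := (is_derive1_caratheodory _ _ _).1 (is_derive_cos (0 : R)).
have [S [eS cS S0]] := (is_derive1_caratheodory _ _ _).1 (is_derive_sin (0 : R)).
rewrite expR0 in A0; rewrite sin0 oppr0 in B0; rewrite cos0 in S0.
pose p (w : C^o) : C^o := (A (re w))%:C - 1.
pose q (w : C^o) : C^o := (expR (re w))%:C * ((B (im w))%:C + 'i * (S (im w))%:C) - 'i.
have cRe : {for 0, continuous (fun z : C^o => re z : R^o)} by exact: Re_continuous.
have cIm : {for 0, continuous (fun z : C^o => im z : R^o)} by exact: Im_continuous.
have lift (f : R^o -> R^o) (k : C^o -> R^o) : {for 0, continuous k} -> {for k 0, continuous f} ->
    {for 0, continuous (fun w : C^o => (f (k w))%:C : C^o)}.
  move=> ck cf.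
  have c1 : {for 0, continuous (f \o k)} by exact: continuous_comp.
  have c2 := (continuous_comp c1 (@real_complex_continuous _)).
  exact: c2.
have cp : {for 0, continuous p}.
  by rewrite /p; apply: contB; [exact: lift|exact: cont_cst].
have cq : {for 0, continuous q}.
  rewrite /q; apply: contB; last exact: cont_cst.
  apply: contM; first by apply: lift => //; exact: continuous_expR.
  by apply: contD; [|apply: contM; [exact: cont_cst|]]; apply: lift.
have p0 : p 0 = 0 by rewrite /p /= A0 subrr.
have q0 : q 0 = 0 by rewrite /q /= expR0 B0 S0 mul1r add0r mulr1 subrr.
have cp0 : p w @[w --> nbhs (0 : C^o)] --> (0 : C^o) by rewrite -{2}p0; exact: cp.
have cq0 : q w @[w --> nbhs (0 : C^o)] --> (0 : C^o) by rewrite -{2}q0; exact: cq.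
have key w : cexp w - 1 - w = p w * (re w)%:C + q w * (im w)%:C.
  have := eA (re w); have := eB (im w); have := eS (im w).
  rewrite /p /q /cexp sin0 cos0 expR0 !subr0 => e1 e2 e3.
  case: w e1 e2 e3 => x y /= e1 e2 e3.
  have -> : cos y = 1 + B y * y by rewrite -e2; ring.
  rewrite e1; simpc.
  have e4 : expR x = 1 + A x * x by rewrite -e3; ring.
  congr (_ +i* _); rewrite ?e4; ring.
exists (fun w => if w == 0 then 1 else (cexp w - 1) / w); split.
- apply: near_all => w; rewrite cexp0 subr0; case: eqP => [->|/eqP w0].
    by rewrite cexp0 subrr mulr0.
  by rewrite divfK.
- rewrite /prop_for/continuous_at eqxx.
  apply/(@cvgrPdist_lt _ _ _ (nbhs (0 : C^o)) (nbhs_filter _)) => e e0.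
  have e2 : 0 < e / 2 by rewrite divr_gt0.
  have hp : \forall w \near (0 : C^o), `|p w| < e / 2.
    by apply: (@cvgr0_norm_lt _ C^o _ (nbhs (0 : C^o)) (nbhs_filter _) _ cp0 _ e2).
  have hq : \forall w \near (0 : C^o), `|q w| < e / 2.
    by apply: (@cvgr0_norm_lt _ C^o _ (nbhs (0 : C^o)) (nbhs_filter _) _ cq0 _ e2).
  apply: (near_imp2 _ hp hq) => w {}hp {}hq; case: eqP => [_|/eqP w0]; first by rewrite subrr normr0.
  have -> : 1 - (cexp w - 1) / w = - ((cexp w - 1 - w) / w) by field.
  have wp : 0 < `|w| by rewrite normr_gt0.
  rewrite normrN normrM normfV ltr_pdivrMr // key.
  apply: (le_lt_trans (ler_normD _ _)); rewrite !normrM !norm_real.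
  rewrite [e]splitr mulrDl; apply: ler_ltD.
    by apply: ler_pM; [|rewrite ler0c|exact: ltW|exact: norm_Re_le].
  apply: (@le_lt_trans _ _ (`|q w| * `|w|)); last by rewrite ltr_pM2r.
  by apply: ler_wpM2l => //; exact: norm_Im_le.
- by rewrite eqxx.
Qed.

Lemma cexp_cderiv z : cderiv (@cexp R) z (cexp z).
Proof.
have h : cderiv (fun w : C => cexp (w - z)) z 1.
  rewrite -[X in cderiv _ _ X]mulr1.
  apply: (@cderiv_comp _ (@cexp R) (fun w => w - z) z 1 1).
    by rewrite -[X in cderiv _ _ X]addr0; apply: cderivD; [exact: cderiv_id|exact: cderiv_cst].
  by rewrite subrr; exact: cexp_cderiv0.
have := cderivM (cderiv_cst (cexp z) z) h; rewrite mul0r add0r mulr1.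
by apply: cderiv_congr; apply: near_all => w; rewrite -cexpD addrC subrK.
Qed.

End Cexp.

(** * Taylor remainders of the exponential *)

Section Hol.
Variable R : realType.
Local Notation C := (R[i]).
Local Notation re := (@complex.Re R).
Local Notation im := (@complex.Im R).
Implicit Types z w : C.

Lemma ReM_real (c : C) (s : R) : re (c * s%:C) = re c * s.
Proof. by case: c => a b; simpc. Qed.

Lemma ReB (a b : C) : re (a - b) = re a - re b.
Proof. by case: a b => [? ?] [? ?]. Qed.

Lemma slice_derive (c z l : C) (F : C -> C) (s : R) : cderiv F (s%:C * z) l ->
  is_derive (s : R) 1 (fun t : R => re (c * F (t%:C * z))) (re (c * (l * z))).
Proof.
move=> [g [a b <-]].
have ct : {for s, continuous (fun t : R^o => t%:C * z : C^o)}.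
  by apply: contM; [exact: real_complex_continuous|exact: cont_cst].
apply/is_derive1_caratheodory.
(* the identity F w - F z = g w (w - z) may only hold near z *)
pose g' w := if w == s%:C * z then g w else (F w - F (s%:C * z)) / (w - s%:C * z).
have e' : {near (s%:C * z : C^o), g =1 g'}.
  apply: near_imp a => w ew; rewrite /g'; case: eqP => // /eqP n.
  by rewrite ew mulfK // subr_eq0.
have cg' : {for s%:C * z, continuous (g' : C^o -> C^o)} by exact: near_continuous b.
exists (fun t : R => re (c * (g' (t%:C * z) * z))); split.
- move=> t; rewrite -ReM_real rmorphB /= -ReB -mulrBr.
  congr (re _); rewrite -!mulrA; congr (c * _).
  rewrite [_ * (t%:C - s%:C)]mulrC mulrBl /g'; case: eqP => [->|/eqP n].
    by rewrite !subrr mulr0.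
  by rewrite divfK // subr_eq0.
- have c1 : {for s, continuous (fun t : R^o => c * (g' (t%:C * z) * z) : C^o)}.
    apply: contM; first exact: cont_cst.
    apply: contM; last exact: cont_cst.
    exact: (continuous_comp ct cg').
  exact: (continuous_comp c1 (@Re_continuous R _)).
- by rewrite /g' eqxx.
Qed.

(** The real mean value theorem applied to [t |-> Re (c F(t z))], where [c]
    is the conjugate of [F z]. *)
Lemma complex_mvt (F F' : C -> C) z : (forall w, cderiv F w (F' w)) -> F 0 = 0 ->
  exists2 s : R, 0 <= s <= 1 & `|F z| <= `|F' (s%:C * z)| * `|z|.
Proof.
move=> hF F0; pose c := (F z)^*.
have d (s : R) := @slice_derive c z _ F s (hF _).
have dcont : {within `[0, 1], continuous (fun t : R => re (c * F (t%:C * z)))}.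
  by apply: derivable_within_continuous => x _; have [] := d x.
have [s] := @MVT_segment R (fun t => re (c * F (t%:C * z))) (fun t => re (c * (F' (t%:C * z) * z))) 0 1 ler01 (fun x _ => d x) dcont.
rewrite in_itv /= => hs; rewrite mul1r mul0r F0 mulr0 subr0 subr0 mulr1 => e.
exists s => //.
have [->|n0] := eqVneq (F z) 0; first by rewrite normr0 mulr_ge0.
have p : 0 < `|F z| by rewrite normr_gt0.
rewrite -(ler_pM2l p) -expr2 sqr_normc mulrC -/c.
have -> : c * F z = (re (c * F z))%:C.
  by rewrite /c mulrC -sqr_normc -[LHS]RRe_real // rpredX // normr_real.
rewrite e; apply: (@le_trans _ _ (`|re (c * (F' (s%:C * z) * z))|%:C)).
  by rewrite lecR ler_norm.
apply: (le_trans (norm_Re_le _)).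
by rewrite !normrM /c normcJ.
Qed.

Definition expo_rem n z : C := cexp z - \sum_(k < n) z ^+ k / k`!%:R.

Lemma fact_neq0 n : n`!%:R != 0 :> C.
Proof. by rewrite pnatr_eq0 -lt0n fact_gt0. Qed.

Lemma cderivX n z : cderiv (fun w : C => w ^+ n) z (n%:R * z ^+ n.-1).
Proof.
elim: n => [|n ih]; first by rewrite mul0r; exact: cderiv_cst.
have := cderivM (cderiv_id z) ih; rewrite mul1r /=.
have -> : z ^+ n + z * (n%:R * z ^+ n.-1) = n.+1%:R * z ^+ n.
  case: n {ih} => [|n]; first by rewrite mulr0n mul0r mulr0 addr0 mul1r.
  by rewrite /= mulrCA -exprS -[in RHS]nat1r mulrDl mul1r.
by apply: cderiv_congr; apply: near_all => w; rewrite exprS.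
Qed.

Lemma cderiv_sum n (f : 'I_n -> C -> C) (l : 'I_n -> C) z :
  (forall k, cderiv (f k) z (l k)) -> cderiv (fun w => \sum_k f k w) z (\sum_k l k).
Proof.
elim: n f l => [|n ih] f l h.
  rewrite big_ord0; apply: (cderiv_congr _ (cderiv_cst 0 z)).
  by apply: near_all => w; rewrite big_ord0.
rewrite big_ord_recl; have := cderivD (h ord0) (ih _ _ (fun k => h (lift ord0 k))).
by apply: cderiv_congr; apply: near_all => w; rewrite big_ord_recl.
Qed.

Lemma cderivZ (c : C) f z l : cderiv f z l -> cderiv (fun w => c * f w) z (c * l).
Proof. by move=> h; have := cderivM (cderiv_cst c z) h; rewrite mul0r add0r. Qed.

Lemma cderivN (f : C -> C) z l : cderiv f z l -> cderiv (fun w => - f w) z (- l).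
Proof.
move=> h; have := cderivZ (-1) h; rewrite mulN1r.
by apply: cderiv_congr; apply: near_all => w; rewrite mulN1r.
Qed.

Lemma expo_rem_deriv n z : cderiv (expo_rem n.+1) z (expo_rem n z).
Proof.
apply: cderivD; first exact: cexp_cderiv.
apply: cderivN; rewrite /expo_rem.
have e : \sum_(k < n) z ^+ k / k`!%:R = \sum_(k < n.+1) (k`!%:R)^-1 * (k%:R * z ^+ k.-1).
  rewrite big_ord_recl /= mul0r mulr0 add0r; apply: eq_bigr => k _ /=.
  rewrite /bump /= add1n /= factS natrM.
  have : (k.+1%:R : C) != 0 by rewrite pnatr_eq0.
  have := fact_neq0 k; set f := k`!%:R; set n1 := k.+1%:R => f0 n0.
  move: f f0 n1 n0 => f f0 n1 n0; field; exact/andP.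
rewrite e.
have := @cderiv_sum n.+1 (fun k w => (k`!%:R)^-1 * w ^+ k) _ z (fun k => cderivZ _ (cderivX k z)).
by apply: cderiv_congr; apply: near_all => w; apply: eq_bigr => k _; rewrite mulrC.
Qed.

Lemma expo_rem0 n : expo_rem n.+1 0 = 0.
Proof.
rewrite /expo_rem cexp0 big_ord_recl expr0 /= fact0 divr1 big1 ?addr0 ?subrr // => k _.
by rewrite expr0n /= mul0r.
Qed.

(** Each remainder is a primitive of the previous one, so that the mean value
    inequality gains one power of [z]. *)
Lemma expo_rem_bound n : exists2 M : R, 0 <= M &
  forall z, `|z| <= 1 -> `|expo_rem n z| <= M%:C * `|z| ^+ n.
Proof.
elim: n => [|n [M M0 ih]].
  exists (expR 1) => [|z z1]; first exact: expR_ge0.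
  rewrite /expo_rem big_ord0 subr0 expr0 mulr1 /cexp normrM norm_real.
  rewrite normc_def /= cos2Dsin2 sqrtr1 mulr1 lecR ger0_norm ?expR_ge0 // ler_expR.
  have := le_trans (norm_Re_le z) z1; rewrite lecR; exact: le_trans (ler_norm _).
exists M => // z z1.
have [s /andP[s0 s1] h] := complex_mvt z (@expo_rem_deriv n) (@expo_rem0 n).
apply: (le_trans h); rewrite exprSr mulrA; apply: ler_wpM2r => //.
have sz : `|s%:C * z| <= `|z|.
  by rewrite normrM norm_real (ger0_norm s0) ler_piMl // lecR.
apply: (le_trans (ih _ (le_trans sz z1))).
apply: ler_wpM2l; first by rewrite lecR.
by apply: lerXn2r; rewrite ?nnegrE.
Qed.

(** [ephi n z] is the sum of [z^k / (n+k)!]: the exponential series divided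
    [n] times by [z].  The family is stable under differentiation and under
    [f |-> (f - f 0) / z]. *)
Definition ephi n z : C := if z == 0 then n`!%:R^-1 else expo_rem n z / z ^+ n.

Lemma ephi_at0 n : ephi n 0 = n`!%:R^-1.
Proof. by rewrite /ephi eqxx. Qed.

Lemma ephiS n z : ephi n z = ephi n 0 + z * ephi n.+1 z.
Proof.
rewrite ephi_at0 /ephi; case: eqP => [->|/eqP z0]; first by rewrite mul0r addr0.
rewrite /expo_rem big_ord_recr /= exprS.
set S := \sum_(i < n) _.
field.
by rewrite z0 fact_neq0 expf_neq0.
Qed.

Lemma ephi0E z : ephi 0 z = cexp z.
Proof.
by rewrite /ephi /expo_rem big_ord0 subr0 expr0 divr1 fact0 invr1; case: eqP => // ->; rewrite cexp0.
Qed.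

Lemma ephi_cont0 n : {for 0, continuous (ephi n : C^o -> C^o)}.
Proof.
have [M M0 h] := expo_rem_bound n.+1.
apply/(@cvgrPdist_lt _ _ _ (nbhs (0 : C^o)) (nbhs_filter _)) => _ /gt0_real[e e0 ->].
have M1 : 0 < M + 1 by exact: ltr_wpDl.
have d0 : 0 < Num.min 1 (e / (M + 1)) by rewrite lt_min ltr01 /=; exact: divr_gt0.
exists ((Num.min 1 (e / (M + 1)))%:C) => [|z /=]; first by rewrite /= ltcR.
have [->|n0] := eqVneq z 0; first by move=> _; rewrite subrr normr0 ltcR.
rewrite sub0r normrN => zd.
have z1 : `|z| <= 1.
  by apply/ltW/(lt_le_trans zd); rewrite -(rmorph1 (real_complex R)) lecR ge_min lexx.
have z2 : `|z| <= (e / (M + 1))%:C.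
  by apply/ltW/(lt_le_trans zd); rewrite lecR ge_min lexx orbT.
rewrite [ephi n z]ephiS opprD addrA subrr sub0r normrN normrM.
rewrite /ephi (negbTE n0).
have zp : 0 < `|z| by rewrite normr_gt0.
apply: (@le_lt_trans _ _ (`|z| * M%:C)).
  apply: ler_wpM2l => //; rewrite normrM normfV normrX ler_pdivrMr ?exprn_gt0 //.
  exact: h.
apply: (@le_lt_trans _ _ ((e / (M + 1))%:C * M%:C)).
  by apply: ler_wpM2r; rewrite ?ler0c.
rewrite -rmorphM ltcR mulrAC ltr_pdivrMr // ltr_pM2l // ltrDl //.
Qed.

Lemma ephi_deriv n z : cderiv (ephi n) z (ephi n z - n%:R * ephi n.+1 z).
Proof.
have [->|z0] := eqVneq z 0.
  exists (ephi n.+1); split.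
  - by apply: near_all => w; rewrite [ephi n w]ephiS subr0; ring.
  - exact: ephi_cont0.
  - rewrite !ephi_at0 factS natrM; field.
    by rewrite fact_neq0 nat1r pnatr_eq0.
have ne : \forall w \near (z : C^o), expo_rem n w / w ^+ n = ephi n w.
  have : \forall w \near (z : C^o), w != 0.
    apply: (@cvgr_neq0 _ C^o _ (nbhs (z : C^o)) (nbhs_filter _) id z) => //.
  by apply: near_imp => w /negbTE w0; rewrite /ephi w0.
apply: (cderiv_congr ne).
have dV := @cderivV _ (fun w : C => w ^+ n) z _ (expf_neq0 n z0) (cderivX n z).
case: n {ne} dV => [|n] dV.
  rewrite mul0r subr0 ephi0E; apply: (cderiv_congr _ (cexp_cderiv z)).
  by apply: near_all => w; rewrite /expo_rem big_ord0 subr0 expr0 divr1.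
have := cderivM (expo_rem_deriv n z) dV.
congr cderiv; rewrite /ephi (negbTE z0) /expo_rem !big_ord_recr /= !exprS.
set S := \sum_(i < n) _; rewrite !factS !natrM.
field.
by rewrite z0 expf_neq0 // fact_neq0 nat1r pnatr_eq0.
Qed.

End Hol.

(** * Meromorphic germs and residues *)

Lemma punct_lim_uniq (K : numFieldType) (f : K^o -> K^o) (z l1 l2 : K^o) :
  f x @[x --> z^'] --> l1 -> f x @[x --> z^'] --> l2 -> l1 = l2.
Proof. by move=> h1 h2; exact: (cvg_unique _ h1 h2). Qed.

Lemma cderiv_near_eq (K : numFieldType) (f1 f2 : K -> K) z l1 l2 :
  (\forall w \near (z : K^o), f1 w = f2 w) ->
  cderiv f1 z l1 -> cderiv f2 z l2 -> l1 = l2.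
Proof.
move=> e; apply: cderiv_punct; first exact: nbhs_dnbhs.
exact: (nbhs_singleton e).
Qed.

Lemma cderiv_eq (K : numFieldType) (f1 f2 : K -> K) z l1 l2 :
  (\forall w \near (z : K^o), f1 w = f2 w) -> l1 = l2 ->
  cderiv f1 z l1 -> cderiv f2 z l2.
Proof. by move=> e <-; exact: cderiv_congr. Qed.

Section Residue.
Variable R : realType.
Local Notation C := (R[i]).
Implicit Types (z w c d : C) (f g h : C -> C).

(** The germs at 0 generated by the exponential series: a class of holomorphic
    germs in which derivatives and Taylor expansions are given by explicit
    formulas. *)
Inductive hol : (C -> C) -> Prop :=
| hol_cst c : hol (fun=> c)
| hol_ephi n c : hol (fun z => ephi n (c * z))
| hol_add f g : hol f -> hol g -> hol (fun z => f z + g z)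
| hol_mul f g : hol f -> hol g -> hol (fun z => f z * g z)
| hol_inv f : hol f -> f 0 != 0 -> hol (fun z => (f z)^-1).

(** The class is closed under differentiation and under division of
    [f - f 0] by [z]; iterating the latter gives Taylor expansions. *)
Lemma hol_tower f : hol f -> exists f' f1,
  [/\ hol f', hol f1, \forall z \near (0 : C^o), cderiv f z (f' z)
    & \forall z \near (0 : C^o), f z = f 0 + z * f1 z].
Proof.
elim=> {f} [c|n c|f g hf [f' [f1 [a1 a2 a3 a4]]] hg [g' [g1 [b1 b2 b3 b4]]]|
  f g hf [f' [f1 [a1 a2 a3 a4]]] hg [g' [g1 [b1 b2 b3 b4]]]|f hf [f' [f1 [a1 a2 a3 a4]]] f0].
- exists (fun=> 0), (fun=> 0); split; try exact: hol_cst.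
    by apply: near_all => z; exact: cderiv_cst.
  by apply: near_all => z; rewrite mulr0 addr0.
- exists (fun z => c * (ephi n (c * z) + (- n%:R) * ephi n.+1 (c * z))),
    (fun z => c * ephi n.+1 (c * z)); split.
  + apply: (@hol_mul (fun=> c)); first exact: hol_cst.
    apply: (@hol_add (fun z => ephi n (c * z))); first exact: hol_ephi.
    by apply: (@hol_mul (fun=> - n%:R)); [exact: hol_cst|exact: hol_ephi].
  + by apply: (@hol_mul (fun=> c)); [exact: hol_cst|exact: hol_ephi].
  + apply: near_all => z; rewrite mulNr mulrC.
    apply: (@cderiv_comp _ (ephi n) (fun w => c * w)); last exact: ephi_deriv.
    by have := cderivZ c (cderiv_id z); rewrite mulr1.
  + by apply: near_all => z; rewrite mulr0 ephiS mulrCA mulrA.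
- exists (fun z => f' z + g' z), (fun z => f1 z + g1 z); split; try exact: hol_add.
    by apply: near_imp2 a3 b3 => z; exact: cderivD.
  by apply: near_imp2 a4 b4 => z -> ->; ring.
- exists (fun z => f' z * g z + f z * g' z), (fun z => f1 z * g z + f 0 * g1 z); split.
  + by apply: hol_add; exact: hol_mul.
  + apply: hol_add; first exact: hol_mul.
    by apply: (@hol_mul (fun=> f 0)) => //; exact: hol_cst.
  + by apply: near_imp2 a3 b3 => z; exact: cderivM.
  + by apply: near_imp2 a4 b4 => z ef eg; rewrite [in RHS]mulrDr mulrA -[_ * f1 z]addr0 {1}ef {1}eg [in RHS]eg; ring.
- have n0 : \forall z \near (0 : C^o), f z != 0.
    have a30 := nbhs_singleton a3.
    exact: (@cvgr_neq0 _ C^o _ (nbhs (0 : C^o)) (nbhs_filter _) f _ (cderiv_cont a30)).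
  have hV := hol_inv hf f0.
  exists (fun z => (- 1) * f' z * ((f z)^-1 * (f z)^-1)),
    (fun z => (- (f 0)^-1) * (f1 z * (f z)^-1)); split.
  + apply: (@hol_mul (fun z => -1 * f' z)); last exact: (hol_mul hV hV).
    by apply: (@hol_mul (fun=> -1)) => //; exact: hol_cst.
  + by apply: (@hol_mul (fun=> - (f 0)^-1)); [exact: hol_cst|exact: hol_mul].
  + apply: near_imp2 a3 n0 => z d nz; have := cderivV nz d.
    by rewrite mulN1r -invfM expr2.
  + apply: near_imp2 a4 n0 => z e nz.
    have e1 : z * f1 z = f z - f 0 by rewrite e addrAC subrr add0r.
    have -> : z * (- (f 0)^-1 * (f1 z * (f z)^-1)) = - (f 0)^-1 * (f z)^-1 * (z * f1 z) by ring.
    by rewrite e1; field; exact/andP.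
Qed.

Lemma hol_derivable f : hol f -> \forall z \near (0 : C^o), derivable (f : C^o -> C^o) z 1.
Proof.
move=> /hol_tower[f' [_ [_ _ h _]]].
by apply: near_imp h => z /cderiv_derivable[].
Qed.

Lemma hol_cont f : hol f -> {for 0, continuous (f : C^o -> C^o)}.
Proof. by move=> /hol_tower[f' [_ [_ _ /nbhs_singleton /cderiv_cont h _]]]. Qed.

Lemma hol_taylor f n : hol f -> exists (c : nat -> C) (g : C -> C), hol g /\
  \forall z \near (0 : C^o), f z = \sum_(i < n) c i * z ^+ i + z ^+ n * g z.
Proof.
move=> hf; elim: n => [|n [c [g [hg e]]]].
  exists (fun=> 0), f; split=> //; apply: near_all => z.
  by rewrite big_ord0 add0r expr0 mul1r.
have [_ [g1 [_ hg1 _ eg]]] := hol_tower hg.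
exists (fun i => if (i < n)%N then c i else g 0), g1; split=> //.
apply: near_imp2 e eg => z -> ->.
rewrite big_ord_recr /= ltnn mulrDr addrA [_ * g 0]mulrC mulrA -exprSr.
by congr (_ + _ + _); apply: eq_bigr => i _; rewrite ltn_ord.
Qed.

Lemma punct0 (P : set C) : (\forall z \near (0 : C^o), P z) -> \forall z \near (0 : C^o)^', P z.
Proof. exact: nbhs_dnbhs. Qed.

Lemma punct_imp (P Q : set C) : (forall z, z != 0 -> P z -> Q z) ->
  (\forall z \near (0 : C^o)^', P z) -> \forall z \near (0 : C^o)^', Q z.
Proof.
move=> h hP; have hn := nbhs_dnbhs_neq (0 : C^o).
near=> z; apply: h; first by near: z.
by near: z.
Unshelve. all: by end_near. Qed.

Lemma punct_imp2 (P Q S : set C) : (forall z, z != 0 -> P z -> Q z -> S z) ->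
  (\forall z \near (0 : C^o)^', P z) -> (\forall z \near (0 : C^o)^', Q z) ->
  \forall z \near (0 : C^o)^', S z.
Proof.
move=> h hP hQ; have hn := nbhs_dnbhs_neq (0 : C^o).
by near=> z; apply: h; near: z.
Unshelve. all: by end_near. Qed.

Lemma punct_near (P : set C) : (\forall z \near (0 : C^o)^', P z) ->
  \forall z \near (0 : C^o)^', \forall w \near (z : C^o), P w.
Proof.
move=> h; have h1 : \forall z \near (0 : C^o), z != 0 -> P z.
  by move: h; rewrite near_withinE.
have h2 := near_join h1.
apply: punct_imp (punct0 h2) => z z0 h3.
have : \forall w \near (z : C^o), w != 0.
  exact: (@cvgr_neq0 _ C^o _ (nbhs (z : C^o)) (nbhs_filter _) id z).
by apply: near_imp2 h3 => w a b; exact: a.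
Qed.

Definition mero f := exists k g, hol g /\ \forall z \near (0 : C^o)^', f z = g z / z ^+ k.

Lemma mero_congr f g : (\forall z \near (0 : C^o)^', f z = g z) -> mero f -> mero g.
Proof.
move=> e [k [h [hh e']]]; exists k, h; split=> //.
by apply: punct_imp2 e e' => z _ -> ->.
Qed.

Lemma hol_mero f : hol f -> mero f.
Proof.
move=> h; exists 0%N, f; split=> //; apply: punct0; apply: near_all => z.
by rewrite expr0 divr1.
Qed.

Lemma mero_mul f g : mero f -> mero g -> mero (fun z => f z * g z).
Proof.
move=> [k [f1 [h1 e1]]] [l [g1 [h2 e2]]]; exists (k + l)%N, (fun z => f1 z * g1 z).
split; first exact: hol_mul.
by apply: punct_imp2 e1 e2 => z z0 -> ->; rewrite exprD mulf_div.
Qed.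

Lemma is_residue_congr f g c : (\forall z \near (0 : C^o)^', f z = g z) ->
  is_residue f c -> is_residue g c.
Proof.
move=> e [N [b [h [dh e']]]]; exists N, b, h; split=> //.
by apply: punct_imp2 e e' => z _ -> ->.
Qed.

Lemma is_residueD f g c d : is_residue f c -> is_residue g d ->
  is_residue (fun z => f z + g z) (c + d).
Proof.
have pad N M (b : nat -> C) z : (N <= M)%N ->
    \sum_(k < N) b k / z ^+ k.+2 = \sum_(k < M) (if (k < N)%N then b k else 0) / z ^+ k.+2.
  move=> le; rewrite (big_ord_widen M (fun k => b k / z ^+ k.+2) le) big_mkcond /=.
  by apply: eq_bigr => i _; case: ifP; rewrite ?mul0r.
move=> [N [b [h [dh e]]]] [N' [b' [h' [dh' e']]]].
exists (maxn N N'), (fun k => (if (k < N)%N then b k else 0) + (if (k < N')%N then b' k else 0)),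
  (fun z => h z + h' z); split.
  by apply: near_imp2 dh dh' => z; exact: derivableD.
apply: punct_imp2 e e' => z z0 -> ->.
rewrite (pad _ _ _ _ (leq_maxl N N')) (pad _ _ _ _ (leq_maxr N N')).
under [in RHS]eq_bigr do rewrite mulrDl.
rewrite big_split /= mulrDl; ring.
Qed.

Lemma is_residue_hol f : hol f -> is_residue f 0.
Proof.
move=> h; exists 0%N, (fun=> 0), f; split; first exact: hol_derivable.
by apply: punct0; apply: near_all => z; rewrite big_ord0 mul0r !add0r.
Qed.

Lemma is_residueZ a f c : is_residue f c -> is_residue (fun z => a * f z) (a * c).
Proof.
move=> [N [b [h [dh e]]]]; exists N, (fun k => a * b k), (fun z => a * h z); split.
  by apply: near_imp dh => z d; exact: (@derivableZ _ _ _ h a z 1 d).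
apply: punct_imp e => z z0 ->; rewrite !mulrDr mulrA mulr_sumr.
by congr (_ + _ + _); apply: eq_bigr => i _; rewrite mulrA.
Qed.

(** After multiplication by [z^n], the limit at 0 isolates the coefficient of
    the pole of highest order. *)
Lemma principal_part_eq0 n (b : nat -> C) (h : C^o -> C^o) : {for 0, continuous h} ->
  (\forall z \near (0 : C^o)^', \sum_(k < n) b k / z ^+ k.+1 + h z = 0) ->
  forall k, (k < n)%N -> b k = 0.
Proof.
move=> ch; elim: n => [//|n ih] e.
have bn : b n = 0.
  pose P z := \sum_(k < n.+1) b k * z ^+ (n - k) + z ^+ n.+1 * h z.
  have cP : {for 0, continuous (P : C^o -> C^o)}.
    apply: contD; last first.
      by apply: contM => //; apply: cderiv_cont; exact: cderivX.
    apply: (@cderiv_cont _ _ _ (\sum_(k < n.+1) b k * ((n - k)%:R * 0 ^+ (n - k).-1))).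
    by apply: (@cderiv_sum _ _ (fun k w => b k * w ^+ (n - k))) => k; apply: cderivZ; exact: cderivX.
  have P0 : P 0 = b n.
    rewrite /P expr0n /= mul0r addr0 big_ord_recr /= subnn expr0 mulr1 big1 ?add0r // => k _.
    by rewrite expr0n subn_eq0 leqNgt ltn_ord /= mulr0.
  have Pz : \forall z \near (0 : C^o)^', P z = 0.
    apply: punct_imp e => z z0 e.
    have : z ^+ n.+1 * (\sum_(k < n.+1) b k / z ^+ k.+1 + h z) = 0 by rewrite e mulr0.
    rewrite mulrDr mulr_sumr => <-; congr (_ + _); apply: eq_bigr => k _.
    have le : (k.+1 <= n.+1)%N by [].
    rewrite mulrCA; congr (_ * _).
    have -> : z ^+ n.+1 = z ^+ k.+1 * z ^+ (n - k) by rewrite -exprD addSn subnKC.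
    by rewrite mulrAC divff ?mul1r // expf_neq0.
  have c0 : (fun z => P z) @ (0 : C^o)^' --> (P 0 : C^o).
    by move=> A nA; apply: nbhs_dnbhs; exact: cP.
  have c1 : (fun z => P z) @ (0 : C^o)^' --> (0 : C^o).
    by move=> A nA; apply: (punct_imp _ Pz) => z _ /= ->; exact: (nbhs_singleton nA).
  by rewrite -P0; exact: (punct_lim_uniq c0 c1).
move=> k; rewrite ltnS leq_eqVlt => /orP[/eqP -> //|kn].
apply: ih kn; apply: punct_imp e => z z0.
by rewrite big_ord_recr /= bn mul0r addr0.
Qed.

Lemma derivable_cont (h : C^o -> C^o) : (\forall z \near (0 : C^o), derivable h z 1) ->
  {for 0, continuous h}.
Proof. by move=> /nbhs_singleton /derivable1_diffP /differentiable_continuous. Qed.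

(** The difference of two Laurent expansions is a principal part that
    extends continuously. *)
Lemma is_residue_uniq f c d : is_residue f c -> is_residue f d -> c = d.
Proof.
move=> hc hd.
have h := is_residueD hc (is_residueZ (-1) hd).
have [N [b [g [dg e]]]] : is_residue (fun=> 0) (c - d).
  rewrite mulN1r in h; apply: is_residue_congr h; apply: punct0; apply: near_all => z.
  by rewrite mulN1r subrr.
pose b' k := if k is k'.+1 then b k' else c - d.
have : b' 0%N = 0.
  apply: (@principal_part_eq0 N.+1 b' g (derivable_cont dg)) => //.
  apply: punct_imp e => z z0 e1.
  by rewrite [RHS]e1 big_ord_recl /= expr1.
by move=> /eqP; rewrite subr_eq0 => /eqP.
Qed.

Lemma residue0E f c : is_residue f c -> residue0 f = c.
Proof.
move=> h; apply: (@is_residue_uniq f) => //.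
by rewrite /residue0; case: xgetP => [x -> //|/(_ c)].
Qed.

Lemma mero_laurent f : mero f -> exists N (b : nat -> C) h c, hol h /\
  \forall z \near (0 : C^o)^', f z = c / z + \sum_(k < N) b k / z ^+ k.+2 + h z.
Proof.
move=> [[|k] [g [hg e]]].
  exists 0%N, (fun=> 0), g, 0; split=> //; apply: punct_imp e => z _ ->.
  by rewrite big_ord0 mul0r !add0r expr0 divr1.
have [c [h [hh eg]]] := hol_taylor k.+1 hg.
exists k, (fun j => c (k - j.+1)%N), h, (c k); split=> //.
apply: punct_imp2 e (punct0 eg) => z z0 -> ->.
rewrite mulrDl [z ^+ k.+1 * _]mulrC mulfK ?expf_neq0 //; congr (_ + _).
rewrite mulr_suml big_ord_recr /= addrC; congr (_ + _).
  by rewrite exprSr invfM mulrA mulfK // expf_neq0.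
rewrite (reindex_inj rev_ord_inj) /=; apply: eq_bigr => j _.
have -> : z ^+ k.+1 = z ^+ (k - j.+1) * z ^+ j.+2 by rewrite -exprD addnS subnK.
by rewrite invfM -mulrA mulVKf // expf_neq0.
Qed.

Lemma mero_residue f : mero f -> is_residue f (residue0 f).
Proof.
move=> /mero_laurent[N [b [h [c [hh e]]]]].
have r : is_residue f c by exists N, b, h; split=> //; exact: hol_derivable.
by rewrite (residue0E r).
Qed.

(** No term of a Laurent series has [c / z] as derivative. *)
Lemma mero_deriv_residue F f : mero F ->
  (\forall z \near (0 : C^o)^', cderiv F z (f z)) -> is_residue f 0.
Proof.
move=> /mero_laurent[N [b [h [c [hh e]]]]] dF.
have [h' [_ [hh' _ dh _]]] := hol_tower hh.
exists N.+1, (fun k => if k is k'.+1 then - (k.+1)%:R * b k' else - c), h'; split.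
  exact: hol_derivable.
have e2 := punct_near e.
have dV n z : z != 0 -> cderiv (fun w : C => (w ^+ n)^-1) z (- n%:R / z ^+ n.+1).
  move=> z0; have := @cderivV _ (fun w : C => w ^+ n) z _ (expf_neq0 n z0) (cderivX n z).
  congr cderiv; case: n => [|n]; first by rewrite mulr0n mul0r oppr0 !mul0r.
  by rewrite /= !exprS; field; rewrite z0 expf_neq0.
have {}dh := punct0 dh.
have h3 : \forall z \near (0 : C^o)^', cderiv F z (f z) /\ cderiv h z (h' z).
  by apply: punct_imp2 dF dh => z _ hF hhz; split.
apply: punct_imp2 e2 h3 => z z0 ez [dFz dhz].
apply: (@cderiv_near_eq _ _ _ _ _ _ ez dFz).
rewrite mul0r add0r big_ord_recl /=.
have d1 := cderivZ c (dV 1%N _ z0).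
have d2 : cderiv (fun w => \sum_(k < N) b k / w ^+ k.+2) z
    (\sum_(k < N) b k * (- k.+2%:R / z ^+ k.+3)).
  by apply: (@cderiv_sum _ _ (fun k w => b k / w ^+ k.+2)) => k; apply: cderivZ; exact: dV.
have := cderivD (cderivD d1 d2) dhz.
apply: cderiv_eq.
- by apply: near_all.
- congr (_ + _ + _); first by rewrite mulrA mulrN mulr1.
  by apply: eq_bigr => k _; rewrite /bump /= add1n mulrA [b k * _]mulrC.
Qed.

End Residue.

(** * Sums of residues over the nonzero complex numbers *)

Lemma fsbigD_supp (K : nmodType) (I : choiceType) (A : set I) (f g : I -> K) :
  finite_set (A `&` [set i | f i != 0]) -> finite_set (A `&` [set i | g i != 0]) ->
  \sum_(i \in A) (f i + g i) = \sum_(i \in A) f i + \sum_(i \in A) g i.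
Proof.
move=> ff fg; pose B := (A `&` [set i | f i != 0]) `|` (A `&` [set i | g i != 0]).
have fB : finite_set B by rewrite finite_setU.
have sB : B `<=` A by move=> i [] [].
have nB i : (A `\` B) i -> f i = 0 /\ g i = 0.
  move=> [Ai nBi]; split; apply/eqP/negP => /negP h; apply: nBi; [left|right]; split => //.
rewrite -(@fsbig_widen _ _ _ _ B A f) //; last by move=> i /nB[].
rewrite -(@fsbig_widen _ _ _ _ B A g) //; last by move=> i /nB[].
rewrite -(@fsbig_widen _ _ _ _ B A (fun i => f i + g i)) //.
  exact: fsbig_split.
by move=> i /nB[/= -> ->]; rewrite addr0.
Qed.

Lemma finite_supp_sum (K : fieldType) (I : choiceType) (A : set I) (J : Type) (s : seq J)
  (c : J -> K) (F : J -> I -> K) :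
  (forall j, finite_set (A `&` [set i | F j i != 0])) ->
  finite_set (A `&` [set i | \sum_(j <- s) c j * F j i != 0]).
Proof.
move=> hF; elim: s => [|j s ih].
  by apply: (sub_finite_set _ (finite_set0 _)) => i [_ /=]; rewrite big_nil eqxx.
apply: (@sub_finite_set _ _ ((A `&` [set i | F j i != 0]) `|` (A `&` [set i | \sum_(j <- s) c j * F j i != 0]))).
  move=> i [Ai /=]; rewrite big_cons => h.
  have [e|n] := eqVneq (F j i) 0; last by left.
  by right; split=> //; move: h; rewrite e mulr0 add0r.
by rewrite finite_setU.
Qed.

Lemma fsbig_lin (K : fieldType) (I : choiceType) (A : set I) (J : Type) (s : seq J)
  (c : J -> K) (F : J -> I -> K) :
  (forall j, finite_set (A `&` [set i | F j i != 0])) ->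
  \sum_(i \in A) (\sum_(j <- s) c j * F j i) = \sum_(j <- s) c j * \sum_(i \in A) F j i.
Proof.
move=> hF; elim: s => [|j s ih].
  by rewrite big_nil fsbig1 // => i _; rewrite big_nil.
rewrite big_cons -ih mulr_fsumr.
under eq_fsbigr do rewrite big_cons.
rewrite fsbigD_supp //; last exact: finite_supp_sum.
by apply: sub_finite_set (hF j) => i [Ai /=]; rewrite mulf_eq0 negb_or => /andP[_ h].
Qed.

Section ResSum.
Variable R : realType.
Local Notation C := (R[i]).
Implicit Types (f : C -> C) (rho z u : C).

(** The residue at [u = rho] of the differential form [f(u) du / u], read in the
    coordinate [u = rho e^z]. *)
Definition res f rho := residue0 (fun z => f (rho * cexp z)).
Definition units0 : set C := [set rho | rho != 0].
(** The sum over all [rho] is a sum of finite support, hence additive in [f]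
    only in presence of this condition. *)
Definition res_finite f := (forall rho, rho != 0 -> mero (fun z => f (rho * cexp z))) /\
  finite_set (units0 `&` [set rho | res f rho != 0]).
Definition ressum f := \sum_(rho \in units0) res f rho.

Lemma mero_residue_lin (J : Type) (s : seq J) (c : J -> C) (F : J -> C -> C) f :
  (forall j, mero (F j)) -> (\forall z \near (0 : C^o)^', f z = \sum_(j <- s) c j * F j z) ->
  is_residue f (\sum_(j <- s) c j * residue0 (F j)).
Proof.
move=> mF e.
suff h : is_residue (fun z => \sum_(j <- s) c j * F j z) (\sum_(j <- s) c j * residue0 (F j)).
  by apply: is_residue_congr h; apply: punct_imp e => z _ ->.
elim: s {e} => [|j s ih].
  rewrite big_nil; apply: is_residue_congr (is_residue_hol (hol_cst 0)).
  by apply: punct0; apply: near_all => z; rewrite big_nil.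
rewrite big_cons; apply: is_residue_congr (is_residueD (is_residueZ (c j) (mero_residue (mF j))) ih).
by apply: punct0; apply: near_all => z; rewrite big_cons.
Qed.

Lemma ressum_lin (J : Type) (s : seq J) (c : J -> C) (F : J -> C -> C) f :
  (forall j, res_finite (F j)) ->
  (forall rho, rho != 0 -> \forall z \near (0 : C^o)^',
     f (rho * cexp z) = \sum_(j <- s) c j * F j (rho * cexp z)) ->
  ressum f = \sum_(j <- s) c j * ressum (F j).
Proof.
move=> nF e.
rewrite -[RHS](@fsbig_lin _ _ units0 _ s c (fun j => res (F j))); last by move=> j; case: (nF j).
apply: eq_fsbigr => rho; rewrite inE => r0.
apply: residue0E; apply: (@mero_residue_lin _ s c (fun j z => F j (rho * cexp z))).
  by move=> j; apply: (nF j).1.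
exact: e.
Qed.

Lemma cexp_int (m : int) : cexp (0 +i* (2 * pi * m%:~R) : C) = 1.
Proof.
have E (x : R) : (0 +i* x : C) = 'i * x%:C by simpc.
rewrite E [(2 * pi * _)%:C]rmorphM rmorph_int mulrA mulrzr -E.
rewrite cexpMz; suff -> : cexp (0 +i* (2 * pi) : C) = 1 by rewrite exp1rz.
rewrite /cexp /= expR0 mul1r.
have -> : 2 * pi = pi *+ 2 :> R by rewrite mulr_natl.
by rewrite cos2pi sin2pi.
Qed.

Lemma cexp_period (x : R) : cexp (0 +i* (2 * pi * x) : C) = 1 -> x \is a Num.int.
Proof.
set y := x - (Num.floor x)%:~R.
have xy : x = y + (Num.floor x)%:~R by rewrite subrK.
have y0 : 0 <= y by rewrite subr_ge0 floor_le.
have y1 : y < 1 by rewrite ltrBlDl -[X in _ + X]/(1%:~R) -intrD floorD1_gt.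
rewrite xy.
have -> : (0 +i* (2 * pi * (y + (Num.floor x)%:~R)) : C) =
    (0 +i* (2 * pi * y)) + (0 +i* (2 * pi * (Num.floor x)%:~R)) by simpc; rewrite mulrDr.
rewrite cexpD cexp_int mulr1 /cexp /= expR0 mul1r => /(congr1 (@complex.Re R)) /= cy.
have [->|yn0] := eqVneq y 0; first by rewrite add0r intr_int.
have pp := pi_gt0 R.
have s0 : 0 < sin (pi * y).
  apply: sin_gt0_pi; apply/andP; split; first by rewrite mulr_gt0 // lt_neqAle eq_sym yn0.
  by rewrite gtr_pMr.
move: cy; have -> : 2 * pi * y = (pi * y) *+ 2 by rewrite mulr2n; ring.
rewrite cos_mulr2n => cy.
have := cos2Dsin2 (pi * y).
have : 0 < sin (pi * y) ^+ 2 by rewrite exprn_gt0.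
move: cy; rewrite mulr2n; lra.
Qed.

(** The roots are one of them times the powers of [exp (2 i pi / m)]; their
    power sums are geometric. *)
Lemma mth_roots (m : nat) (c : C) : (0 < m)%N -> c != 0 ->
  exists zeta : 'I_m -> C, (forall i, zeta i ^+ m = c) /\
    forall k, (k < m)%N -> \sum_i zeta i ^+ k = if k == 0%N then m%:R else 0.
Proof.
move=> m0 c0; pose om : C := cexp (0 +i* (2 * pi * m%:R^-1)).
have omk (k : nat) : om ^+ k = cexp (0 +i* (2 * pi * (k%:R / m%:R))).
  rewrite -cexpMn; congr cexp.
  elim: k => [|k ih]; first by rewrite mulr0n mul0r mulr0.
  rewrite mulrS ih; simpc; congr (_ +i* _).
  by rewrite -natr1; ring.
have mR : m%:R != 0 :> R by rewrite pnatr_eq0 -lt0n.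
have om_m : om ^+ m = 1 by rewrite omk divff // -[1]/(1%:~R) cexp_int.
have om_k k : (0 < k < m)%N -> om ^+ k != 1.
  move=> /andP[k0 km]; apply/negP => /eqP; rewrite omk => /cexp_period /intrP[q e].
  have q0 : 0 < k%:R / m%:R :> R by rewrite divr_gt0 // ltr0n.
  have q1 : k%:R / m%:R < 1 :> R by rewrite ltr_pdivrMr ?ltr0n // mul1r ltr_nat.
  by move: q0 q1; rewrite e ltr0z -[1]/(1%:~R) ltr_int; case: q {e} => [[|q]|q].
exists (fun i => m.-root c * om ^+ i); split=> [i|k km].
  by rewrite exprMn rootCK // -exprM mulnC exprM om_m expr1n mulr1.
case: eqP => [->|/eqP kn0].
  by under eq_bigr do rewrite expr0; rewrite sumr_const card_ord.
under eq_bigr do rewrite exprMn -exprM mulnC exprM.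
rewrite -mulr_sumr; apply/eqP; rewrite mulf_eq0; apply/orP; right.
have n1 : om ^+ k - 1 != 0 by rewrite subr_eq0 om_k // lt0n kn0.
by rewrite -(inj_eq (mulfI n1)) mulr0 -subrX1 -exprM mulnC exprM om_m expr1n subrr.
Qed.

End ResSum.

(** * Products of inverses of binomials 1 - c / u^m *)

Lemma frac_split (K : fieldType) (a b c d P : K) : d = 1 - c * b -> d != 0 ->
  a / P = 1 * (a / (d * P)) + - c * (a * b / (d * P)).
Proof.
move=> e d0; have -> : a / P = a * d * (d^-1 * P^-1) by rewrite mulrA mulfK.
by rewrite invfM {1}e; ring.
Qed.

Section OneDim.
Variable R : realType.
Local Notation C := (R[i]).
Implicit Types (rho z u c : C) (L : seq (int * C)) (j m : int).

(** The two forms on the integers; the solution operators for [int_up] and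
    [int_down] expand [1 / (1 - c u^-m)] at infinity and at 0. *)
Definition int_up (m : int) : R := m%:~R.
Definition int_down (m : int) : R := - m%:~R.

Lemma int_upB : {morph int_up : x y / x - y}.
Proof. by move=> x y; rewrite /int_up intrB. Qed.
Lemma int_downB : {morph int_down : x y / x - y}.
Proof. by move=> x y; rewrite /int_down intrB; ring. Qed.

Definition ratfac (p : int * C) u := 1 - p.2 * u ^ (- p.1).
Definition ratfun L j u := u ^ j / \prod_(p <- L) ratfac p u.

Definition nz_pair (p : int * C) := (p.1 != 0) && (p.2 != 0).

Definition delta0 j : C := (j == 0)%:R.
(** The coefficient of [u^-j] in the expansion at infinity of the product of the
    [1 / (1 - c u^-m)], minus the one in the expansion at 0. *)
Definition jump L j : C := invnabs int_up L delta0 j - invnabs int_down L delta0 j.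

Lemma nz_pairE L : all nz_pair L -> all (good int_up) L /\ all (good int_down) L.
Proof.
move=> gL; split; apply/allP => p /(allP gL) /andP[p1 p2]; rewrite /good p2 andbT /int_up /int_down ?normrN;
  by rewrite -intr_norm -[X in X <= _]/(1%:~R) ler_int; move: p1; case: (p.1) => [[]|].
Qed.

Lemma delta_supp e : e = int_up \/ e = int_down -> supp e 0 delta0.
Proof.
move=> he a; rewrite /delta0; case: eqP => // ->; case: he => ->; rewrite /int_up /int_down ?oppr0 ltxx //.
Qed.
Lemma delta_supp1 : supp int_up 0 delta0. Proof. by apply: delta_supp; left. Qed.
Lemma delta_supp2 : supp int_down 0 delta0. Proof. by apply: delta_supp; right. Qed.

Lemma jump_rec p L j : all nz_pair (p :: L) ->
  jump (p :: L) j - p.2 * jump (p :: L) (j - p.1) = jump L j.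
Proof.
move=> gL; have [g1 g2] := nz_pairE gL.
have := nab_invnabs int_upB g1 delta_supp1; move/(congr1 (fun f => f j)).
have := nab_invnabs int_downB g2 delta_supp2; move/(congr1 (fun f => f j)).
rewrite /nab /jump => <- <-; ring.
Qed.

Lemma jump_nil j : jump [::] j = 0.
Proof. by rewrite /jump /= subrr. Qed.

Lemma jump_perm L L' j : all nz_pair L -> perm_eq L L' -> jump L j = jump L' j.
Proof.
move=> gL LL'; have [g1 g2] := nz_pairE gL.
by rewrite /jump (invnabs_perm int_upB g1 delta_supp1 LL') (invnabs_perm int_downB g2 delta_supp2 LL').
Qed.

Lemma ratfun_perm L L' j : perm_eq L L' -> ratfun L j = ratfun L' j.
Proof. by move=> LL'; apply/funext => u; rewrite /ratfun (perm_big _ LL'). Qed.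

Lemma ratfac_exp p rho z : rho != 0 ->
  ratfac p (rho * cexp z) = 1 - (p.2 * rho ^ (- p.1)) * cexp ((- p.1)%:~R * z).
Proof. by move=> r0; rewrite /ratfac exprzMl ?unitfE // ?cexp_neq0 // -cexpMz mulrzl mulrA. Qed.

Lemma cexp_ephi (c : C) : (fun z => cexp (c * z)) = (fun z => ephi 0 (c * z)).
Proof. by apply/funext => z; rewrite ephi0E. Qed.

Lemma hol_cexp (c : C) : hol (fun z => cexp (c * z)).
Proof. by rewrite cexp_ephi; exact: hol_ephi. Qed.

Lemma hol_1sub (c m : C) : hol (fun z => 1 - c * cexp (m * z)).
Proof.
have -> : (fun z => 1 - c * cexp (m * z)) = (fun z => 1 + (- c) * cexp (m * z)).
  by apply/funext => z; rewrite mulNr.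
apply: (@hol_add _ (fun=> 1)); first exact: hol_cst.
by apply: (@hol_mul _ (fun=> - c)); [exact: hol_cst|exact: hol_cexp].
Qed.

Lemma factor_hol (c m : C) : c != 1 -> hol (fun z => (1 - c * cexp (m * z))^-1).
Proof.
move=> c1; apply: (hol_inv (hol_1sub c m)).
by rewrite mulr0 cexp0 mulr1 subr_eq0 eq_sym.
Qed.

Lemma cexp1_sub (m z : C) : 1 - 1 * cexp (m * z) = z * (- m * ephi 1 (m * z)).
Proof.
rewrite mul1r -ephi0E ephiS ephi_at0 fact0 invr1; ring.
Qed.

Lemma hol_ephi1 (m : C) : m != 0 -> hol (fun z => (- m * ephi 1 (m * z))^-1).
Proof.
move=> m0; apply: (@hol_inv _ (fun z => - m * ephi 1 (m * z))).
  by apply: (@hol_mul _ (fun=> - m)); [exact: hol_cst|exact: hol_ephi].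
by rewrite mulr0 ephi_at0 factS fact0 muln1 invr1 mulr1 oppr_eq0.
Qed.

Lemma factor_mero (c m : C) : m != 0 -> mero (fun z => (1 - c * cexp (m * z))^-1).
Proof.
move=> m0; have [->|c1] := eqVneq c 1; last exact/hol_mero/factor_hol.
exists 1%N, (fun z => (- m * ephi 1 (m * z))^-1); split; first exact: hol_ephi1.
by apply: punct0; apply: near_all => z; rewrite cexp1_sub invfM expr1 mulrC.
Qed.

Lemma hol_near_neq0 (f : C -> C) : hol f -> f 0 != 0 -> \forall z \near (0 : C^o), f z != 0.
Proof.
move=> hf f0; exact: (@cvgr_neq0 _ C^o _ (nbhs (0 : C^o)) (nbhs_filter _) f _ (hol_cont hf)).
Qed.

Lemma factor_neq0 (c m : C) : m != 0 -> \forall z \near (0 : C^o)^', 1 - c * cexp (m * z) != 0.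
Proof.
move=> m0; have [->|c1] := eqVneq c 1.
  have h : \forall z \near (0 : C^o), (- m * ephi 1 (m * z)) != 0.
    apply: (@hol_near_neq0 (fun z => - m * ephi 1 (m * z))).
      by apply: (@hol_mul _ (fun=> - m)); [exact: hol_cst|exact: hol_ephi].
    by rewrite mulr0 ephi_at0 factS fact0 muln1 invr1 mulr1 oppr_eq0.
  by apply: punct_imp (punct0 h) => z z0 h'; rewrite cexp1_sub mulf_neq0.
apply: punct0; apply: (hol_near_neq0 (hol_1sub c m)).
by rewrite mulr0 cexp0 mulr1 subr_eq0 eq_sym.
Qed.

Lemma ratfac_neq0 p rho : nz_pair p -> rho != 0 ->
  \forall z \near (0 : C^o)^', ratfac p (rho * cexp z) != 0.
Proof.
move=> /andP[p1 _] r0.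
have m0 : (- p.1)%:~R != 0 :> C by rewrite intr_eq0 oppr_eq0.
by apply: punct_imp (factor_neq0 (p.2 * rho ^ (- p.1)) m0) => z _; rewrite ratfac_exp.
Qed.

Lemma ratfun_exp L j rho z : rho != 0 -> ratfun L j (rho * cexp z) =
  rho ^ j * cexp (j%:~R * z) * \prod_(p <- L) (ratfac p (rho * cexp z))^-1.
Proof.
by move=> r0; rewrite /ratfun exprzMl ?unitfE ?cexp_neq0 // -cexpMz mulrzl -prodfV.
Qed.

Lemma ratfun_mero L j rho : all nz_pair L -> rho != 0 -> mero (fun z => ratfun L j (rho * cexp z)).
Proof.
move=> gL r0; rewrite (funext (fun z => ratfun_exp L j z r0)).
apply: mero_mul.
  by apply: hol_mero; apply: (@hol_mul _ (fun=> rho ^ j)); [exact: hol_cst|exact: hol_cexp].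
elim: L gL => [|p L ih] /=.
  move=> _; apply: (mero_congr _ (hol_mero (hol_cst 1))); apply: punct0; apply: near_all => z.
  by rewrite big_nil.
move=> /andP[/andP[p1 p2] gL].
have m0 : (- p.1)%:~R != 0 :> C by rewrite intr_eq0 oppr_eq0.
apply: (mero_congr _ (mero_mul (factor_mero (p.2 * rho ^ (- p.1)) m0) (ih gL))).
by apply: punct0; apply: near_all => z; rewrite big_cons ratfac_exp.
Qed.

(** No factor of the denominator vanishes at [rho], so the function is
    holomorphic there. *)
Lemma ratfun_res0 L j rho : (forall p, p \in L -> p.2 * rho ^ (- p.1) != 1) -> rho != 0 ->
  res (ratfun L j) rho = 0.
Proof.
move=> nL r0; apply: residue0E; rewrite (funext (fun z => ratfun_exp L j z r0)).
apply: is_residue_hol; apply: hol_mul.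
  by apply: (@hol_mul _ (fun=> rho ^ j)); [exact: hol_cst|exact: hol_cexp].
elim: L nL => [|p L ih] nL.
  by rewrite (_ : (fun z => _) = (fun=> 1)); [exact: hol_cst|apply/funext => z; rewrite big_nil].
have nL' q : q \in L -> q.2 * rho ^ (- q.1) != 1 by move=> qL; apply: nL; rewrite in_cons qL orbT.
have := hol_mul (factor_hol (- p.1)%:~R (nL p (mem_head _ _))) (ih nL').
by rewrite (_ : (fun z => _ * _) = (fun z => \prod_(p <- p :: L) (ratfac p (rho * cexp z))^-1)) //;
  apply/funext => z; rewrite big_cons ratfac_exp.
Qed.

Lemma finite_roots (n : nat) (c : C) : (0 < n)%N -> finite_set [set x : C | x ^+ n = c].
Proof.
move=> n0; have [r e] := closed_field_poly_normal ('X^n - c%:P : {poly C}).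
have lc : lead_coef ('X^n - c%:P : {poly C}) = 1 by rewrite lead_coefDl ?lead_coefXn // size_polyXn size_polyN (leq_ltn_trans (size_polyC_leq1 _)).
apply: (@sub_finite_set _ _ [set` r]); last exact: finite_seq.
move=> x /= xc; rewrite -root_prod_XsubC -[\prod_(_ <- _) _]scale1r -lc -e.
by rewrite rootE !hornerE xc subrr.
Qed.

Lemma ratfun_res_finite L j : all nz_pair L -> res_finite (ratfun L j).
Proof.
move=> gL; split=> [rho|]; first exact: ratfun_mero.
apply: (@sub_finite_set _ _ (\bigcup_(p in [set` L]) [set rho : C | rho != 0 /\ p.2 * rho ^ (- p.1) = 1])).
  move=> rho [/= r0 h]; apply: contrapT => nb; move/negP: h; apply.
  apply/eqP/ratfun_res0 => // p pL; apply/negP => /eqP e; apply: nb; by exists p.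
apply: bigcup_finite; first exact: finite_seq.
move=> p /= /(allP gL) /andP[p1 p2].
case E : p.1 => [n|n].
- apply: (@sub_finite_set _ _ [set x : C | x ^+ n = p.2]).
    move=> x [x0 /=]; rewrite -exprnN => h.
    by rewrite -[RHS](mulfVK (expf_neq0 n x0)) h mul1r.
  by apply: finite_roots; move: p1; rewrite E; case: n {E}.
- apply: (@sub_finite_set _ _ [set x : C | x ^+ n.+1 = p.2^-1]); last exact: finite_roots.
  move=> x [x0 /=]; rewrite NegzE opprK -exprnP => h.
  by apply: (mulfI p2); rewrite h divff.
Qed.

Lemma ressum_ratfun_rec p L j : all nz_pair (p :: L) ->
  ressum (ratfun L j) = ressum (ratfun (p :: L) j) - p.2 * ressum (ratfun (p :: L) (j - p.1)).
Proof.
move=> gL; have gp : nz_pair p by case/andP: gL.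
pose F (b : bool) := if b then ratfun (p :: L) j else ratfun (p :: L) (j - p.1).
rewrite (@ressum_lin _ _ [:: true; false] (fun b : bool => if b then 1 else - p.2) F).
- by rewrite !big_cons big_nil addr0 mul1r mulNr.
- by case; exact: ratfun_res_finite.
- move=> rho r0; apply: punct_imp (ratfac_neq0 gp r0) => z z0 dn.
  rewrite !big_cons big_nil addr0 /F /ratfun !big_cons; set u := rho * cexp z in dn *.
  have u0 : u != 0 by rewrite mulf_neq0 // cexp_neq0.
  rewrite expfzDr //; set P := \prod_(_ <- _) _.
  exact: (@frac_split _ (u ^ j) (u ^ (- p.1)) p.2 _ P erefl dn).
Qed.

(** The residue theorem says that [defect] vanishes: the sum of the residues of
    [ratfun L j] at the nonzero points is the difference of its expansions at
    infinity and at 0. *)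
Definition defect L j := ressum (ratfun L j) - jump L j.

(** Multiplying [ratfun (p :: L) j] by its first denominator removes the
    factor, and [jump] satisfies the same recursion. *)
Lemma defect_rec p L j : all nz_pair (p :: L) ->
  defect (p :: L) j = p.2 * defect (p :: L) (j - p.1) + defect L j.
Proof. by move=> gL; rewrite /defect -(jump_rec j gL) (ressum_ratfun_rec j gL); ring. Qed.

Lemma defect_perm L L' j : all nz_pair L -> perm_eq L L' -> defect L j = defect L' j.
Proof. by move=> gL LL'; rewrite /defect (jump_perm j gL LL') (ratfun_perm j LL'). Qed.

Lemma defect_nil j : defect [::] j = 0.
Proof.
rewrite /defect jump_nil subr0 /ressum fsbig1 // => rho r0.
by apply: ratfun_res0.
Qed.

Definition units1 (s : seq C) : seq (int * C) := [seq (1, rho) | rho <- s].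

Lemma good_units1 s : all (fun rho => rho != 0) s -> all nz_pair (units1 s).
Proof. by move=> h; rewrite all_map; apply/allP => r /(allP h). Qed.

End OneDim.

(** * The residue theorem for these functions *)

Section OneDimMain.
Variable R : realType.
Local Notation C := (R[i]).
Implicit Types (rho z u c : C) (L : seq (int * C)) (j m : int).
Local Notation int_up := (@int_up R).
Local Notation int_down := (@int_down R).
Local Notation s1 := (@delta_supp1 R).
Local Notation s2 := (@delta_supp2 R).
Local Notation defect := (@defect R).

Lemma jump_one (sigma : C) : sigma != 0 -> jump [:: (1, sigma)] 0 = 1.
Proof.
move=> s0.
rewrite /jump -[invnabs int_up _ _]/(invnab int_up (1, sigma) _) -[invnabs int_down _ _]/(invnab int_down (1, sigma) _).
have p1 : 0 < int_up 1 by rewrite /int_up ltr01.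
have n2 : int_down 1 < 0 by rewrite /int_down oppr_lt0 ltr01.
have h1 : int_up 0 < 1%:R by rewrite /int_up ltr01.
have h2 : int_down 0 < 1%:R by rewrite /int_down oppr0 ltr01.
have g1 : good int_up (1 : int, sigma) by rewrite /good /= s0 andbT /int_up normr1 lexx.
have g2 : good int_down (1 : int, sigma) by rewrite /good /= s0 andbT /int_down normrN1 lexx.
rewrite (@invnab_pos _ _ _ _ (@int_upB R) (1 : int, sigma) _ 0 1 g1 p1 s1 h1).
rewrite (@invnab_neg _ _ _ _ (@int_downB R) (1 : int, sigma) _ 0 1 g2 n2 s2 h2).
by rewrite !big_ord1 /delta0 /= expr0 mul1r mulr0 oppr0 subr0.
Qed.

Lemma jump_many (s : seq C) : (1 < size s)%N -> all (fun rho => rho != 0) s ->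
  jump (units1 s) (-1) = 0.
Proof.
move=> ss s0; have gL := good_units1 s0; have [g1 g2] := nz_pairE gL.
rewrite /jump (invnabs_supp (@int_upB R) g1 s1); last by rewrite /int_up mulrN1z oppr_lt0 ltr01.
rewrite sub0r; apply/eqP; rewrite oppr_eq0; apply/eqP.
have h (t : seq C) : all (fun rho => rho != 0) t -> supp int_down (size t)%:R (invnabs int_down (units1 t) (@delta0 R)).
  elim: t => [_|r t ih /= /andP[r0 t0]]; first exact: s2.
  have gp : good int_down (1, r) by rewrite /good /int_down /= normrN1 lexx.
  have := invnab_supp (@int_downB R) gp (ih t0); rewrite /int_down /= opprK max_r ?ler01 // natr1.
  exact.
apply: (h s s0); rewrite /int_down mulrN1z opprK.
by rewrite -[1]/(1%:R) ltr_nat.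
Qed.

Lemma cexpN_factor z : 1 - cexp (- z) = z * ephi 1 (- z) :> C.
Proof. rewrite -ephi0E ephiS ephi_at0 fact0 invr1; ring. Qed.

Lemma is_residue_1sub : is_residue (fun z : C => (1 - cexp (- z))^-1) 1.
Proof.
have hh : hol (fun z : C => (ephi 1 (- z))^-1).
  have h : hol (fun z : C => ephi 1 (- z)).
    by rewrite (_ : (fun z => _) = (fun z : C => ephi 1 (-1 * z))); [exact: hol_ephi|apply/funext => z; rewrite mulN1r].
  by apply: (hol_inv h); rewrite oppr0 ephi_at0 factS fact0 muln1 invr1 oner_eq0.
have [_ [g1 [_ hg1 _ e]]] := hol_tower hh.
exists 0%N, (fun=> 0), g1; split; first exact: hol_derivable.
apply: punct_imp (punct0 e) => z z0 ez.
rewrite big_ord0 addr0 cexpN_factor invfM ez oppr0 ephi_at0 factS fact0 muln1 !invr1 mulrDr mulr1 mul1r.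
by rewrite mulKf.
Qed.

(** For a pole of order at least 2 and [j = -1] the form is exact, with a
    power of [1 / (1 - e^-z)] as primitive. *)
Lemma is_residue_power k (sigma : C) : sigma != 0 ->
  is_residue (fun z : C => sigma^-1 * (cexp (- z) / (1 - cexp (- z)) ^+ k.+2)) 0.
Proof.
move=> s0.
pose F z : C := (- sigma^-1 / k.+1%:R) * ((1 - cexp (- z))^-1) ^+ k.+1.
apply: (@mero_deriv_residue _ F).
- apply: mero_mul; first exact: (hol_mero (hol_cst _)).
  elim: k {F} => [|k ih].
    have h1 := @factor_mero R 1 (-1); rewrite oppr_eq0 oner_eq0 in h1.
    apply: (mero_congr _ (h1 isT)); apply: punct0; apply: near_all => z.
    by rewrite mul1r mulN1r expr1.
  have h1 := @factor_mero R 1 (-1); rewrite oppr_eq0 oner_eq0 in h1.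
  apply: (mero_congr _ (mero_mul (h1 isT) ih)); apply: punct0; apply: near_all => z.
  by rewrite mul1r mulN1r [in RHS]exprS.
- have h := @factor_neq0 R 1 (-1); rewrite oppr_eq0 oner_eq0 in h.
  apply: punct_imp (h isT) => z z0; rewrite mul1r mulN1r => n0.
  have dN : cderiv (fun w : C => cexp (- w)) z (cexp (- z) * -1).
    apply: (@cderiv_comp _ (@cexp R) (fun w => - w)); last exact: cexp_cderiv.
    exact: (cderivN (cderiv_id z)).
  have d1 := cderivD (cderiv_cst (1 : C) z) (cderivN dN).
  have d2 := @cderivV _ (fun w : C => 1 - cexp (- w)) z _ n0 d1.
  have d3 := cderivZ (- sigma^-1 / k.+1%:R) (@cderiv_comp _ (fun x : C => x ^+ k.+1) (fun w : C => (1 - cexp (- w))^-1) z _ _ d2 (cderivX k.+1 _)).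
  move: d3; congr cderiv => /=.
  set x := cexp (- z) in n0 *; rewrite add0r mulrN1 opprK.
  rewrite exprVn !exprS.
  have k0 : (k.+1%:R : C) != 0 by rewrite pnatr_eq0.
  move: (k.+1%:R : C) k0 => K k0.
  by field; rewrite k0 s0 n0 expf_neq0.
Qed.

Lemma ressum_const_power n (sigma : C) : sigma != 0 ->
  ressum (ratfun (units1 (nseq n.+1 sigma)) (if n is 0%N then 0 else -1)) = (n == 0%N)%:R.
Proof.
move=> s0; set j := (X in ratfun _ X).
rewrite /ressum -(@fsbig_widen _ _ _ _ [set sigma] (@units0 R)); first last.
- move=> rho [r0 ns]; apply: ratfun_res0 => // p; rewrite /units1 map_nseq mem_nseq => /andP[_ /eqP ->] /=.
  apply/negP => /eqP e; apply: ns => /=; apply/esym.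
  by rewrite -[LHS](mulfVK r0) -exprN1 e mul1r.
- by move=> rho /= ->.
rewrite fsbig_set1; apply: residue0E.
have dE z : ratfac (1, sigma) (sigma * cexp z) = 1 - cexp (- z).
  by rewrite ratfac_exp //= exprN1 divff // mul1r mulrN1z mulN1r.
have gE z : ratfun (units1 (nseq n.+1 sigma)) j (sigma * cexp z) =
    sigma ^ j * cexp (j%:~R * z) * ((1 - cexp (- z)) ^+ n.+1)^-1.
  rewrite ratfun_exp // big_map; congr (_ * _).
  elim: (n.+1) => [|k ih]; first by rewrite big_nil expr0 invr1.
  by rewrite big_cons ih dE exprS invfM.
rewrite (funext gE).
clear gE; rewrite {}/j; case: n => [|n] /=.
  apply: is_residue_congr is_residue_1sub; apply: punct0; apply: near_all => z.
  by rewrite mulr0z mul0r cexp0 expr1 !mul1r.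
apply: is_residue_congr (is_residue_power n s0); apply: punct0; apply: near_all => z.
by rewrite mulrN1z mulN1r exprN1 mulrA.
Qed.

(** By [defect_rec] and induction on the number of factors, [defect] at [j] is
    [rho] times [defect] at [j - 1], for each [rho] of the list.  Two distinct
    values of [rho] force [defect] to vanish; if all are equal, it vanishes as
    soon as it does for one [j], which is computed: [j = 0] for a simple pole,
    [j = -1] otherwise. *)
Lemma defect_units1 (s : seq C) j : all (fun rho => rho != 0) s -> defect (units1 s) j = 0.
Proof.
move: {2}(size s) (erefl (size s)) => n; elim: n s j => [|n ih] s j.
  by move/size0nil => -> _; exact: defect_nil.
move=> ss s0; have gs := good_units1 s0.
have rec rho k : rho \in s -> defect (units1 s) k = rho * defect (units1 s) (k - 1).
  move=> rs; have P : perm_eq (units1 s) ((1, rho) :: units1 (rem rho s)).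
    by rewrite -[_ :: _]/(units1 (rho :: rem rho s)); apply/perm_map/perm_to_rem.
  have g' : all (@nz_pair R) ((1, rho) :: units1 (rem rho s)) by rewrite -(perm_all _ P).
  rewrite !(defect_perm _ gs P) (defect_rec k g') /= ih ?addr0 //.
  - by rewrite size_rem // ss.
  - by apply/allP => r /mem_rem /(allP s0).
case: s ss s0 gs rec => // sigma s ss s0 gs rec.
have [/allP same|/allPn[rho rs nrs]] := boolP (all (fun rho => rho == sigma) s); last first.
  (* two recursions with different ratios *)
  have h1 := rec rho (j + 1) (ltac:(by rewrite in_cons rs orbT)).
  have h2 := rec sigma (j + 1) (mem_head _ _).
  move: h1; rewrite h2 addrK => /eqP; rewrite -subr_eq0 -mulrBl mulf_eq0 subr_eq0 eq_sym.
  by rewrite (negbTE nrs) /= => /eqP.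
have sn : sigma :: s = nseq n.+1 sigma.
  rewrite -ss; apply/all_pred1P; apply/allP => r.
  by rewrite in_cons => /orP[//|rin]; exact: same.
have sg0 : sigma != 0 by apply: (allP s0); exact: mem_head.
have dj : defect (units1 (sigma :: s)) (if n is 0%N then 0 else -1) = 0.
  rewrite /defect sn ressum_const_power //; case: n ih ss sn => [|n] _ ss sn.
    by rewrite /= jump_one // subrr.
  by rewrite /= -[_ :: _]/(units1 (nseq n.+2 sigma)) -sn jump_many // ?subrr // ss.
move: dj; set j0 : int := (X in defect _ X) => dj.
(* from the computed value, upwards and downwards *)
have {}rec k := rec sigma k (mem_head _ _).
have up (k : nat) : defect (units1 (sigma :: s)) (j0 + k%:Z) = 0.
  elim: k => [|k ihk]; first by rewrite addr0.
  by rewrite rec -addrA intS [1 + _]addrC addrK ihk mulr0.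
have down (k : nat) : defect (units1 (sigma :: s)) (j0 - k%:Z) = 0.
  elim: k => [|k ihk]; first by rewrite subr0.
  move: ihk; rewrite rec -addrA -opprD [_ + 1]addrC -intS => /eqP.
  by rewrite mulf_eq0 (negbTE sg0) /= => /eqP.
by rewrite -[j](subrK j0) addrC; case: (j - j0) => k; rewrite ?NegzE.
Qed.

(** Partial fractions, read off the geometric sums
    [(1 - (zeta u)^m) / (1 - zeta u)]: in their mean over [zeta] only the
    constant term survives, by the values of the power sums. *)
Lemma frac_roots (m : nat) (c u : C) (zeta : 'I_m -> C) : (0 < m)%N ->
  (forall i, zeta i ^+ m = c) ->
  (forall k, (k < m)%N -> \sum_i zeta i ^+ k = if k == 0%N then m%:R else 0) ->
  1 - c * u ^+ m != 0 ->
  (1 - c * u ^+ m)^-1 = \sum_i m%:R^-1 * (1 - zeta i * u)^-1.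
Proof.
move=> m0 zm zs n0.
have e i : (1 - zeta i * u) * (\sum_(k < m) (zeta i * u) ^+ k) = 1 - c * u ^+ m.
  by apply: oppr_inj; rewrite -mulNr !opprB -subrX1 exprMn zm.
have zn i : 1 - zeta i * u != 0 by apply/eqP => e0; move: (e i) n0; rewrite e0 mul0r => <-; rewrite eqxx.
have e' i : (1 - zeta i * u)^-1 = (\sum_(k < m) (zeta i * u) ^+ k) * (1 - c * u ^+ m)^-1.
  by rewrite -(e i) invfM mulrCA mulfV ?mulr1 //; apply/eqP => e0; move: (e i) n0; rewrite e0 mulr0 => <-; rewrite eqxx.
under eq_bigr do rewrite e' mulrA.
rewrite -mulr_suml -mulr_sumr exchange_big /=.
have -> : \sum_(k < m) \sum_i (zeta i * u) ^+ k = m%:R.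
  rewrite (bigD1 (Ordinal m0)) //= [X in _ + X]big1 ?addr0.
    by under eq_bigr do rewrite /= expr0; rewrite sumr_const card_ord.
  move=> k kn; under eq_bigr do rewrite exprMn.
  rewrite -mulr_suml zs // -val_eqE /= in kn *.
  by rewrite (negbTE kn) mul0r.
by rewrite mulVf ?mul1r // pnatr_eq0 -lt0n.
Qed.

(** The solution operators follow the same partial fraction decomposition:
    by uniqueness it is enough that both sides solve the equation of order
    [m], and the mean of the [(1 - zeta T)^-1] does. *)
Lemma invnab_roots (e : int -> R) (h : int -> C) (m : nat) (c : C) (zeta : 'I_m -> C) :
  e = int_up \/ e = int_down -> supp e 0 h ->
  (0 < m)%N -> c != 0 -> (forall i, zeta i ^+ m = c) ->
  (forall k, (k < m)%N -> \sum_i zeta i ^+ k = if k == 0%N then m%:R else 0) ->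
  invnab e (m%:Z, c) h = fun j => \sum_i m%:R^-1 * invnab e (1, zeta i) h j.
Proof.
move=> he sh m0 c0 zm zs.
have eB : {morph e : x y / x - y} by case: he => ->; [exact: int_upB|exact: int_downB].
have zn i : zeta i != 0 by apply/eqP => e0; move: (zm i) c0; rewrite e0 expr0n -(prednK m0) /= => <-; rewrite eqxx.
have gm : good e (m%:Z, c).
  by rewrite /good c0 andbT; case: he => ->; rewrite /int_up /int_down ?normrN normr_nat -[1]/(1%:R) ler_nat.
have gi i : good e (1 : int, zeta i).
  by rewrite /good zn andbT; case: he => ->; rewrite /int_up /int_down ?normrN normr1.
apply/esym; apply: (@invnabs_uniq _ _ _ _ eB [:: (m%:Z, c)]) => //=.
- by rewrite gm.
- by apply: supp_lin => i; exact: invnab_supp0.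
rewrite nab_lin; apply/funext => j.
have tele i k : invnab e (1 : int, zeta i) h j - zeta i ^+ k * invnab e (1 : int, zeta i) h (j - k%:Z) =
    \sum_(t < k) zeta i ^+ t * h (j - t%:Z).
  elim: k => [|k ih]; first by rewrite big_ord0 expr0 mul1r subr0 subrr.
  rewrite big_ord_recr /= -ih; have /(congr1 (fun f => f (j - k%:Z))) := nab_invnab eB (gi i) sh.
  rewrite /nab /= -addrA -opprD => <-; rewrite exprSr intS [k%:Z + 1]addrC; ring.
rewrite (eq_bigr (fun i => m%:R^-1 * \sum_(t < m) zeta i ^+ t * h (j - t%:Z))); last first.
  by move=> i _; rewrite -tele /nab /= zm.
rewrite -mulr_sumr exchange_big /= (bigD1 (Ordinal m0)) //= [X in _ * (_ + X)]big1 ?addr0.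
  rewrite (eq_bigr (fun=> h j)); last by move=> i _; rewrite /= expr0 mul1r; congr h; exact: subr0.
  by rewrite sumr_const card_ord -[h j *+ m]mulr_natl mulKf // pnatr_eq0 -lt0n.
move=> k kn; rewrite -mulr_suml zs // -val_eqE /= in kn *.
by rewrite (negbTE kn) mul0r.
Qed.

Lemma defect_roots (m : nat) (c : C) L j (zeta : 'I_m -> C) : (0 < m)%N -> c != 0 ->
  (forall i, zeta i ^+ m = c) ->
  (forall k, (k < m)%N -> \sum_i zeta i ^+ k = if k == 0%N then m%:R else 0) ->
  all (@nz_pair R) L ->
  defect ((m%:Z, c) :: L) j = \sum_i m%:R^-1 * defect ((1, zeta i) :: L) j.
Proof.
move=> m0 c0 zm zs gL; have [g1 g2] := nz_pairE gL.
have zn i : zeta i != 0 by apply/eqP => e0; move: (zm i) c0; rewrite e0 expr0n -(prednK m0) /= => <-; rewrite eqxx.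
have gmL : all (@nz_pair R) ((m%:Z, c) :: L) by rewrite /= gL andbT /nz_pair c0 andbT /= -lt0n.
rewrite /defect; under eq_bigr do rewrite mulrBr; rewrite sumrB; congr (_ - _).
  apply: ressum_lin => [i|rho r0]; first by apply: ratfun_res_finite; rewrite /= gL /nz_pair /= zn.
  have gm : nz_pair (m%:Z, c) by case/andP: gmL.
  apply: punct_imp (ratfac_neq0 gm r0) => z z0.
  rewrite /ratfun; set u := rho * cexp z.
  rewrite big_cons [ratfac _ _]/ratfac /= -exprnN -exprVn => dn.
  rewrite invfM (frac_roots m0 zm zs dn) mulr_suml mulr_sumr; apply: eq_bigr => i _.
  rewrite big_cons [ratfac (1, _) _]/ratfac /= exprN1 [(_ * \prod_(_ <- _) _)^-1]invfM; ring.
rewrite /jump; under eq_bigr do rewrite mulrBr; rewrite sumrB.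
have h1 := invnab_roots (or_introl erefl) (invnabs_supp (@int_upB R) g1 s1) m0 c0 zm zs.
have h2 := invnab_roots (or_intror erefl) (invnabs_supp (@int_downB R) g2 s2) m0 c0 zm zs.
by rewrite /= h1 h2.
Qed.

(** [1 / (1 - x) = 1 - 1 / (1 - x^-1)], for functions and for operators. *)
Lemma defect_opp (m : int) (c : C) L j : m != 0 -> c != 0 -> all (@nz_pair R) L ->
  defect ((m, c) :: L) j = defect L j - defect ((- m, c^-1) :: L) j.
Proof.
move=> m0 c0 gL; have [g1 g2] := nz_pairE gL.
have gp : nz_pair (R := R) (m, c) by rewrite /nz_pair m0.
have gq : nz_pair (- m, c^-1) by rewrite /nz_pair oppr_eq0 m0 invr_eq0.
have gpL : all (@nz_pair R) ((m, c) :: L) by rewrite /= gp.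
have gqL : all (@nz_pair R) ((- m, c^-1) :: L) by rewrite /= gq.
have [gp1 gp2] := nz_pairE gpL; have [gq1 gq2] := nz_pairE gqL.
have key (e : int -> R) h : {morph e : x y / x - y} -> good e (m, c) -> good e (- m, c^-1) -> supp e 0 h ->
    invnab e (m, c) h = fun k => h k - invnab e (- m, c^-1) h k.
  move=> eB gep geq sh; apply/esym; apply: (@invnabs_uniq _ _ _ _ eB [:: (m, c)]) => //=.
  - by rewrite gep.
  - by move=> k k0; rewrite sh // (invnab_supp0 eB geq sh) // subrr.
  apply/funext => k; have := nab_invnab eB geq sh; rewrite /nab /= => E.
  have := congr1 (fun f => f (k - m)) E; rewrite /= opprK subrK => <-.
  by field.
rewrite /defect.
have -> : jump ((m, c) :: L) j = jump L j - jump ((- m, c^-1) :: L) j.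
  have sL1 := invnabs_supp (@int_upB R) g1 s1; have sL2 := invnabs_supp (@int_downB R) g2 s2.
  have [p1 _] := andP gp1; have [p2 _] := andP gp2.
  have [q1 _] := andP gq1; have [q2 _] := andP gq2.
  rewrite /jump /= (key int_up _ (@int_upB R) p1 q1 sL1) (key int_down _ (@int_downB R) p2 q2 sL2); ring.
suff -> : ressum (ratfun ((m, c) :: L) j) = ressum (ratfun L j) - ressum (ratfun ((- m, c^-1) :: L) j) by ring.
pose F (b : bool) := if b then ratfun L j else ratfun ((- m, c^-1) :: L) j.
rewrite (@ressum_lin _ _ [:: true; false] (fun b : bool => if b then 1 else - 1) F).
- by rewrite !big_cons big_nil addr0 mul1r mulN1r.
- by case; exact: ratfun_res_finite.
- move=> rho r0; apply: punct_imp2 (ratfac_neq0 gp r0) (ratfac_neq0 gq r0) => z z0.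
  rewrite !big_cons big_nil addr0 /F /ratfun !big_cons; set u := rho * cexp z.
  have u0 : u != 0 by rewrite mulf_neq0 // cexp_neq0.
  set P := \prod_(_ <- _) _.
  rewrite /ratfac /= opprK => d1; have -> : u ^ m = (u ^ (- m))^-1 by rewrite -invr_expz invrK.
  have : u ^ (- m) != 0 by rewrite expfz_neq0.
  move: (u ^ (- m)) d1 => x d1 x0 d2.
  have -> : (1 - c^-1 * x^-1) = - (1 - c * x) / (c * x) by field; rewrite x0 c0.
  rewrite !invfM !invrK; have [->|P0] := eqVneq P 0; first by rewrite invr0 !mulr0 addr0.
  by field; rewrite ?oppr_eq0 ?d1 ?P0 ?c0 ?x0 //= -?opprB ?oppr_eq0 ?d1.
Qed.

(** All the factors are reduced to order 1: a factor with [m < 0] is inverted,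
    a factor with [m > 0] is split along the [m]-th roots.  The list [s]
    collects the factors already reduced. *)
Theorem defect_eq0 L j : all (@nz_pair R) L -> defect L j = 0.
Proof.
suff h (s : seq C) : all (fun rho => rho != 0) s -> all (@nz_pair R) L -> defect (units1 s ++ L) j = 0.
  exact: (h [::]).
elim: L s => [|[m c] L ih] s s0 gL; first by rewrite cats0 defect_units1.
have gs := good_units1 s0.
move: gL => /= /andP[/andP[/= m0 c0] gL].
have gall : all (@nz_pair R) (units1 s ++ (m, c) :: L) by rewrite all_cat gs /= gL /nz_pair /= m0 c0.
have gsL : all (@nz_pair R) (units1 s ++ L) by rewrite all_cat gs.
have P : perm_eq (units1 s ++ (m, c) :: L) ((m, c) :: (units1 s ++ L)).
  by apply/permPl; exact: (perm_catCA _ [:: (m, c)] L).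
rewrite (defect_perm _ gall P).
have pos (k : nat) (d : C) : (0 < k)%N -> d != 0 -> defect ((k%:Z, d) :: units1 s ++ L) j = 0.
  move=> k0 d0; have [zeta [zm zs]] := mth_roots k0 d0.
  rewrite (defect_roots j k0 d0 zm zs gsL) big1 // => i _.
  have zn : zeta i != 0 by apply/eqP => e0; move: (zm i) d0; rewrite e0 expr0n -(prednK k0) /= => <-; rewrite eqxx.
  by rewrite -[_ :: _]/(units1 (zeta i :: s) ++ L) ih ?mulr0 //= zn.
case: m m0 {gall P} => k m0; first by apply: pos => //; rewrite lt0n.
rewrite (defect_opp j m0 c0 gsL) ih // NegzE opprK pos ?subrr // invr_eq0 //.
Qed.

End OneDimMain.

(** * Recurrent sequences *)

Section RecSeq.
Variable K : numFieldType.
Implicit Types (p q : {poly K}) (s t : nat -> K).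

Definition shiftop p s n := \sum_(i < size p) p`_i * s (n + i)%N.

Lemma shiftop_widen N p s n : (size p <= N)%N -> shiftop p s n = \sum_(i < N) p`_i * s (n + i)%N.
Proof.
move=> le; rewrite /shiftop (big_ord_widen N (fun i => p`_i * s (n + i)%N) le) big_mkcond.
by apply: eq_bigr => i _; case: ltnP => // h; rewrite nth_default // mul0r.
Qed.

Lemma shiftopD p q s n : shiftop (p + q) s n = shiftop p s n + shiftop q s n.
Proof.
pose N := maxn (size p) (size q).
rewrite (@shiftop_widen N (p + q)) ?size_polyD // (@shiftop_widen N p) ?leq_maxl //.
rewrite (@shiftop_widen N q) ?leq_maxr // -big_split; apply: eq_bigr => i _ /=.
by rewrite coefD mulrDl.
Qed.

Lemma shiftopC c s n : shiftop c%:P s n = c * s n.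
Proof.
rewrite (@shiftop_widen 1) ?size_polyC_leq1 // big_ord1 coefC eqxx addn0 //.
Qed.

Lemma shiftopMX p s n : shiftop (p * 'X) s n = shiftop p s n.+1.
Proof.
rewrite (@shiftop_widen (size p).+1); last first.
  by have [->|p0] := eqVneq p 0; [rewrite mul0r size_poly0|rewrite size_mulX].
rewrite big_ord_recl coefMX /= mul0r add0r; apply: eq_bigr => i _.
by rewrite coefMX /= /bump /= add1n addSnnS.
Qed.

Lemma shiftopM p q s n : shiftop (p * q) s n = shiftop p (shiftop q s) n.
Proof.
elim/poly_ind: p n => [|p c ih] n.
  by rewrite mul0r /shiftop size_poly0 !big_ord0.
rewrite mulrDl mulrAC shiftopD shiftopMX ih.
rewrite [in RHS]shiftopD shiftopMX shiftopC; congr (_ + _).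
rewrite mul_polyC; have [->|c0] := eqVneq c 0.
  by rewrite scale0r mul0r /shiftop size_poly0 big_ord0.
by rewrite /shiftop size_scale // mulr_sumr; apply: eq_bigr => i _; rewrite coefZ mulrA.
Qed.

(** The constant term of the annihilator is nonzero, so that the recurrence can
    be run backwards; this is what [recseq_eventually0] rests on. *)
Definition recseq s := exists2 p, p.[0] != 0 & forall n, shiftop p s n = 0.

Lemma shiftop_ext p s t n : s =1 t -> shiftop p s n = shiftop p t n.
Proof. by move=> e; apply: eq_bigr => i _; rewrite e. Qed.

Lemma recseq_ext s t : s =1 t -> recseq s -> recseq t.
Proof. by move=> e [p p0 h]; exists p => // n; rewrite -(h n); exact: shiftop_ext. Qed.

Lemma shiftop0 p n : shiftop p (fun=> 0) n = 0.
Proof. by rewrite /shiftop big1 // => i _; rewrite mulr0. Qed.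

Lemma recseq0 : recseq (fun=> 0).
Proof. by exists 1; [rewrite hornerC oner_eq0|move=> n; exact: shiftop0]. Qed.

Lemma recseqD s t : recseq s -> recseq t -> recseq (fun n => s n + t n).
Proof.
move=> [p p0 hp] [q q0 hq]; exists (p * q); first by rewrite hornerM mulf_neq0.
move=> n; have -> : shiftop (p * q) (fun n => s n + t n) n = shiftop (p * q) s n + shiftop (p * q) t n.
  by rewrite /shiftop -big_split; apply: eq_bigr => i _; rewrite mulrDr.
rewrite mulrC shiftopM (shiftop_ext _ _ hp) shiftop0 mulrC shiftopM.
by rewrite (shiftop_ext _ _ hq) shiftop0 addr0.
Qed.

Lemma recseqZ c s : recseq s -> recseq (fun n => c * s n).
Proof.
move=> [p p0 hp]; exists p => // n; rewrite -[RHS](mulr0 c) -(hp n) mulr_sumr.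
by apply: eq_bigr => i _; rewrite mulrCA.
Qed.

Lemma recseq_sum (I : Type) (r : seq I) (F : I -> nat -> K) :
  (forall i, recseq (F i)) -> recseq (fun n => \sum_(i <- r) F i n).
Proof.
move=> h; elim: r => [|i r ih].
  by apply: recseq_ext recseq0 => n; rewrite big_nil.
by apply: recseq_ext (recseqD (h i) ih) => n; rewrite big_cons.
Qed.

Lemma recseq_geo c : c != 0 -> recseq (fun n => c ^+ n).
Proof.
move=> c0; exists ('X - c%:P); first by rewrite hornerXsubC sub0r oppr_eq0.
move=> n; rewrite (@shiftop_widen 2) ?size_XsubC // !big_ord_recl big_ord0 !coefB !coefC !coefX /=.
by rewrite addn0 addn1 exprS; ring.
Qed.

(** If [p] annihilates [s], it maps [n s(n)] to the image of [s] under
    [p^`() * 'X], which [p] annihilates in turn. *)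
Lemma recseq_muln s : recseq s -> recseq (fun n => n%:R * s n).
Proof.
move=> [p p0 hp]; exists (p * p); first by rewrite hornerM mulf_neq0.
move=> n; rewrite shiftopM.
have e k : shiftop p (fun n => n%:R * s n) k = shiftop (p^`() * 'X) s k.
  rewrite (@shiftop_widen (size p) (p^`() * 'X)); last first.
    have [->|d0] := eqVneq p^`() 0; first by rewrite mul0r size_poly0.
    rewrite size_mulX //; apply: lt_size_deriv; apply/eqP => e; move: p0.
    by rewrite e horner0 eqxx.
  transitivity (shiftop p (fun n => n%:R * s n) k - k%:R * shiftop p s k).
    by rewrite hp mulr0 subr0.
  rewrite /shiftop mulr_sumr -sumrB.
  apply: eq_bigr => i _; rewrite coefMX; case: i => [[|i] ip] /=.
    by rewrite addn0 mul0r; ring.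
  by rewrite coef_deriv natrD -mulr_natl; ring.
rewrite (shiftop_ext _ _ e) -shiftopM mulrC shiftopM (shiftop_ext _ _ hp).
exact: shiftop0.
Qed.

Lemma recseq_lin a b s : recseq s -> recseq (fun n => (a + b * n%:R) * s n).
Proof.
move=> h; apply: recseq_ext (recseqD (recseqZ a h) (recseqZ b (recseq_muln h))) => n.
by rewrite mulrDl mulrA.
Qed.

(** The recurrence, run backwards, propagates the zeros.  This is why a
    quasi-polynomial is determined by its values far away on each line. *)
Lemma recseq_eventually0 s : recseq s -> (\forall n \near \oo, s n = 0) -> forall n, s n = 0.
Proof.
move=> [p p0 hp] [N _ hN].
have key k n : (N <= n + k)%N -> s n = 0.
  elim: k n => [|k ih] n le; first by apply: hN; rewrite /= -[n]addn0.
  have := hp n; rewrite (@shiftop_widen (size p).+1) // big_ord_recl addn0.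
  rewrite big1 ?addr0; last first.
    move=> i _; rewrite ih ?mulr0 //= /bump /= add1n addnS.
    by rewrite addSn -addnS; apply: (leq_trans le); rewrite leq_add2r leq_addr.
  by rewrite -horner_coef0 => /eqP; rewrite mulf_eq0 (negbTE p0) => /eqP.
by move=> n; apply: (key N); rewrite leq_addl.
Qed.

End RecSeq.

Section QuasiLines.
Variables (R : realType) (V : vectType R) (Gamma : set V).
Local Notation C := (R[i]).

Lemma characterD (y : torus Gamma) (a b : V) :
  character y (a + b) = character y a * character y b.
Proof. by rewrite /character -cexpD; congr cexp; simpc; rewrite linearD /= mulrDr. Qed.


Lemma polyfun_val_rec (P : mpoly.mpoly (\dim {:V}) C) (a w : V) (s : nat -> C) :
  recseq s -> recseq (fun n => s n * polyfun_val P (a + w *+ n)).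
Proof.
move=> hs; rewrite /polyfun_val.
apply: (@recseq_ext _ (fun n => \sum_(m <- mpoly.msupp P) mpoly.mcoeff m P *
   ((\prod_i ((coord (vbasis {:V}) i (a + w *+ n))%:C) ^+ m i) * s n))).
  move=> n; rewrite mpoly.mevalE mulr_sumr; apply: eq_bigr => m _; ring.
apply: recseq_sum => m; apply: recseqZ.
elim: (index_enum _) => [|i r ih].
  by apply: recseq_ext hs => n; rewrite big_nil mul1r.
suff h (k : nat) (t : nat -> C) : recseq t ->
    recseq (fun n => (coord (vbasis {:V}) i (a + w *+ n))%:C ^+ k * t n).
  by apply: recseq_ext (h (m i) _ ih) => n; rewrite big_cons mulrA.
move=> ht; elim: k => [|k ihk]; first by apply: recseq_ext ht => n; rewrite expr0 mul1r.
apply: recseq_ext (recseq_lin (coord (vbasis {:V}) i a)%:C (coord (vbasis {:V}) i w)%:C ihk) => n.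
rewrite exprS -mulrA; congr (_ * _).
by rewrite linearD raddfMn /= rmorphD rmorphMn /= mulr_natr.
Qed.

Lemma qp_val_seq (Q : quasipoly Gamma) : exists r : seq (torus Gamma), uniq r /\
  (forall y, y \notin r -> qp_coef Q y = 0) /\
  forall a, qp_val Q a = \sum_(y <- r) character y a * polyfun_val (qp_coef Q y) a.
Proof.
exists (fset_set [set y | qp_coef Q y != 0]); split; first exact: fset_uniq.
have n0 y : y \notin fset_set [set y | qp_coef Q y != 0] -> qp_coef Q y = 0.
  by rewrite in_fset_set; [rewrite notin_setE /= => /negP/negPn/eqP|exact: qp_finite].
split=> // a; rewrite /qp_val (fsbigTE (fset_set [set y | qp_coef Q y != 0])) // => y /n0 ->.
by rewrite /polyfun_val mpoly.meval0 mulr0.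
Qed.

Lemma qp_val_rec (Q : quasipoly Gamma) (a w : V) : recseq (fun n => qp_val Q (a + w *+ n)).
Proof.
have [r [_ [_ hr]]] := qp_val_seq Q.
apply: (@recseq_ext _ (fun n => \sum_(y <- r) character y (a + w *+ n) * polyfun_val (qp_coef Q y) (a + w *+ n))).
  by move=> n; rewrite hr.
apply: recseq_sum => y; apply: polyfun_val_rec.
have e n : character y a * character y w ^+ n = character y (a + w *+ n).
  elim: n => [|n ih]; first by rewrite mulr0n addr0 expr0 mulr1.
  by rewrite mulrSr addrA characterD -ih exprSr mulrA.
apply: (recseq_ext e); apply: recseqZ; apply: recseq_geo; exact: cexp_neq0.
Qed.

End QuasiLines.

(** * Recursion for partition functions *)

Section Partition.
Variables (R : realType) (V : vectType R).
Local Notation C := (R[i]).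
Implicit Types (s : seq V) (a x : V).

Definition sols s a : set {ffun 'I_(size s) -> nat} :=
  [set m : {ffun 'I_(size s) -> nat} | a = \sum_(i < size s) s`_i *+ m i].

Arguments sols : clear implicits.

Lemma sols_finite s a (u : 'Hom(V, R^o)) : (forall x, x \in s -> 1 <= u x :> R) ->
  finite_set (sols s a).
Proof.
move=> u1; pose N := (Num.truncn `|u a : R|).+1.
pose f (g : {ffun 'I_(size s) -> 'I_N.+1}) : {ffun 'I_(size s) -> nat} := [ffun i => nat_of_ord (g i)].
apply: (@sub_finite_set _ _ (f @` setT)); last by apply: finite_image; exact: finite_finset.
move=> m /= ma; have mN i : (m i < N.+1)%N.
  rewrite ltnS ltnW // -(ltr_nat R); apply: le_lt_trans (truncnS_gt _).
  apply: le_trans (ler_norm _); rewrite ma linear_sum /= (bigD1 i) //= raddfMn /=.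
  have ui (j : 'I_(size s)) : 1 <= u s`_j :> R by apply: u1; exact: mem_nth.
  apply: (@le_trans _ _ (u s`_i *+ m i : R)).
    exact: (@ler_wMn2r R (m i) 1 (u s`_i : R) (ui i)).
  rewrite lerDl sumr_ge0 // => j _; rewrite raddfMn mulrn_wge0 //.
  exact: (le_trans ler01 (ui j)).
exists [ffun i => Ordinal (mN i)] => //.
by apply/ffunP => i; rewrite !ffunE.
Qed.

Lemma partition_nil a : partition_fun [::] a = nat_of_bool (a == 0).
Proof.
rewrite /partition_fun; case: eqP => [->|a0].
  rewrite (_ : [set m | _] = [set [ffun=> 0%N]]); first by rewrite fset_set1 cardfs1.
  apply/seteqP; split=> m /=; first by move=> _; apply/ffunP => -[].
  by move=> ->; rewrite big_ord0.
rewrite (_ : [set m | _] = set0); first by rewrite fset_set0 cardfs0.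
by apply/seteqP; split=> m //=; rewrite big_ord0.
Qed.

(** Either the first multiplicity is 0, or it can be lowered by 1. *)
Lemma partition_cons x s a (u : 'Hom(V, R^o)) : (forall y, y \in x :: s -> 1 <= u y :> R) ->
  partition_fun (x :: s) a = (partition_fun s a + partition_fun (x :: s) (a - x)%R)%N.
Proof.
move=> u1.
have us y : y \in s -> 1 <= u y :> R by move=> ys; apply: u1; rewrite in_cons ys orbT.
pose f (m : {ffun 'I_(size s) -> nat}) : {ffun 'I_(size (x :: s)) -> nat} :=
  [ffun i => if unlift ord0 i is Some j then m j else 0%N].
pose g (m : {ffun 'I_(size (x :: s)) -> nat}) : {ffun 'I_(size (x :: s)) -> nat} :=
  [ffun i => if i == ord0 then (m i).+1 else m i].
have fin1 := sols_finite a us; have fin2 := sols_finite (a - x) u1.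
have E : sols (x :: s) a = f @` sols s a `|` g @` sols (x :: s) (a - x).
  apply/seteqP; split=> m /=.
    rewrite /sols /= big_ord_recl /= => ma.
    case m0 : (m ord0) => [|k].
      left; exists [ffun j => m (lift ord0 j)].
        rewrite /= ma m0 mulr0n add0r; apply: eq_bigr => i _; by rewrite ffunE.
      apply/ffunP => i; rewrite !ffunE; case: unliftP => [j ->|->]; rewrite ?ffunE //.
    right; exists [ffun i => if i == ord0 then k else m i].
      rewrite /= big_ord_recl /= ffunE eqxx.
      rewrite [X in _ = _ + X](eq_bigr (fun i : 'I_(size s) => s`_i *+ m (lift ord0 i))); last by move=> i _; rewrite ffunE.
      by apply/eqP; rewrite subr_eq ma m0 mulrS -addrA addrC.
    apply/ffunP => i; rewrite !ffunE; case: eqP => [->|//]; by rewrite m0.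
  move=> [[m' hm' <-]|[m' hm' <-]]; rewrite /sols /= big_ord_recl /=.
    rewrite /f ffunE unlift_none mulr0n add0r hm'; apply: eq_bigr => i _.
    by rewrite ffunE liftK.
  move: hm'; rewrite /sols /= big_ord_recl /= => hm'.
  rewrite [X in _ = _ + X](eq_bigr (fun i : 'I_(size s) => s`_i *+ m' (lift ord0 i))); last by move=> i _; rewrite /g ffunE.
  by rewrite /g ffunE eqxx mulrS -addrA -hm' addrC subrK.
have fI : injective f.
  move=> m1 m2 e; apply/ffunP => j; have /ffunP/(_ (lift ord0 j)) := e.
  by rewrite !ffunE liftK.
have gI : injective g.
  move=> m1 m2 e; apply/ffunP => j; have /ffunP/(_ j) := e.
  by rewrite !ffunE; case: eqP => // _ [].
rewrite /partition_fun -/(sols (x :: s) a) -/(sols s a) -/(sols (x :: s) (a - x)) E.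
rewrite fset_setU; [|exact: finite_image|exact: finite_image].
rewrite !fset_set_image // cardfsU.
rewrite [X in (_ - #|` X|)%N](_ : _ = fset0) ?cardfs0 ?subn0.
  by rewrite (card_imfset _ _ fI) (card_imfset _ _ gI).
apply/fsetP => m; rewrite !inE; apply/negbTE/negP => /andP[/imfsetP[m1 _ ->] /imfsetP[m2 _]].
by move/ffunP/(_ ord0); rewrite !ffunE unlift_none eqxx.
Qed.
End Partition.

(** * Wall crossing as a convolution *)

Section Combine.
Variables (M : zmodType) (K : numFieldType) (R : realType).
Variables (G : set M) (GB : forall a b, G a -> G b -> G (a - b)).
Variables (L : seq (M * K)) (w : M) (kP g f : M -> K).
Hypothesis GL : forall p, p \in L -> G p.1.
Hypothesis Gw : G w.

Definition on_wall (e : M -> R) (h : M -> K) a := if e a == 0 then h a else 0.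

Lemma recseq_nab (p : M * K) (h : M -> K) : (forall a v, recseq (fun n => h (a + v *+ n))) ->
  forall a v, recseq (fun n => nab p h (a + v *+ n)).
Proof.
move=> hr a v; apply: recseq_ext (recseqD (hr a v) (recseqZ (- p.2) (hr (a - p.1) v))) => n.
by rewrite /nab mulNr [a - _ + _]addrAC.
Qed.

Lemma recseq_nabs (h : M -> K) : (forall a v, recseq (fun n => h (a + v *+ n))) ->
  forall a v, recseq (fun n => nabs L h (a + v *+ n)).
Proof. by elim: L h => //= p L' ih h hr; apply: ih; exact: recseq_nab. Qed.

Section Half.
Variables (e : M -> R) (v0 : M).
Hypothesis Gv : G v0.
Hypothesis eB : {morph e : x y / x - y}.
Hypothesis gL : all (good e) L.
Hypothesis ew : e w = 0.
Hypothesis ev : e v0 < 0.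
Hypothesis diff_kP : nabs L kP = on_wall e g.
Hypothesis g_far : forall a, G a -> e a = 0 -> \forall n \near \oo, g (a + w *+ n) = f (a + w *+ n).

Let eline a n : e (a + w *+ n) = e a.
Proof. by rewrite (e_D eB) (e_Mn eB) ew mul0rn addr0. Qed.

Lemma on_wall_supp (h : M -> K) : supp e 0 (on_wall e h).
Proof. by move=> a a0; rewrite /on_wall lt_eqF. Qed.

(** The differences of [kP] are supported on the wall, and those of [k] vanish:
    they do so far below the wall, where [k] and [kP] have the same germs, hence
    everywhere by recurrence along [v0].  Therefore [kP - k] solves the same
    equation as [invnabs e L (on_wall e f)] and has the same low germ. *)
Lemma half_germ (k : M -> K) : (forall a v, recseq (fun n => k (a + v *+ n))) ->
  (forall a, G a -> e a < 0 -> \forall n \near \oo, k (a + w *+ n) = kP (a + w *+ n)) ->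
  germ0 G w (fun a => kP a - k a - invnabs e L (on_wall e f) a).
Proof.
move=> hr hk.
have low1 : low0 e G w (fun a => kP a - k a).
  exists 0 => a Ga a0; apply: filterS (hk a Ga a0) => n ->; exact: subrr.
have nk0 a : G a -> nabs L k a = 0.
  move=> Ga.
  have [C hC] := low0_nabs eB GB GL low1.
  pose D := Num.min C 0.
  have far b : G b -> e b < D -> nabs L k b = 0.
    move=> Gb; rewrite lt_min => /andP[bC b0].
    have := @recseq_eventually0 _ (fun n => nabs L k (b + w *+ n)) (recseq_nabs hr b w) _ 0%N.
    rewrite mulr0n addr0; apply; apply: filterS (hC b Gb bC) => n.
    by rewrite (nabsB L kP k) diff_kP /on_wall eline lt_eqF // sub0r => /eqP; rewrite oppr_eq0 => /eqP.
  have := @recseq_eventually0 _ (fun n => nabs L k (a + v0 *+ n)) (recseq_nabs hr a v0) _ 0%N.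
  rewrite mulr0n addr0; apply.
  pose N := (Num.truncn (`|e a - D| / - e v0)).+1.
  exists N => // n /= Nn; apply: far.
    exact: (subgroupD GB Ga (subgroupMn GB n Gv)).
  rewrite (e_D eB) (e_Mn eB) -mulr_natr.
  have h1 : `|e a - D| / - e v0 < n%:R.
    by apply: lt_le_trans (truncnS_gt _) _; rewrite ler_nat.
  move: h1; rewrite ltr_pdivrMr ?oppr_gt0 // mulrN => h1.
  have := ler_norm (e a - D); rewrite [e v0 * _]mulrC; lra.
have sw := on_wall_supp f.
have si := invnabs_supp eB gL sw.
apply: (germ_uniq eB GB gL GL).
- move=> a Ga; have [ea|ea] := eqVneq (e a) 0.
    apply: filterS (g_far Ga ea) => n gf.
    rewrite (nabsB L (fun a => kP a - k a)) (nabsB L kP k) diff_kP (nabs_invnabs eB gL sw) /on_wall eline ea eqxx gf nk0 ?subr0 ?subrr //.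
    exact: (subgroupD GB Ga (subgroupMn GB n Gw)).
  apply: nearW => n.
  rewrite (nabsB L (fun a => kP a - k a)) (nabsB L kP k) diff_kP (nabs_invnabs eB gL sw) /on_wall eline (negbTE ea) nk0 ?subr0 //.
  exact: (subgroupD GB Ga (subgroupMn GB n Gw)).
- exists 0 => a Ga a0; apply: filterS (hk a Ga a0) => n ->.
  by rewrite subrr si ?subr0 // eline.
Qed.

End Half.

Variables (e : M -> R) (v0 : M).
Hypothesis Gv : G v0.
Hypothesis eB : {morph e : x y / x - y}.
Hypothesis gL : all (good e) L.
Hypothesis ew : e w = 0.
Hypothesis ev : 0 < e v0.
Hypothesis diff_kP : nabs L kP = on_wall e g.
Hypothesis g_far : forall a, G a -> e a = 0 -> \forall n \near \oo, g (a + w *+ n) = f (a + w *+ n).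

Lemma invnabs_recseq (e' : M -> R) (h : M -> K) : {morph e' : x y / x - y} -> e' w = 0 ->
  (forall a, recseq (fun n => h (a + w *+ n))) ->
  forall a, recseq (fun n => invnabs e' L h (a + w *+ n)).
Proof.
move=> e'B e'w hr; elim: L => //= p L' ih a.
have el n : e' (a + w *+ n) = e' a by rewrite (e_D e'B) (e_Mn e'B) e'w mul0rn addr0.
pose N := (Num.truncn `|e' a|).+1.
have [pp|pp] := boolP (0 < e' p.1).
  apply: (@recseq_ext _ (fun n => \sum_(i < N) p.2 ^+ i * invnabs e' L' h (a - p.1 *+ i + w *+ n))).
    by move=> n; rewrite /invnab pp el; apply: eq_bigr => i _; rewrite addrAC.
  by apply: recseq_sum => i; exact: recseqZ.
apply: (@recseq_ext _ (fun n => -1 * \sum_(i < N) p.2 ^- i.+1 * invnabs e' L' h (a + p.1 *+ i.+1 + w *+ n))).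
  by move=> n; rewrite /invnab (negbTE pp) el mulN1r; congr (- _); apply: eq_bigr => i _; rewrite addrAC.
by apply: recseqZ; apply: recseq_sum => i; exact: recseqZ.
Qed.

(** [half_germ] on both sides of the wall compares [kP] with [k1] and with [k2];
    the unknown germ of [kP] cancels in the difference.  Equality of germs is
    equality, both sides being recurrent in the direction [w]. *)
Theorem wall_crossing_convolution (k1 k2 : M -> K) :
  (forall a v, recseq (fun n => k1 (a + v *+ n))) ->
  (forall a v, recseq (fun n => k2 (a + v *+ n))) ->
  (forall a v, recseq (fun n => f (a + v *+ n))) ->
  (forall a, G a -> 0 < e a -> \forall n \near \oo, k1 (a + w *+ n) = kP (a + w *+ n)) ->
  (forall a, G a -> e a < 0 -> \forall n \near \oo, k2 (a + w *+ n) = kP (a + w *+ n)) ->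
  forall a, G a ->
    k1 a - k2 a = invnabs e L (on_wall e f) a - invnabs (fun b => - e b) L (on_wall e f) a.
Proof.
move=> r1 r2 rf h1 h2 a Ga.
pose e' b := - e b.
have e'B : {morph e' : x y / x - y} by move=> x y; rewrite /e' eB opprD.
have gL' : all (good e') L by rewrite (eq_all (a2 := good e)) // => p; rewrite /good /e' normrN.
have wall h : on_wall e' h = on_wall e h.
  by apply/funext => b; rewrite /on_wall /e' oppr_eq0.
have e'v : e' (- v0) = - e' v0 by rewrite (e_N e'B).
have A2 : germ0 G w (fun a => kP a - k2 a - invnabs e L (on_wall e f) a).
  apply: (@half_germ e (- v0)) => //; first exact: (subgroupN GB).
  by rewrite (e_N eB) oppr_lt0.
have A1 : germ0 G w (fun a => kP a - k1 a - invnabs e' L (on_wall e f) a).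
  rewrite -wall; apply: (@half_germ e' v0) => //.
  - by rewrite /e' ew oppr0.
  - by rewrite /e' oppr_lt0.
  - by rewrite wall.
  - by move=> b Gb /eqP; rewrite oppr_eq0 => /eqP; exact: g_far.
  - by move=> b Gb; rewrite oppr_lt0; exact: h1.
apply/eqP; rewrite -subr_eq0; apply/eqP.
pose D b := k1 b - k2 b - (invnabs e L (on_wall e f) b - invnabs e' L (on_wall e f) b).
rewrite -/(D a).
have wr b : recseq (fun n => on_wall e f (b + w *+ n)).
  rewrite /on_wall; have el n : e (b + w *+ n) = e b by rewrite (e_D eB) (e_Mn eB) ew mul0rn addr0.
  have [eb|eb] := eqVneq (e b) 0.
    by apply: recseq_ext (rf b w) => n; rewrite el eb eqxx.
  by apply: recseq_ext (recseq0 _) => n; rewrite el (negbTE eb).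
have e'w : e' w = 0 by rewrite /e' ew oppr0.
have := @recseq_eventually0 _ (fun n => D (a + w *+ n)) _ _ 0%N.
rewrite mulr0n addr0; apply.
  apply: recseq_ext (recseqD (recseqD (r1 a w) (recseqZ (-1) (r2 a w)))
    (recseqD (recseqZ (-1) (invnabs_recseq eB ew wr a)) (invnabs_recseq e'B e'w wr a))) => n.
  by rewrite /D !mulN1r; ring.
have := A1 a Ga; have := A2 a Ga.
apply: filterS2 => n B2 B1; rewrite /D.
move: B1 B2 => /eqP; rewrite subr_eq0 => /eqP <- /eqP; rewrite subr_eq0 => /eqP <-; ring.
Qed.

End Combine.

(** * Partition functions under difference operators *)

Section PartitionNab.
Variable R : realType.
Local Notation C := (R[i]).

Definition ones (V : vectType R) (s : seq V) : seq (V * C) := [seq (x, 1) | x <- s].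
Definition pfC (V : vectType R) (s : seq V) (a : V) : C := (partition_fun s a)%:R.
Definition deltaV (V : vectType R) (a : V) : C := (a == 0)%:R.

Section OneSpace.
Variable V : vectType R.
Implicit Types (s : seq V) (a x : V) (u : 'Hom(V, R^o)).

Lemma hom_B u : {morph (u : V -> R) : x y / x - y}.
Proof. by move=> x y; rewrite linearB. Qed.

Lemma good_ones u s : (forall x, x \in s -> 1 <= `|u x : R|) -> all (good (u : V -> R)) (ones s).
Proof.
move=> h; rewrite all_map; apply/allP => x xs /=; rewrite /good /= oner_eq0 andbT; exact: h.
Qed.

Lemma half_space_scale s u : (forall x, x \in s -> 0 < u x :> R) ->
  exists u' : 'Hom(V, R^o), forall x, x \in s -> 1 <= u' x :> R.
Proof.
move=> h; pose c := \sum_(y <- s) `|(u y : R)^-1|; exists (c *: u) => x xs.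
have ux := h x xs.
rewrite scale_lfunE -[c *: _]/(c * (u x : R)) -(mulVf (lt0r_neq0 ux)) ler_pM2r //.
apply: le_trans (ler_norm _) _.
exact: (@ler_mem_sum _ _ _ (fun y => `|(u y : R)^-1|)).
Qed.

Lemma nab_pfC s x u : (forall y, y \in x :: s -> 1 <= u y :> R) ->
  nab (x, 1) (pfC (x :: s)) = pfC s.
Proof.
move=> h; apply/funext => a; rewrite /nab /= mul1r /pfC (partition_cons a h) natrD.
by rewrite addrK.
Qed.

Lemma pfC_supp s u : (forall y, y \in s -> 1 <= u y :> R) -> supp (u : V -> R) 0 (pfC s).
Proof.
move=> h a a0; rewrite /pfC /partition_fun (_ : [set m | _] = set0) ?fset_set0 ?cardfs0 //.
apply/seteqP; split=> m //= ma; move: a0; rewrite ma linear_sum /= ltNge sumr_ge0 // => i _.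
by rewrite raddfMn mulrn_wge0 // (le_trans ler01) // h // mem_nth.
Qed.

Lemma nabs_pfC s t u : (forall y, y \in s ++ t -> 1 <= u y :> R) ->
  nabs (ones s) (pfC (s ++ t)) = pfC t.
Proof.
elim: s => //= x s ih h; rewrite (nab_pfC h) ih // => y ys; apply: h.
by rewrite in_cons ys orbT.
Qed.

Lemma pfC_nil : pfC [::] = @deltaV V.
Proof. by apply/funext => a; rewrite /pfC partition_nil /deltaV; case: eqP. Qed.

Lemma pfC_perm s t u : (forall y, y \in s -> 1 <= u y :> R) -> perm_eq s t -> pfC s = pfC t.
Proof.
move=> h st.
have ht y : y \in t -> 1 <= u y :> R by rewrite -(perm_mem st); exact: h.
have gs : all (good (u : V -> R)) (ones s).
  by apply: good_ones => x xs; apply: le_trans (ler_norm _); exact: h.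
apply: (@nabs_inj _ _ _ _ (@hom_B u) (ones s) _ _ 0 gs); try exact: pfC_supp.
have -> : nabs (ones s) (pfC s) = pfC [::].
  by have := @nabs_pfC s [::] u; rewrite cats0; exact.
rewrite (nabs_perm (perm_map _ st)).
by have := @nabs_pfC t [::] u; rewrite cats0 => ->.
Qed.

End OneSpace.

Variables (V : vectType R) (W : {vspace V}).
Implicit Types (s : seq V) (u : 'Hom(V, R^o)).

(** Both sides solve the same difference equations, the form [u] being restricted
    to [W] on the right. *)
Lemma pfC_sub s u : (forall y, y \in s -> 1 <= u y :> R) -> (forall y, y \in s -> y \in W) ->
  pfC s = fun a => if a \in W then pfC [seq vsproj W y | y <- s] (vsproj W a) else 0.
Proof.
elim: s => [|x s ih] h hW.
  apply/funext => a; rewrite /= !pfC_nil /deltaV; case: ifP => aW.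
    congr (_%:R); congr nat_of_bool; apply/eqP/eqP => [->|e]; first by rewrite linear0.
    by rewrite -(vsprojK aW) e linear0.
  by case: eqP => // a0; move: aW; rewrite a0 mem0v.
have xW : x \in W by apply: hW; rewrite mem_head.
have hW' y : y \in s -> y \in W by move=> ys; apply: hW; rewrite in_cons ys orbT.
have h' y : y \in s -> 1 <= u y :> R by move=> ys; apply: h; rewrite in_cons ys orbT.
pose u' : 'Hom(subvs_of W, R^o) := (u \o linfun vsval)%VF.
have hu' y : y \in [seq vsproj W y | y <- x :: s] -> 1 <= u' y :> R.
  move=> /mapP[z zs ->]; rewrite /u' comp_lfunE lfunE /= vsprojK; [exact: h|exact: hW].
set h2 := fun a => _.
apply: (@nabs_inj _ _ _ _ (@hom_B _ u) [:: (x, 1)] _ _ 0) => //=.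
- by rewrite /good /= oner_eq0 andbT (le_trans (h x (mem_head _ _))) // ler_norm.
- exact: pfC_supp.
- move=> a a0; rewrite /h2; case: ifP => // aW; apply: (pfC_supp hu').
  by rewrite /u' comp_lfunE lfunE /= vsprojK.
rewrite (nab_pfC h) ih //; apply/funext => a; rewrite /nab /h2 /= mul1r rpredBr //.
case: ifP => aW; last by rewrite subr0.
by rewrite linearB /= -{1}(nab_pfC hu') /nab /= mul1r.
Qed.

Lemma nabs_partition (Phi : seq V) u : (forall y, y \in Phi -> 0 < u y :> R) ->
  nabs (ones (vectors_out W Phi)) (pfC Phi) =
  fun a => if a \in W then pfC (vectors_in W Phi) (vsproj W a) else 0.
Proof.
move=> /half_space_scale[{}u h].
have P : perm_eq Phi (vectors_out W Phi ++ [seq y <- Phi | y \in W]).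
  by rewrite perm_sym perm_catC; apply/permPl; exact: perm_filterC.
have h' y : y \in vectors_out W Phi ++ [seq y <- Phi | y \in W] -> 1 <= u y :> R.
  by rewrite -(perm_mem P); exact: h.
rewrite (pfC_perm h P) (nabs_pfC h') (@pfC_sub _ u) //.
- by move=> y; rewrite mem_filter => /andP[_ /h].
- by move=> y; rewrite mem_filter => /andP[].
Qed.

End PartitionNab.

(** * Chambers and linear forms *)

Section Topo.
Variables (R : realType) (V : vectType R).
Implicit Types (x p q v : V) (f g : 'Hom(V, R^o)) (fs : seq 'Hom(V, R^o)).

Lemma form_continuous f : continuous (f : vtop V -> R^o).
Proof.
pose h (r : 'rV[R]_(\dim {:V})) : R^o := \sum_i r 0 i * f (vbasis {:V})`_i.
have hc : continuous h.
  move=> r; rewrite /h; elim: (index_enum _) => [|i s ih].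
    rewrite (_ : (fun r : 'rV[R]_(\dim {:V}) => _) = fun=> 0); first exact: cst_continuous.
    by apply/funext => r'; rewrite big_nil.
  rewrite (_ : (fun r : 'rV[R]_(\dim {:V}) => _) = fun r => r 0 i * f (vbasis {:V})`_i + \sum_(j <- s) r 0 j * f (vbasis {:V})`_j); last first.
    by apply/funext => r'; rewrite big_cons.
  apply: (@contD R _ (fun r : 'rV[R]_(\dim {:V}) => r 0 i * f (vbasis {:V})`_i : R^o) _ r) => //.
  apply: (@contM R _ (fun r : 'rV[R]_(\dim {:V}) => r 0 i : R^o) (fun=> f (vbasis {:V})`_i) r); last exact: cont_cst.
  exact: coord_continuous.
have -> : (f : vtop V -> R^o) = h \o passmx.rVof (vbasis {:V}).
  apply/funext => v /=; rewrite /h {1}(coord_vbasis (memvf v)) linear_sum; apply: eq_bigr => i _.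
  by rewrite linearZ /= -passmx.coord_rVof.
by move=> x; apply: continuous_comp; [exact: initial_continuous|exact: hc].
Qed.

Lemma line_continuous p v : continuous (fun t : R^o => (p + t *: v : vtop V)).
Proof.
apply: continuous_comp_initial => t.
rewrite (_ : _ \o _ = fun t : R^o => passmx.rVof (vbasis {:V}) p + t *: passmx.rVof (vbasis {:V}) v); last first.
  by apply/funext => s /=; apply/rowP => i; rewrite !mxE linearD linearZ.
apply: (@continuousD _ _ _ (fun=> passmx.rVof (vbasis {:V}) p) (fun t : R^o => t *: passmx.rVof (vbasis {:V}) v)).
  exact: cst_continuous.
by apply: continuousZr_tmp => A.
Qed.

Lemma near_line x v (P : set V) : (\forall y \near (x : vtop V), P y) ->
  exists2 d : R, 0 < d & forall t, `|t| < d -> P (x + t *: v).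
Proof.
move=> hP; have c := @line_continuous x v 0.
have : \forall t \near (0 : R^o), P (x + t *: v).
  by apply: c; rewrite /= scale0r addr0.
move=> [d d0 h]; exists d => // t td; apply: h; by rewrite /= sub0r normrN.
Qed.

Lemma near_forms fs x (w : V) : (forall f, f \in fs -> 0 < f x * f w :> R) ->
  \forall y \near (x : vtop V), forall f, f \in fs -> 0 < f y * f w :> R.
Proof.
elim: fs => [_|f fs ih h]; first by apply: near_all => y f; rewrite in_nil.
have h1 : \forall y \near (x : vtop V), 0 < f y * f w :> R.
  have c : {for (x : vtop V), continuous (fun y : vtop V => f y * f w : R^o)}.
    by apply: contM; [exact: form_continuous|exact: cont_cst].
  apply: (@cvgr_gt R (vtop V) (nbhs (x : vtop V)) (nbhs_filter _) _ _ c).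
  exact: h (mem_head _ _).
have {}ih := ih (fun g gs => h g (ltac:(by rewrite in_cons gs orbT))).
apply: near_imp2 h1 ih => y a b g; rewrite in_cons => /orP[/eqP -> //|]; exact: b.
Qed.

Lemma closure_near (A : set V) x (P : set V) : vclosure A x ->
  (\forall y \near (x : vtop V), P y) -> exists p, A p /\ P p.
Proof. by move=> cA hP; have [p [Ap Pp]] := cA _ hP; exists p. Qed.

(** A segment that avoids the singular cones is connected. *)
Lemma chamber_segment (Phi : seq V) c p q : chamber Phi c -> c p ->
  (forall t : R, 0 <= t <= 1 -> ~ cone_sing Phi (p + t *: (q - p))) -> c q.
Proof.
move=> [x nx ->] cp seg.
have e := same_connected_component cp.
rewrite e; pose f t := (p + t *: (q - p) : vtop V).
have h : f @` `[0, 1] `<=` connected_component (~` cone_sing Phi : set (vtop V)) p.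
  apply: connected_component_max.
  - by exists 0; rewrite /= ?in_itv /= ?lexx ?ler01 // /f scale0r addr0.
  - by move=> _ [t t01 <-] /=; apply: seg; move: t01; rewrite /= in_itv.
  - apply: connected_continuous_connected; first exact: segment_connected.
    by apply: continuous_subspaceT; exact: line_continuous.
apply: h; exists 1; first by rewrite /= in_itv /= ler01 lexx.
by rewrite /f scale1r addrC subrK.
Qed.

Lemma chamber_common (Phi : seq V) c c' p : chamber Phi c -> chamber Phi c' -> c p -> c' p -> c = c'.
Proof.
move=> [x nx ->] [y ny ->] /same_connected_component e /same_connected_component e'.
by rewrite e e'.
Qed.

Lemma cone_span (nu : seq V) a : cone nu a -> a \in <<nu>>%VS.
Proof.
by move=> [t _ ->]; apply: memv_suml => i _; apply: memvZ; apply: memv_span; exact: mem_nth.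
Qed.

Lemma separating_form (S : {vspace V}) v : v \notin S ->
  exists f, (forall x, x \in S -> f x = 0 :> R) /\ f v != 0 :> R.
Proof.
move=> vS; pose pr : 'End(V) := (\1 - projv S)%VF.
have prE x : pr x = x - projv S x by rewrite /pr add_lfunE opp_lfunE id_lfunE.
have pv : pr v != 0.
  by rewrite prE subr_eq0; apply/eqP => e; move: vS; rewrite e memv_proj.
have [i ci] : exists i, coord (vbasis {:V}) i (pr v) != 0.
  apply: contrapT => nc; move/negP: pv; apply; apply/eqP.
  rewrite (coord_vbasis (memvf (pr v))) big1 // => i _.
  have [-> |ci] := eqVneq (coord (vbasis {:V}) i (pr v)) 0; first by rewrite scale0r.
  by case: nc; exists i.
exists (coordform i \o pr)%VF; split=> [x xS|].
  by rewrite comp_lfunE prE projv_id // subrr linear0.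
by rewrite comp_lfunE lfunE /=.
Qed.

End Topo.

(** * Rational points in general position *)

Section Rational.
Variables (R : realType) (X : vectType R) (G : set X).
Hypothesis GB : forall a b, G a -> G b -> G (a - b).
Implicit Types (x y b : X) (fs : seq 'Hom(X, R^o)).

Definition rat_point x := exists2 n : nat, (0 < n)%N & G (x *+ n).

Lemma rationalD x b (q : rat) : rat_point x -> G b -> rat_point (x + ratr q *: b).
Proof.
move=> [n n0 Gx] Gb; exists (n * `|denq q|)%N.
  by rewrite muln_gt0 n0 absz_gt0 denq_neq0.
rewrite mulrnDl; apply: (subgroupD GB).
  by have := subgroupMz GB `|denq q|%N Gx; rewrite -pmulrn -mulrnA.
have -> : (ratr q *: b) *+ (n * `|denq q|) = b *~ (numq q * n).
  rewrite -scaler_nat scalerA -[b *~ _]scaler_int; congr (_ *: _).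
  have E : (denq q)%:~R = (`|denq q|%N)%:R :> R by rewrite pmulrn gtz0_abs // denq_gt0.
  have d0 : (`|denq q|%:R : R) != 0 by rewrite pnatr_eq0 absz_eq0 denq_neq0.
  rewrite natrM intrM /ratr E -pmulrn; move: (`|denq q|%:R : R) d0 => d d0.
  by field.
exact: (subgroupMz GB).
Qed.

(** The coordinates of [x] on the vectors of [s] are replaced by rational ones
    one after the other, [O] being open. *)
Lemma rational_dense (s : seq X) (O : set X) r x :
  (forall y, O y -> \forall z \near (y : vtop X), O z) ->
  (forall b, b \in s -> G b) -> rat_point r -> x \in span s -> O (r + x) ->
  exists2 y, rat_point y & O y.
Proof.
move=> Oo; elim: s r x => [|b s ih] r x sG rr.
  by rewrite span_nil memv0 => /eqP -> ; rewrite addr0 => Or; exists r.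
rewrite span_cons => /memv_addP[_ /vlineP[k ->]] [x' x's ->] Ox.
have Gb : G b by apply: sG; rewrite mem_head.
have [d d0 h] := near_line b (Oo _ Ox).
have kd : k < k + d by rewrite ltrDl.
have [q] := rat_in_itvoo kd; rewrite in_itv /= => /andP[kq qd].
apply: (ih (r + ratr q *: b) x') => //.
- by move=> c cs; apply: sG; rewrite in_cons cs orbT.
- exact: rationalD.
have := h (ratr q - k); rewrite gtr0_norm ?subr_gt0 // ltrBlDl => /(_ qd).
rewrite (_ : r + _ + _ = r + ratr q *: b + x') //.
rewrite scalerBl -!addrA; congr (r + _).
by rewrite addrCA [k *: b + _]addrC subrK addrC.
Qed.

(** A point on one of the hyperplanes is moved by a small rational multiple of a
    lattice vector transverse to it, without meeting the previous ones. *)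
Lemma rational_generic (s : seq X) (O : set X) fs :
  (forall y, O y -> \forall z \near (y : vtop X), O z) ->
  (forall b, b \in s -> G b) ->
  (forall f, f \in fs -> exists2 b, b \in s & f b != 0 :> R) ->
  forall y, rat_point y -> O y ->
  exists y', [/\ rat_point y', O y' & forall f, f \in fs -> f y' != 0 :> R].
Proof.
move=> Oo sG; elim: fs => [|f fs ih] hfs y ry Oy; first by exists y.
have hfs' g : g \in fs -> exists2 b, b \in s & g b != 0 :> R.
  by move=> gs; apply: hfs; rewrite in_cons gs orbT.
have {ih}[z [rz Oz nz]] := ih hfs' y ry Oy.
have [fz|fz] := eqVneq (f z : R) 0; last first.
  by exists z; split=> // g; rewrite in_cons => /orP[/eqP ->|/nz].
have [b bs fb] := hfs f (mem_head _ _).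
have nz2 g : g \in fs -> 0 < g z * g z :> R.
  by move=> /nz gz; rewrite -expr2 exprn_even_gt0.
have nearz : \forall x \near (z : vtop X), O x /\ (forall g, g \in fs -> 0 < g x * g z :> R).
  by apply: near_imp2 (Oo _ Oz) (near_forms nz2) => x Ox hx; split.
have [d d0 h] := near_line b nearz.
have d1 : 0 < 0 + d by rewrite add0r.
have [q] := rat_in_itvoo d1; rewrite in_itv /= add0r => /andP[q0 qd].
have [|O1 n1] := h (ratr q); first by rewrite gtr0_norm.
exists (z + ratr q *: b); split=> //; first by apply: rationalD => //; exact: sG.
move=> g; rewrite in_cons => /orP[/eqP ->|/n1].
  by rewrite linearD /= fz add0r linearZ /= mulf_neq0 // gt_eqF.
by move=> h1; apply/eqP => g0; move: h1; rewrite g0 mul0r ltxx.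
Qed.

End Rational.

Section Geometry.
Variables (R : realType).

Lemma choose_forms (X : vectType R) (T : eqType) (L : seq T) (P : T -> Prop)
  (Q : T -> 'Hom(X, R^o) -> Prop) :
  (forall t, P t -> exists f, Q t f) ->
  exists fs : seq 'Hom(X, R^o),
    (forall t, t \in L -> P t -> exists2 f, f \in fs & Q t f) /\
    (forall f, f \in fs -> exists2 t, P t & Q t f).
Proof.
move=> h; elim: L => [|t L [fs [h1 h2]]]; first by exists [::].
have [Pt|nPt] := pselect (P t); last first.
  by exists fs; split=> // t'; rewrite in_cons => /orP[/eqP -> //|]; exact: h1.
have [f Qf] := h t Pt; exists (f :: fs); split.
  move=> t'; rewrite in_cons => /orP[/eqP -> _|t'L Pt']; first by exists f => //; rewrite mem_head.
  by have [g gs Qg] := h1 t' t'L Pt'; exists g => //; rewrite in_cons gs orbT.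
by move=> g; rewrite in_cons => /orP[/eqP ->|/h2 //]; exists t.
Qed.

Definition subseqs (T : eqType) (s : seq T) : seq (seq T) :=
  [seq mask (val m) s | m : (size s).-tuple bool].

Lemma mem_subseqs (T : eqType) (nu s : seq T) : subseq nu s -> nu \in subseqs s.
Proof.
move=> /subseqP[m sm ->]; apply/mapP.
have sm' : size m == size s by apply/eqP.
by exists (Tuple sm'); rewrite ?mem_enum.
Qed.

(** [H] is the open half-space on one side of the wall, or the whole space.  The
    singular cones either lie in the kernel of one of the forms [fs] or avoid
    [H]; so a chamber that meets a region of [H] where these forms keep
    their signs contains it. *)
Section Reach.
Variables (V : vectType R) (Phi : seq V) (fs : seq 'Hom(V, R^o)) (w : V) (H : V -> Prop).
Hypothesis Hconv : forall x y (s t : R), H x -> H y -> 0 <= s -> 0 <= t -> 0 < s + t -> H (s *: x + t *: y).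
Hypothesis cover : forall nu, subseq nu Phi -> (size nu < \dim {:V})%N ->
  (exists2 f, f \in fs & forall x, x \in span nu -> f x = 0 :> R) \/
  (forall a, H a -> ~ cone nu a).

Definition same_side (y : V) := forall f, f \in fs -> 0 < f y * f w :> R.

Lemma reach c p q : chamber Phi c -> c p -> same_side p -> H p -> same_side q -> H q -> c q.
Proof.
move=> hc cp Np Hp Nq Hq; apply: (chamber_segment hc cp) => t /andP[t0 t1] [nu [snu dnu] cnu].
have e : p + t *: (q - p) = (1 - t) *: p + t *: q.
  by rewrite scalerBr scalerBl scale1r addrA addrAC.
have t1' : 0 <= 1 - t by rewrite subr_ge0.
rewrite e in cnu; have [[f fin fz]|] := cover snu dnu; last first.
  by move=> /(_ _ _ cnu); apply; apply: Hconv => //; rewrite subrK.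
have := fz _ (cone_span cnu); rewrite linearD !linearZ /= => f0.
have fp := Np f fin; have fq := Nq f fin.
have : 0 < ((1 - t) * (f p : R) + t * (f q : R)) * (f w : R).
  rewrite mulrDl -!mulrA; have [->|tn0] := eqVneq t 0.
    by rewrite mul0r addr0 subr0 mul1r.
  apply: ltr_wpDl; first by rewrite mulr_ge0 // ltW.
  by rewrite mulr_gt0 // lt_neqAle eq_sym tn0.
by rewrite [X in X * _]f0 mul0r ltxx.
Qed.

Lemma same_side_far a : (forall f, f \in fs -> f w != 0 :> R) ->
  \forall n \near \oo, same_side (a + w *+ n).
Proof.
rewrite /same_side; elim: fs => [_|f gs ih h]; first by apply: nearW => n f.
have {}ih := ih (fun g gin => h g (ltac:(by rewrite in_cons gin orbT))).
have fw : 0 < (f w : R) ^+ 2 by rewrite exprn_even_gt0 //= h // mem_head.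
have h1 : \forall n \near \oo, 0 < f (a + w *+ n) * f w :> R.
  pose N := (Num.truncn (`|f a * f w : R| / (f w : R) ^+ 2)).+1.
  exists N => // n /= Nn.
  have -> : (f (a + w *+ n) : R) * f w = (f a : R) * f w + (f w : R) ^+ 2 * n%:R.
    rewrite linearD raddfMn /=; move: (f a : R) (f w : R) => x y.
    by rewrite -[y *+ n]mulr_natr; ring.
  have : `|f a * f w : R| / (f w : R) ^+ 2 < n%:R.
    by apply: (lt_le_trans (truncnS_gt _)); rewrite ler_nat.
  rewrite ltr_pdivrMr // => h2; have := ler_norm (- (f a * f w : R)); rewrite normrN => h3.
  by rewrite -ltrBlDl sub0r [_ ^+ 2 * _]mulrC; apply: le_lt_trans h3 _.
by apply: filterS2 h1 ih => n a1 b1 g; rewrite in_cons => /orP[/eqP -> //|]; exact: b1.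
Qed.

End Reach.
End Geometry.

(** * A lattice direction inside the wall *)

Section GeometryMain.
Variables (R : realType) (V : vectType R) (Gamma : set V) (Phi : seq V) (W : {vspace V}).
Variables (E : 'Hom(V, R^o)) (c1 c2 : set V) (c12 : set (subvs_of W)).
Hypothesis GB : forall a b, Gamma a -> Gamma b -> Gamma (a - b).
Hypothesis PhiG : forall x, x \in Phi -> Gamma x.
Hypothesis half : exists u : 'Hom(V, R^o), forall phi, phi \in Phi -> 0 < u phi :> R.
Hypothesis hW : is_wall W Phi.
Hypothesis hWE : W = lker E.
Hypothesis hc1 : chamber Phi c1.
Hypothesis hc2 : chamber Phi c2.
Hypothesis hc : separated_by W Phi E c1 c2.
Hypothesis hpos : exists2 phi, phi \in Phi & 0 < E phi :> R.
Hypothesis hc12 : chamber (vectors_in W Phi) c12.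
Hypothesis hc12_cl : vsval @^-1` (vclosure c1 `&` vclosure c2) `<=` vclosure c12.

Let memW a : (a \in W) = (E a == 0 :> R).
Proof. by rewrite hWE memv_ker. Qed.

Lemma cone_add (nu : seq V) a b : cone nu a -> cone nu b -> cone nu (a + b).
Proof.
move=> [s s0 ->] [t t0 ->]; exists (fun i => s i + t i) => [i|]; first exact: addr_ge0.
by rewrite -big_split; apply: eq_bigr => i _; rewrite scalerDl.
Qed.

Lemma cone_scale (nu : seq V) (k : R) a : 0 <= k -> cone nu a -> cone nu (k *: a).
Proof.
move=> k0 [s s0 ->]; exists (fun i => k * s i) => [i|]; first exact: mulr_ge0.
by rewrite scaler_sumr; apply: eq_bigr => i _; rewrite scalerA.
Qed.

(** A span of fewer than [\dim V] vectors of [Phi], other than [W], does not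
    contain [W]; so it is in the kernel of a form that is nonzero on [W], and
    [fs] collects such forms.  The forms [gs] do the same for [Phi] in [W].  The
    interior of the common facet then contains a rational point [w0] where none
    of these forms vanishes, and [w] is a multiple of it. *)
Lemma wall_direction : exists w : V, [/\ Gamma w, E w = 0 :> R &
  exists (fs : seq 'Hom(V, R^o)) (gs : seq 'Hom(subvs_of W, R^o)) (w0 : subvs_of W) (r : R),
  [/\ 0 < r, vsval w0 = r *: w, vclosure c1 (vsval w0) /\ vclosure c2 (vsval w0), vclosure c12 w0 &
   [/\ forall nu, subseq nu Phi -> (size nu < \dim {:V})%N -> W != span nu ->
         exists2 f, f \in fs & forall x, x \in span nu -> f x = 0 :> R,
       forall nu, subseq nu (vectors_in W Phi) -> (size nu < \dim {:subvs_of W})%N ->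
         exists2 f, f \in gs & forall x, x \in span nu -> f x = 0 :> R,
       forall f, f \in fs -> f w != 0 :> R & forall g, g \in gs -> g w0 != 0 :> R]]].
Proof.
have [nu snu [fnu dnu eW]] := hW.
have dW : \dim W = size nu by rewrite eW; apply/eqP.
have nuW b : b \in nu -> b \in W by move=> bnu; rewrite eW memv_span.
pose B := [seq vsproj W y | y <- nu].
have spanB x : x \in span B.
  have -> : span B = (linfun (vsproj W) @: span nu)%VS.
    by rewrite limg_span; congr span; apply: eq_map => y; rewrite lfunE.
  by apply/memv_imgP; exists (vsval x); rewrite ?lfunE /= ?vsvalK // -eW subvsP.
have A1 mu : (size mu < \dim {:V})%N /\ W != span mu ->
    exists f : 'Hom(V, R^o), (forall x, x \in span mu -> f x = 0 :> R) /\ exists2 b, b \in nu & f b != 0 :> R.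
  move=> [dmu neW].
  have [b bnu bmu] : exists2 b, b \in nu & b \notin span mu.
    apply: contrapT => nb; move/negP: neW; apply; rewrite eqEdim; apply/andP; split.
      rewrite eW; apply/span_subvP => b bnu; apply: contrapT => /negP nb'; apply: nb; by exists b.
    by rewrite dW; apply: leq_trans (dim_span _) _; rewrite -ltnS dnu.
  have [f [f1 f2]] := separating_form bmu.
  by exists f; split=> //; exists b.
have A2 (mu : seq (subvs_of W)) : (size mu < \dim {:subvs_of W})%N ->
    exists f : 'Hom(subvs_of W, R^o), (forall x, x \in span mu -> f x = 0 :> R) /\ exists2 b, b \in B & f b != 0 :> R.
  move=> dmu; have [v vmu] : exists v, v \notin span mu.
    apply: contrapT => nv; move: dmu; rewrite ltnNge => /negP; apply.
    apply: leq_trans (dim_span mu); apply: dimvS; apply/subvP => v _.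
    by apply: contrapT => /negP nv'; apply: nv; exists v.
  have [f [f1 f2]] := separating_form vmu; exists f; split=> //.
  apply: contrapT => nb; move/negP: f2; apply; apply/eqP.
  have sB : (span B <= lker f)%VS.
    apply/span_subvP => b bB; rewrite memv_ker; apply: contrapT => /negP nb'.
    by apply: nb; exists b.
  by have := subvP sB v (spanB v); rewrite memv_ker => /eqP.
have [fs [fs1 fs2]] := choose_forms (subseqs Phi) A1.
have [gs [gs1 gs2]] := choose_forms (subseqs (vectors_in W Phi)) A2.
pose F := gs ++ [seq (f \o linfun vsval)%VF | f <- fs].
pose O := vinterior ((vsval : subvs_of W -> V) @^-1` (vclosure c1 `&` vclosure c2)).
have Oopen y : O y -> \forall z \near (y : vtop (subvs_of W)), O z.
  by move=> Oy; apply: nbhs_interior; exact: Oy.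
have [x0 Ox0] : O !=set0 by case: hc.
have GBW (a b : subvs_of W) : lattice_in W Gamma a -> lattice_in W Gamma b -> lattice_in W Gamma (a - b).
  by move=> Ga Gb; rewrite /lattice_in /preimage /mkset linearB; exact: GB.
have BG b : b \in B -> lattice_in W Gamma b.
  move=> /mapP[y ynu ->]; rewrite /lattice_in /preimage /mkset vsprojK; last exact: nuW.
  by apply: PhiG; exact: (mem_subseq snu).
have G0 : lattice_in W Gamma 0.
  rewrite /lattice_in /preimage /mkset linear0; have [phi phiP _] := hpos.
  by rewrite -(subrr phi); apply: GB; exact: PhiG.
have r0 : rat_point (lattice_in W Gamma) 0 by exists 1%N.
have [y ry Oy] : exists2 y, rat_point (lattice_in W Gamma) y & O y.
  by apply: (@rational_dense _ _ _ GBW B O 0 x0) => //; rewrite add0r.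
have hF f : f \in F -> exists2 b, b \in B & f b != 0 :> R.
  rewrite mem_cat => /orP[/gs2[mu _ [_ //]]|/mapP[g gfs ->]].
  have [mu _ [_ [b bnu gb]]] := fs2 g gfs.
  exists (vsproj W b); first exact: map_f.
  by rewrite comp_lfunE lfunE /= vsprojK //; exact: nuW.
have [w0 [[n n0 Gn] Ow0 nz]] := rational_generic GBW Oopen BG hF ry Oy.
have cw0 := interior_subset Ow0.
have nR : n%:R != 0 :> R by rewrite pnatr_eq0 -lt0n.
have ew : vsval w0 = n%:R^-1 *: vsval (w0 *+ n).
  by rewrite raddfMn /= -[X in _ *: X]scaler_nat scalerA mulVf // scale1r.
exists (vsval (w0 *+ n)); split=> //.
  by apply/eqP; rewrite -memW subvsP.
exists fs, gs, w0, n%:R^-1; split=> //.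
- by rewrite invr_gt0 ltr0n.
- exact: hc12_cl.
split.
- move=> mu smu dmu neW; have [f ff [f1 _]] := fs1 mu (mem_subseqs smu) (conj dmu neW).
  by exists f.
- move=> mu smu dmu; have [f ff [f1 _]] := gs1 mu (mem_subseqs smu) dmu.
  by exists f.
- move=> f ff; have fF : (f \o linfun vsval)%VF \in F by rewrite mem_cat; apply/orP; right; apply/mapP; exists f.
  have := nz _ fF; rewrite comp_lfunE lfunE /= !raddfMn /= => h; rewrite -[f _ *+ n]mulr_natr mulf_neq0 //.
- by move=> g gg; apply: nz; rewrite mem_cat gg.
Qed.

(** Near [w0], and also far away in the direction of [w0], the forms [fs] have
    the signs they have at [w0].  As [w0] adheres to [c1], [c1] has a point with
    these signs, and by [reach] it contains every such point above the wall;
    similarly for [c2] and [c12]. *)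
Theorem wall_germ : exists w : V, [/\ Gamma w, E w = 0 :> R,
  forall a, 0 < E a :> R -> \forall n \near \oo, c1 (a + w *+ n),
  forall a, E a < 0 :> R -> \forall n \near \oo, c2 (a + w *+ n) &
  forall a, a \in W -> \forall n \near \oo, c12 (vsproj W (a + w *+ n))].
Proof.
have [w [Gw Ew [fs [gs [w0 [r [r0 ew0 [cl1 cl2] cl12 [cov1 cov2 nzf nzg]]]]]]]] := wall_direction.
have [sep1 sep2 _] := hc.
have half_conv (k : R) (x y : V) (s t : R) : 0 < k * E x -> 0 < k * E y -> 0 <= s -> 0 <= t -> 0 < s + t ->
    0 < k * E (s *: x + t *: y).
  rewrite linearD !linearZ /= mulrDr => kx ky s0 t0 st.
  rewrite [k * (s * _)]mulrCA [k * (t * _)]mulrCA.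
  move: s0; rewrite le_eqVlt => /orP[/eqP s0|s0].
    by rewrite -s0 mul0r add0r mulr_gt0 //; move: st; rewrite -s0 add0r.
  by apply: ltr_wpDr; [rewrite mulr_ge0 // ltW|rewrite mulr_gt0].
have cov (k : R) nu : subseq nu Phi -> (size nu < \dim {:V})%N ->
    (exists2 f, f \in fs & forall x, x \in span nu -> f x = 0 :> R) \/
    (forall a, 0 < k * E a -> ~ cone nu a).
  move=> snu dnu; have [e|ne] := eqVneq W (span nu); [right|left; exact: cov1].
  move=> a ka /cone_span; rewrite -e memW => /eqP Ea.
  by move: ka; rewrite [E a]Ea mulr0 ltxx.
have nearw : \forall y \near (vsval w0 : vtop V), same_side fs w y.
  apply: near_forms => f ff; rewrite ew0 linearZ /= -[r *: _]/(r * _) -mulrA -expr2 mulr_gt0 //.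
  by rewrite exprn_even_gt0 //= nzf.
have Eline a n : E (a + w *+ n) = E a by rewrite linearD raddfMn /= Ew mul0rn addr0.
have [p1 [c1p Np]] := closure_near cl1 nearw.
have reach1 q : same_side fs w q -> 0 < E q :> R -> c1 q.
  move=> Nq Eq; apply: (@reach R V Phi fs w (fun x => 0 < 1 * E x :> R) (half_conv 1) (cov 1) c1 p1 q) => //.
    by rewrite mul1r; exact: sep1.
  by rewrite mul1r.
have [p2 [c2p Np2 Ep2]] : exists p, [/\ c2 p, same_side fs w p & E p < 0 :> R].
  have [p [c2p Npp]] := closure_near cl2 nearw.
  case: sep2 => [s2|c2ext]; first by exists p; split=> //; exact: s2.
  (* [c2] is the exterior chamber: a point of [c2] with the signs [fs] may lie
     on the wall but not above it, where [c1] fills the cone of [Phi] *)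
  have [phi phiP Ephi] := hpos; have [u uP] := half.
  have n12 : c1 <> c2.
    move=> e12; have nphi : ~ c1 (- phi).
      by move=> /sep1; rewrite linearN /= oppr_gt0 => /lt_trans /(_ Ephi); rewrite ltxx.
    have : cone Phi (- phi) by apply: contrapT => nc; apply: nphi; rewrite e12 c2ext.
    move=> [t t0 e]; have : 0 <= u (- phi) :> R.
      rewrite e linear_sum /= sumr_ge0 // => i _; rewrite linearZ /= mulr_ge0 //.
      by rewrite ltW // uP // mem_nth.
    by rewrite linearN /= oppr_ge0 leNgt uP.
  have in_cone q : same_side fs w q -> 0 < E q :> R -> cone Phi q.
    move=> Nq Eq; apply: contrapT => nq; apply: n12.
    by apply: (chamber_common hc1 hc2 (reach1 q Nq Eq)); rewrite c2ext.
  have [Ep|Ep] := ltP (E p : R) 0; first by exists p.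
  have {}Ep : E p = 0 :> R.
    apply/eqP; rewrite eq_le Ep andbT leNgt; apply/negP => Ep'.
    by have := in_cone p Npp Ep'; move: c2p; rewrite c2ext.
  (* on the wall, [p] is a midpoint of a point above, which is in the cone, and
     of a point below, which is then outside *)
  have [d d0 hd] := near_line phi (near_forms Npp).
  have d2 : 0 < d / 2 by rewrite divr_gt0.
  have d2d : `|d / 2| < d by rewrite gtr0_norm // ltr_pdivrMr // mulr_natr mulr2n ltrDl.
  have N1 := hd _ d2d; have N2 := hd (- (d / 2)); rewrite normrN in N2; have {}N2 := N2 d2d.
  exists (p + (- (d / 2)) *: phi); split=> //; last first.
    by rewrite linearD linearZ /= Ep add0r nmulr_rlt0 // oppr_lt0.
  rewrite c2ext => h2.
  have h1 : cone Phi (p + (d / 2) *: phi).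
    by apply: in_cone => //; rewrite linearD linearZ /= Ep add0r mulr_gt0.
  move: c2p; rewrite c2ext; apply.
  have -> : p = 2^-1 *: ((p + (d / 2) *: phi) + (p + (- (d / 2)) *: phi)).
    rewrite addrACA -scalerDl subrr scale0r addr0 -mulr2n -[p *+ 2]scaler_nat scalerA mulVf ?scale1r //; exact: lt0r_neq0.
  by apply: cone_scale; [rewrite invr_ge0|exact: cone_add].
have reach2 q : same_side fs w q -> E q < 0 :> R -> c2 q.
  move=> Nq Eq; apply: (@reach R V Phi fs w (fun x => 0 < (-1) * E x :> R) (half_conv (-1)) (cov (-1)) c2 p2 q) => //.
    by rewrite mulN1r oppr_gt0.
  by rewrite mulN1r oppr_gt0.
exists w; split=> //.
- move=> a Ea; apply: filterS (same_side_far a nzf) => n Nn.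
  by apply: reach1 => //; rewrite Eline.
- move=> a Ea; apply: filterS (same_side_far a nzf) => n Nn.
  by apply: reach2 => //; rewrite Eline.
move=> a aW; pose wX := vsproj W w.
have eX : w0 = r *: wX.
  by apply: subvs_inj; rewrite linearZ /= vsprojK ?memW ?Ew ?eqxx // -ew0.
have nzX g : g \in gs -> g wX != 0 :> R.
  move=> /nzg; rewrite eX linearZ /=; apply: contraNneq => ->; by rewrite scaler0.
have nearX : \forall y \near (w0 : vtop (subvs_of W)), same_side gs wX y.
  apply: near_forms => g gg; rewrite eX linearZ /= -[r *: _]/(r * _) -mulrA -expr2 mulr_gt0 //.
  by rewrite exprn_even_gt0 //= nzX.
have [p [cp NpX]] := closure_near cl12 nearX.
apply: filterS (same_side_far (vsproj W a) nzX) => n Nn.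
rewrite linearD raddfMn /=.
apply: (@reach R _ (vectors_in W Phi) gs wX (fun=> True) _ _ c12 p) => // nu snu dnu.
by left; exact: cov2.
Qed.

End GeometryMain.

(** * Differentiating the kernel of the residue *)

Lemma fsbig_lin_in (K : fieldType) (I : choiceType) (A : set I) (J : eqType) (s : seq J)
  (c : J -> K) (F : J -> I -> K) :
  (forall j, j \in s -> finite_set (A `&` [set i | F j i != 0])) ->
  finite_set (A `&` [set i | \sum_(j <- s) c j * F j i != 0]) /\
  \sum_(i \in A) (\sum_(j <- s) c j * F j i) = \sum_(j <- s) c j * \sum_(i \in A) F j i.
Proof.
move=> hF; pose F' j i := if j \in s then F j i else 0.
have hF' j : finite_set (A `&` [set i | F' j i != 0]).
  case js : (j \in s).
    by apply: sub_finite_set (hF j js) => i; rewrite /= /F' js.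
  by apply: (sub_finite_set _ (finite_set0 _)) => i [_]; rewrite /= /F' js eqxx.
have e i : \sum_(j <- s) c j * F j i = \sum_(j <- s) c j * F' j i.
  by apply: eq_big_seq => j js; rewrite /F' js.
have fs := @finite_supp_sum K I A J s c F' hF'.
split; first by apply: sub_finite_set fs => i /=; rewrite e.
rewrite (eq_fsbigr (fun i => \sum_(j <- s) c j * F' j i)); last by move=> i _; rewrite e.
rewrite (fsbig_lin s c hF'); apply: eq_big_seq => j js; congr (_ * _).
by apply: eq_fsbigr => i _; rewrite /F' js.
Qed.

Section Directional.
Variables (R : realType) (V : vectType R).
Local Notation C := (R[i]).
Local Notation U := 'Hom(V, R^o).
Implicit Types (u x : U) (a psi : V) (Psi : seq V) (k : seq V -> V -> C).

(** The derivative in the direction [u] of [e^<a, x> / prod (1 - e^-<psi, x>)]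
    is a combination of functions of the same kind, where a vector [psi] is
    repeated and [a] is lowered by [psi].  [dop u] is this rule, for
    an arbitrary family indexed by [Psi] and [a]; it is recorded as a finite
    list of terms in order to commute with residues and sums. *)
Definition dterms u Psi a : seq (R * (seq V * V)) :=
  ((u a : R), (Psi, a)) :: [seq (- (u psi : R), (psi :: Psi, a - psi)) | psi <- Psi].

Definition dop u k Psi a : C := \sum_(t <- dterms u Psi a) (t.1)%:C * k t.2.1 t.2.2.
Definition dops us k := foldr dop k us.

Lemma dopE u k Psi a : dop u k Psi a =
  (u a : R)%:C * k Psi a - \sum_(psi <- Psi) (u psi : R)%:C * k (psi :: Psi) (a - psi).
Proof.
rewrite /dop big_cons big_map /=; congr (_ + _); rewrite -sumrN; apply: eq_bigr => psi _.
by rewrite rmorphN mulNr.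
Qed.

Section Guard.
Variables (Psi0 : seq V) (G : set V).
Hypothesis GB : forall a b, G a -> G b -> G (a - b).
Hypothesis PG : forall psi, psi \in Psi0 -> G psi.

(** The range of indices reached from [Psi0] and the lattice [G] by [dterms]. *)
Definition guard Psi a := {subset Psi <= Psi0} /\ G a.

Lemma guard_dterms u Psi a t : guard Psi a -> t \in dterms u Psi a -> guard t.2.1 t.2.2.
Proof.
move=> [sP Ga]; rewrite in_cons => /orP[/eqP -> //|/mapP[psi pin ->]] /=; split=> /=.
  by move=> q; rewrite in_cons => /orP[/eqP ->|]; exact: sP.
by apply: GB => //; apply/PG/sP.
Qed.

Lemma dop_congr u k1 k2 : (forall Psi a, guard Psi a -> k1 Psi a = k2 Psi a) ->
  forall Psi a, guard Psi a -> dop u k1 Psi a = dop u k2 Psi a.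
Proof.
by move=> h Psi a ok; apply: eq_big_seq => t tin; rewrite h //; exact: guard_dterms tin.
Qed.

Lemma dops_congr us k1 k2 : (forall Psi a, guard Psi a -> k1 Psi a = k2 Psi a) ->
  forall Psi a, guard Psi a -> dops us k1 Psi a = dops us k2 Psi a.
Proof. by elim: us => //= u us ih h; apply: dop_congr; exact: ih. Qed.

Lemma dops_residue us (k : C -> seq V -> V -> C) (r : seq V -> V -> C) :
  (forall Psi a, guard Psi a -> is_residue (fun z => k z Psi a) (r Psi a)) ->
  forall Psi a, guard Psi a -> is_residue (fun z => dops us (k z) Psi a) (dops us r Psi a).
Proof.
move=> h; elim: us => //= u us ih Psi a ok; rewrite /dop.
have {ih}ih t : t \in dterms u Psi a -> is_residue (fun z => dops us (k z) t.2.1 t.2.2) (dops us r t.2.1 t.2.2).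
  by move=> tin; apply: ih; exact: guard_dterms tin.
elim: (dterms u Psi a) ih => [|t s ihs] ih.
  rewrite big_nil; apply: is_residue_congr (is_residue_hol (hol_cst 0)).
  by apply: punct0; apply: near_all => z; rewrite big_nil.
rewrite big_cons.
have h1 := is_residueZ (t.1)%:C (ih t (mem_head _ _)).
have h2 := ihs (fun q qs => ih q (ltac:(by rewrite in_cons qs orbT))).
by apply: is_residue_congr (is_residueD h1 h2); apply: punct0; apply: near_all => z; rewrite big_cons.
Qed.

Lemma dops_fsum us (I : choiceType) (A : set I) (r : I -> seq V -> V -> C) :
  (forall Psi a, guard Psi a -> finite_set (A `&` [set i | r i Psi a != 0])) ->
  forall Psi a, guard Psi a ->
    finite_set (A `&` [set i | dops us (r i) Psi a != 0]) /\
    \sum_(i \in A) dops us (r i) Psi a = dops us (fun Psi a => \sum_(i \in A) r i Psi a) Psi a.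
Proof.
move=> h; elim: us => [|u us ih] Psi a ok; first by split; [exact: h|].
have [f1 f2] := @fsbig_lin_in _ I A _ (dterms u Psi a) (fun t => (t.1)%:C)
  (fun t i => dops us (r i) t.2.1 t.2.2) (fun t tin => (ih _ _ (guard_dterms ok tin)).1).
split; first exact: f1.
rewrite /= {1}/dop f2; apply: eq_big_seq => t tin; congr (_ * _).
exact: (ih _ _ (guard_dterms ok tin)).2.
Qed.

End Guard.

Section Kernel.
Variables (E g : U) (z : C).

Definition kfac psi (x : U) : C := 1 - cexp (- pairing psi x g E z).
Definition kern x Psi a : C := para_kernel Psi E g a x z.

Lemma pairing_line a x u (h : R) :
  pairing a (x + h *: u) g E z = pairing a x g E z + h%:C * (u a : R)%:C.
Proof.
rewrite /pairing add_lfunE scale_lfunE -[h *: u a]/(h * (u a : R)) rmorphD rmorphM /=; ring.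
Qed.

Lemma pairingB a b x : pairing (a - b) x g E z = pairing a x g E z - pairing b x g E z.
Proof.
rewrite /pairing !linearB /= !rmorphB /=.
have -> : (0 +i* (2 * pi * (g a - g b)) : C) = (0 +i* (2 * pi * g a)) - (0 +i* (2 * pi * g b)).
  by simpc; congr (_ +i* _); rewrite mulrBr.
ring.
Qed.

Definition kgood (Psi0 : seq V) x := forall psi, psi \in Psi0 -> kfac psi x != 0.

Lemma kern_cons psi Psi a x : kern x (psi :: Psi) a = kern x Psi a / kfac psi x.
Proof.
by rewrite /kern /para_kernel big_cons -/(kfac psi x) invfM mulrA mulrAC.
Qed.

(** [f] is the restriction to the line [x + h u] of a function of a complex
    variable [h] with derivative [l] at 0: complex derivatives are computed
    formally and transferred to [dirder] at the end. *)
Definition lined (u x : U) (f : U -> C) (l : C) := exists2 F : C -> C,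
  (\forall h \near (0 : R^o), f (x + h *: u) = F h%:C) & cderiv F 0 l.

Lemma lined_sum u x (J : eqType) (s : seq J) (c : J -> C) (f : J -> U -> C) (l : J -> C) :
  (forall j, j \in s -> lined u x (f j) (l j)) ->
  lined u x (fun y => \sum_(j <- s) c j * f j y) (\sum_(j <- s) c j * l j).
Proof.
elim: s => [|j s ih] h.
  exists (fun=> 0); last by rewrite big_nil; exact: cderiv_cst.
  by apply: near_all => t; rewrite big_nil.
have [F eF dF] := h j (mem_head _ _).
have [F' eF' dF'] := ih (fun q qs => h q (ltac:(by rewrite in_cons qs orbT))).
exists (fun w => c j * F w + F' w).
  by apply: near_imp2 eF eF' => t e1 e2; rewrite big_cons e1 e2.
by rewrite big_cons; apply: cderivD => //; exact: cderivZ.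
Qed.

Lemma lined_congr u x f1 f2 l : (\forall h \near (0 : R^o), f1 (x + h *: u) = f2 (x + h *: u)) ->
  lined u x f1 l -> lined u x f2 l.
Proof.
move=> e [F eF dF]; exists F => //.
by apply: near_imp2 e eF => t <-.
Qed.

Lemma lined_dirder u x f l : lined u x f l -> dirder u f x = l.
Proof.
move=> [F eF [q [eq cq q0]]]; rewrite /dirder.
have ex : f x = F 0 by have := nbhs_singleton eF; rewrite scale0r addr0.
have c1 : {for 0, continuous (fun h : R^o => q h%:C : C^o)}.
  by apply: (@continuous_comp _ _ _ (fun h : R^o => h%:C : C^o) q); [exact: real_complex_continuous|exact: cq].
have eq' : \forall h \near (0 : R^o), F h%:C - F 0 = q h%:C * (h%:C - 0).
  exact: (@real_complex_continuous R 0 _ eq).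
have c2 : (fun h : R => q h%:C : C^o) @ (0 : R)^' --> (q 0 : C^o).
  by move=> A nA; apply: nbhs_dnbhs; exact: c1.
have cv : ((h^-1)%:C * (f (x + h *: u) - f x) : C^o) @[h --> (0 : R)^'] --> (q 0 : C^o).
  apply: cvg_trans c2; apply: near_eq_cvg; near=> h.
  have h0 : h != 0 by near: h; exact: nbhs_dnbhs_neq.
  have -> : f (x + h *: u) = F h%:C by near: h; exact: nbhs_dnbhs.
  rewrite ex.
  have -> : F h%:C - F 0 = q h%:C * (h%:C - 0) by near: h; exact: nbhs_dnbhs.
  by rewrite subr0 mulrCA -rmorphM /= mulVf // rmorph1 mulr1.
rewrite -q0; exact: (cvg_lim (@norm_hausdorff _ _) cv).
Unshelve. all: by end_near. Qed.

Lemma lined_kern u x Psi a : kgood Psi x -> lined u x (fun y => kern y Psi a) (dop u (kern x) Psi a).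
Proof.
elim: Psi => [|psi Psi ih] gx.
  exists (fun w => cexp (pairing a x g E z + w * (u a : R)%:C)).
    by apply: near_all => h; rewrite /kern /para_kernel big_nil divr1 pairing_line.
  rewrite dopE big_nil subr0 /kern /para_kernel big_nil divr1 mulrC.
  apply: (@cderiv_comp _ (@cexp R) (fun w => pairing a x g E z + w * (u a : R)%:C)).
    have := cderivD (cderiv_cst (pairing a x g E z) 0) (cderivM (cderiv_id (0 : C)) (cderiv_cst (u a : R)%:C 0)).
    by rewrite add0r mul1r mul0r addr0.
  rewrite mul0r addr0; exact: cexp_cderiv.
have gx' : kgood Psi x by move=> q qP; apply: gx; rewrite in_cons qP orbT.
have n0 : kfac psi x != 0 by apply: gx; rewrite mem_head.
have [F eF dF] := ih gx'.
pose f w := 1 - cexp (- (pairing psi x g E z + w * (u psi : R)%:C)).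
have f0 : f 0 = kfac psi x by rewrite /f mul0r addr0.
have df : cderiv f 0 ((u psi : R)%:C * cexp (- pairing psi x g E z)).
  have d1 : cderiv (fun w : C => - (pairing psi x g E z + w * (u psi : R)%:C)) 0 (- (u psi : R)%:C).
    apply: cderivN.
    have := cderivD (cderiv_cst (pairing psi x g E z) 0) (cderivM (cderiv_id (0 : C)) (cderiv_cst (u psi : R)%:C 0)).
    by rewrite add0r mul1r mul0r addr0.
  have d2 := @cderiv_comp _ (@cexp R) _ _ _ _ d1 (cexp_cderiv _).
  have := cderivD (cderiv_cst (1 : C) 0) (cderivN d2).
  by rewrite mul0r addr0 add0r mulrN opprK mulrC.
have n0' : f 0 != 0 by rewrite f0.
have dV := cderivV n0' df.
exists (fun w => F w * (f w)^-1).
  apply: near_imp eF => h e; rewrite kern_cons e; congr (_ / _).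
  by rewrite /kfac pairing_line.
have := cderivM dF dV; congr cderiv.
have F0 : F 0 = kern x Psi a by have := nbhs_singleton eF; rewrite scale0r addr0 => ->.
rewrite f0 F0 !dopE big_cons !kern_cons.
have kB b c : kern x Psi (b - c) = kern x Psi b * cexp (- pairing c x g E z).
  by rewrite /kern /para_kernel pairingB cexpD mulrAC.
have -> : \sum_(q <- Psi) (u q : R)%:C * kern x (q :: psi :: Psi) (a - q) =
    (\sum_(q <- Psi) (u q : R)%:C * kern x (q :: Psi) (a - q)) / kfac psi x.
  by rewrite mulr_suml; apply: eq_bigr => q _; rewrite !kern_cons; ring.
rewrite kB; set S := \sum_(_ <- _) _; field; exact: n0.
Qed.

Variables (Psi0 : seq V) (G : set V).
Hypothesis GB : forall a b, G a -> G b -> G (a - b).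
Hypothesis PG : forall psi, psi \in Psi0 -> G psi.

Lemma kgood_near u x : kgood Psi0 x -> \forall h \near (0 : R^o), kgood Psi0 (x + h *: u).
Proof.
rewrite /kgood; elim: Psi0 => [|psi s ih] h; first by apply: near_all => t q.
have {}ih := ih (fun q qs => h q (ltac:(by rewrite in_cons qs orbT))).
have h1 : \forall t \near (0 : R^o), kfac psi (x + t *: u) != 0.
  pose f (w : C^o) : C^o := 1 - cexp (- (pairing psi x g E z + w * (u psi : R)%:C)).
  have cf : {for 0, continuous f}.
    have d1 := cderivN (cderivD (cderiv_cst (pairing psi x g E z) 0)
      (cderivM (cderiv_id (0 : C)) (cderiv_cst (u psi : R)%:C 0))).
    have d2 := @cderiv_comp _ (@cexp R) _ _ _ _ d1 (cexp_cderiv _).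
    exact: (cderiv_cont (cderivD (cderiv_cst (1 : C) 0) (cderivN d2))).
  have := @cvgr_neq0 _ C^o _ (nbhs (0 : C^o)) (nbhs_filter _) f _ cf.
  rewrite {1}/f mul0r addr0 => /(_ (h psi (mem_head _ _))) nf.
  have := @real_complex_continuous R 0 _ nf.
  by apply: near_imp => t; rewrite /f /= /kfac pairing_line.
apply: near_imp2 h1 ih => t a1 a2 q; rewrite in_cons => /orP[/eqP -> //|]; exact: a2.
Qed.

Lemma dops_rcons us u k : dops (rcons us u) k = dops us (dop u k).
Proof. by rewrite /dops foldr_rcons. Qed.

Lemma lined_dops us u x : kgood Psi0 x -> forall Psi a, guard Psi0 G Psi a ->
  lined u x (fun y => dops us (kern y) Psi a) (dops (rcons us u) (kern x) Psi a).
Proof.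
move=> gx; rewrite dops_rcons; elim: us => [|v us ih] Psi a ok /=.
  by apply: lined_kern => q qP; apply: gx; case: ok => + _; exact.
by apply: lined_sum => t tin; apply: ih; exact: (guard_dterms GB PG ok tin).
Qed.

Lemma dirder_dops us u (f : U -> C) Psi a : guard Psi0 G Psi a ->
  (forall x, kgood Psi0 x -> f x = dops us (kern x) Psi a) ->
  forall x, kgood Psi0 x -> dirder u f x = dops (rcons us u) (kern x) Psi a.
Proof.
move=> ok h x gx; apply: lined_dirder; apply: lined_congr (lined_dops us u gx ok).
by apply: near_imp (kgood_near u gx) => t gt; rewrite h.
Qed.

Lemma iter_dirder m us u (f : U -> C) Psi a : guard Psi0 G Psi a ->
  (forall x, kgood Psi0 x -> f x = dops us (kern x) Psi a) ->
  forall x, kgood Psi0 x -> iter m (dirder u) f x = dops (us ++ nseq m u) (kern x) Psi a.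
Proof.
move=> ok h; elim: m => [|m ih] x gx; first by rewrite cats0; exact: h.
rewrite iterS (dirder_dops u ok ih gx) -cats1 -catA cats1 -[rcons _ _]/(rcons (nseq m u) u).
by congr (dops (us ++ _) _ _ _); elim: m {ih} => //= m ->.
Qed.

(** [polyfun_diff] applies the derivatives of the last coordinate first, while
    [dops] appends a new direction at the end of its list, whence [rev]. *)
Definition dirs (m : 'I_(\dim {:V}) -> nat) (s : seq 'I_(\dim {:V})) : seq U :=
  flatten [seq nseq (m i) (coordform i) | i <- rev s].

Lemma polyfun_diff_kern (P : mpoly.mpoly (\dim {:V}) C) Psi a x : guard Psi0 G Psi a ->
  kgood Psi0 x ->
  polyfun_diff P (fun y => kern y Psi a) x =
  \sum_(m <- mpoly.msupp P) mpoly.mcoeff m P * dops (dirs m (enum 'I_(\dim {:V}))) (kern x) Psi a.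
Proof.
move=> ok gx; apply: eq_bigr => m _; congr (_ * _).
elim: (enum _) x gx => [|i s ih] x gx //=.
rewrite (iter_dirder _ _ ok ih gx) /dirs rev_cons map_rcons flatten_rcons //.
Qed.

End Kernel.
End Directional.

(** * Summing residues over a coset of the torus *)

Lemma finite_preimage_sub (I J : Type) (A : set I) (f : I -> J) (B : set J) :
  set_inj A f -> finite_set B -> (forall i, A i -> B (f i)) -> finite_set A.
Proof.
move=> fI finB h; rewrite -(eq_finite_set (inj_card_eq fI)).
by apply: sub_finite_set finB => j [i Ai <-]; exact: h.
Qed.

Section CircleArg.
Variable R : realType.
Local Notation C := (R[i]).

(** The angle is the arc cosine of the real part, up to sign. *)
Lemma unit_circle_arg (rho : C) : `|rho| = 1 -> exists t : R, rho = cexp (0 +i* (2 * pi * t)).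
Proof.
case: rho => a b; rewrite normc_def /= => /(congr1 (@complex.Re R)) /= e.
have ab : a ^+ 2 + b ^+ 2 = 1.
  by rewrite -[LHS]sqr_sqrtr ?addr_ge0 ?sqr_ge0 // e expr1n.
have a1 : -1 <= a <= 1.
  rewrite -ler_norml -(ler_pXn2r (n := 2)) ?nnegrE // expr1n real_normK ?num_real //.
  by rewrite -ab lerDl sqr_ge0.
have key (th : R) : cos th = a -> sin th = b -> exists t : R, (a +i* b : C) = cexp (0 +i* (2 * pi * t)).
  move=> ct st; exists (th / (2 * pi)).
  have p0 : 2 * pi != 0 :> R by rewrite mulf_neq0 // gt_eqF // pi_gt0.
  by rewrite mulrCA mulfV // mulr1 /cexp /= expR0 mul1r ct st.
have ca := acosK a1.
have sa : sin (acos a) = Num.sqrt (1 - a ^+ 2) by rewrite sin_acos.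
have ba : Num.sqrt (1 - a ^+ 2) = `|b| by rewrite -ab addrAC subrr add0r sqrtr_sqr.
have [b0|b0] := leP 0 b.
  by apply: (key (acos a)) => //; rewrite sa ba ger0_norm.
by apply: (key (- acos a)); rewrite ?cosN // sinN sa ba ltr0_norm // opprK.
Qed.

Lemma norm_expz_eq1 (rho : C) (m : int) : rho != 0 -> m != 0 -> `|rho ^ m| = 1 -> `|rho| = 1.
Proof.
have aux (n : nat) : (0 < n)%N -> `|rho ^+ n| = 1 -> `|rho| = 1.
  by move=> n0; rewrite normrX => /eqP; rewrite pexpr_eq1 // => /eqP.
move=> r0; case: m => [n|n] m0; first by rewrite -exprnP; apply: aux; case: n m0.
by rewrite NegzE -exprnN normfV => /eqP; rewrite invr_eq1 => /eqP; exact: aux.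
Qed.

End CircleArg.

Section Para.
Variables (R : realType) (V : vectType R) (Gamma : set V) (W : {vspace V}) (E : 'Hom(V, R^o)).
Variables (Psi0 : seq V) (v : V).
Local Notation C := (R[i]).
Hypothesis GB : forall a b, Gamma a -> Gamma b -> Gamma (a - b).
Hypothesis hWE : W = lker E.
Hypothesis PG : forall psi, psi \in Psi0 -> Gamma psi.
Hypothesis Eint : forall a, Gamma a -> (E a : R) \is a Num.int.
Hypothesis Psi0E : forall psi, psi \in Psi0 -> E psi != 0 :> R.
Hypothesis Gv : Gamma v.
Hypothesis Ev : E v = 1 :> R.
Local Notation guard := (guard Psi0 Gamma).

Definition Ef (a : V) : R := E a.
Definition Efn (a : V) : R := - E a.
Let EB : {morph Ef : x y / x - y}. Proof. exact: hom_B. Qed.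
Let EnB : {morph Efn : x y / x - y}.
Proof. by move=> x y; rewrite /Efn (hom_B E) opprD. Qed.

(** The difference of the two solutions with right-hand side [f] on the wall,
    as in [wall_crossing_convolution]. *)
Definition wall_jump (f : V -> C) (Psi : seq V) (a : V) : C :=
  invnabs Ef (ones Psi) (on_wall Ef f) a - invnabs Efn (ones Psi) (on_wall Ef f) a.

Lemma good_sub Psi : {subset Psi <= Psi0} -> all (good Ef) (ones Psi) /\ all (good Efn) (ones Psi).
Proof.
move=> sP; have h x : x \in Psi -> 1 <= `|E x : R|.
  move=> xP; have /intrP[m em] := Eint (PG (sP _ xP)); have := Psi0E (sP _ xP).
  rewrite em intr_eq0 => m0; rewrite -intr_norm -[1]/(1%:~R) ler_int.
  by move: m0; case: (m) => [[]|].
split; rewrite all_map; apply/allP => x xP; rewrite /= /good /= oner_eq0 andbT /Ef /Efn ?normrN; exact: h.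
Qed.

Let wall_supp f : supp Ef 0 (on_wall Ef f : V -> C).
Proof. exact: on_wall_supp. Qed.
Let wall_suppn f : supp Efn 0 (on_wall Ef f : V -> C).
Proof. by move=> a; rewrite /Efn oppr_lt0 /on_wall => a0; rewrite /Ef gt_eqF. Qed.

(** By [invnabs_deriv], a linear factor in the right-hand side acts as the
    operator [dop] that describes the derivatives of the kernel. *)
Lemma wall_jump_mul (u : 'Hom(V, R^o)) f Psi a : guard Psi a ->
  wall_jump (fun b => (u b : R)%:C * f b) Psi a = dop u (wall_jump f) Psi a.
Proof.
move=> [sP Ga]; have [g1 g2] := good_sub sP.
have uB : {morph (fun b => (u b : R)%:C : C) : x y / x - y}.
  by move=> x y; rewrite (hom_B u) rmorphB.
have e : on_wall Ef (fun b => (u b : R)%:C * f b) = fun b => (u b : R)%:C * on_wall Ef f b.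
  by apply/funext => b; rewrite /on_wall; case: ifP; rewrite ?mulr0.
rewrite /wall_jump e (invnabs_deriv EB uB g1 (wall_supp f)) (invnabs_deriv EnB uB g2 (wall_suppn f)).
rewrite dopE !big_map /wall_jump mulrBr.
under [X in _ = _ - X]eq_bigr do rewrite mulrBr.
rewrite sumrB /=.
under [X in _ - X - _ = _]eq_bigr do rewrite mulr1.
under [X in _ - _ - (_ - X) = _]eq_bigr do rewrite mulr1.
ring.
Qed.

Lemma wall_jump_dops (us : seq 'Hom(V, R^o)) f Psi a : guard Psi a ->
  wall_jump (fun b => (\prod_(u <- us) (u b : R)%:C) * f b) Psi a = dops us (wall_jump f) Psi a.
Proof.
elim: us Psi a => [|u us ih] Psi a ok /=.
  by congr (wall_jump _ _ _); apply/funext => b; rewrite big_nil mul1r.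
rewrite -(dop_congr GB PG u ih ok) -wall_jump_mul //; congr (wall_jump _ _ _).
by apply/funext => b; rewrite big_cons mulrA.
Qed.

Lemma wall_jump_lin (J : Type) (s : seq J) (c : J -> C) (f : J -> V -> C) Psi a : guard Psi a ->
  wall_jump (fun b => \sum_(j <- s) c j * f j b) Psi a = \sum_(j <- s) c j * wall_jump (f j) Psi a.
Proof.
move=> [sP Ga]; have [g1 g2] := good_sub sP.
have e : on_wall Ef (fun b => \sum_(j <- s) c j * f j b) = fun b => \sum_(j <- s) c j * on_wall Ef (f j) b.
  by apply/funext => b; rewrite /on_wall; case: ifP => // _; rewrite big1 // => j _; rewrite mulr0.
rewrite /wall_jump e (invnabs_lin EB s c g1 (fun j => wall_supp (f j))) (invnabs_lin EnB s c g2 (fun j => wall_suppn (f j))).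
by rewrite -sumrB; apply: eq_bigr => j _; rewrite mulrBr.
Qed.

Lemma wall_jump_poly (P : mpoly.mpoly (\dim {:V}) C) f Psi a : guard Psi a ->
  wall_jump (fun b => f b * polyfun_val P b) Psi a =
  \sum_(m <- mpoly.msupp P) mpoly.mcoeff m P * dops (dirs m (enum 'I_(\dim {:V}))) (wall_jump f) Psi a.
Proof.
move=> ok; under [RHS]eq_bigr do rewrite -wall_jump_dops //.
rewrite -wall_jump_lin //; congr (wall_jump _ _ _); apply/funext => b.
rewrite /polyfun_val mpoly.mevalE mulr_sumr; apply: eq_bigr => m _.
rewrite mulrCA; congr (_ * _); rewrite mulrC; congr (_ * _).
rewrite /dirs big_flatten big_map [RHS](perm_big (enum 'I_(\dim {:V}))) /=; last by rewrite perm_rev.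
rewrite [RHS]big_enum /=; apply: eq_bigr => i _.
by rewrite big_nseq iter_mulr_1 /coordform lfunE.
Qed.

Definition Ez (a : V) : int := Num.floor (E a : R).

Lemma EzE a : Gamma a -> E a = (Ez a)%:~R :> R.
Proof. by move=> /Eint /intrP[m e]; rewrite /Ez e intrKfloor. Qed.

Lemma EzB a b : Gamma a -> Gamma b -> Ez (a - b) = Ez a - Ez b.
Proof.
move=> Ga Gb; apply: (@intr_inj R).
by rewrite intrB -(EzE Ga) -(EzE Gb) -(EzE (GB Ga Gb)) linearB.
Qed.

Definition Lz (y : torus Gamma) (Psi : seq V) : seq (int * C) :=
  [seq (Ez psi, character y (- psi)) | psi <- Psi].

Lemma char0 (y : torus Gamma) : character y 0 = 1.
Proof. by rewrite /character linear0 mulr0 cexp0. Qed.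

Lemma char_neq0 (y : torus Gamma) a : character y a != 0.
Proof. exact: cexp_neq0. Qed.

Lemma charBn (y : torus Gamma) a b n : character y (a - b *+ n) = character y a * character y (- b) ^+ n.
Proof.
elim: n => [|n ih]; first by rewrite mulr0n subr0 expr0 mulr1.
by rewrite mulrSr opprD addrA characterD ih exprSr mulrA.
Qed.

Lemma charDn (y : torus Gamma) a b n : character y (a + b *+ n) = character y a * character y (- b) ^- n.
Proof.
have e : character y (a + b *+ n) * character y (- b) ^+ n = character y a by rewrite -charBn addrK.
by rewrite -e mulfK // expf_neq0 // char_neq0.
Qed.

(** The restriction of [e_y] to the wall, followed by the solution operator on
    the lattice, only depends on the level [E a], up to the factor [e_y(a)]: it
    is the solution operator on the integers, with weights [e_y(-psi)]. *)
Lemma invnabs_char (y : torus Gamma) (e : V -> R) (e' : int -> R) Psi a :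
  (forall b, Gamma b -> e b = e' (Ez b)) ->
  {subset Psi <= Psi0} -> Gamma a ->
  invnabs e (ones Psi) (on_wall Ef (character y)) a =
  character y a * invnabs e' (Lz y Psi) (@delta0 R) (Ez a).
Proof.
move=> ee'; elim: Psi a => [|psi Psi ih] a sP Ga /=.
  rewrite /on_wall /delta0 /Ef EzE // intr_eq0.
  by case: eqP => _; rewrite ?mulr1 ?mulr0.
have Gp : Gamma psi by apply/PG/sP; rewrite mem_head.
have sP' : {subset Psi <= Psi0} by move=> q qP; apply: sP; rewrite in_cons qP orbT.
have G0 := subgroup0 GB Ga.
have GM n : Gamma (psi *+ n) by exact: (subgroupMn GB).
have EzM n : Ez (psi *+ n) = Ez psi *+ n.
  by apply: (@intr_inj R); rewrite -(EzE (GM n)) raddfMn /= (EzE Gp) rmorphMn.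
rewrite /invnab /= !ee' //; case: ifP => _.
  rewrite mulr_sumr; apply: eq_bigr => i _.
  rewrite expr1n mul1r ih //; last exact: GB.
  by rewrite charBn EzB // EzM; ring.
rewrite mulrN; congr (- _); rewrite mulr_sumr; apply: eq_bigr => i _.
rewrite expr1n invr1 mul1r ih //; last exact: (subgroupD GB).
rewrite charDn -[psi *+ i.+1]opprK EzB //; last exact: (subgroupN GB).
rewrite -[- (psi *+ _)]sub0r EzB // EzM.
have -> : Ez 0 = 0 by apply: (@intr_inj R); rewrite -EzE // linear0.
by rewrite sub0r opprK; ring.
Qed.

Definition coset (y : torus Gamma) : set (torus Gamma) :=
  [set g | torus_restr W g = torus_restr W y].
(** A point [g] of the coset is [y + t E] modulo the dual lattice, where [t] is
    read on a lattice vector [v] with [E v = 1]; [rho] is [e^(2 i pi t)]. *)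
Definition rho (y g : torus Gamma) : C := cexp (0 +i* (2 * pi * ((repr g - repr y) v : R))).

Lemma dual_memP (X : vectType R) (G : set X) (x : 'Hom(X, R^o)) :
  reflect (forall a, G a -> (x a : R) \is a Num.int) (x \in dual_lattice G).
Proof. exact: asboolP. Qed.

Lemma torus_eqP (X : vectType R) (G : set X) (x x' : 'Hom(X, R^o)) :
  \pi_(torus G)%qT x = \pi_(torus G)%qT x' <-> x - x' \in dual_lattice G.
Proof.
rewrite Quotient.idealrBE; split=> [->|/eqP //]; exact: eqxx.
Qed.

Lemma repr_pi (x : 'Hom(V, R^o)) : repr (\pi_(torus Gamma)%qT x) - x \in dual_lattice Gamma.
Proof. by apply/torus_eqP; rewrite reprK. Qed.

Lemma memW b : (b \in W) = (E b == 0 :> R).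
Proof. by rewrite hWE memv_ker. Qed.

Lemma cosetP y g : coset y g <->
  forall b, Gamma b -> E b = 0 :> R -> ((repr g - repr y) b : R) \is a Num.int.
Proof.
have restrE (x : 'Hom(V, R^o)) (b : subvs_of W) : dual_restr W x b = x (vsval b).
  by rewrite /dual_restr comp_lfunE lfunE.
rewrite /coset /= /torus_restr torus_eqP; split.
  move=> /dual_memP h b Gb Eb.
  have bW : b \in W by rewrite memW Eb eqxx.
  have := h (vsproj W b); rewrite /lattice_in /preimage /mkset vsprojK // => /(_ Gb).
  by rewrite !add_lfunE !opp_lfunE !restrE vsprojK.
move=> h; apply/dual_memP => b Gb; rewrite add_lfunE opp_lfunE !restrE.
have := h _ Gb; rewrite add_lfunE opp_lfunE; apply.
by apply/eqP; rewrite -memW subvsP.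
Qed.

(** [b - (E b) v] is in the wall, where [g] and [y] differ by an integer. *)
Lemma coset_line y g b : coset y g -> Gamma b -> exists n : int,
  (repr g b : R) = repr y b + (repr g - repr y) v * (Ez b)%:~R + n%:~R.
Proof.
move=> /cosetP h Gb.
have Gc : Gamma (b - v *~ Ez b) by apply: (GB Gb); exact: (subgroupMz GB).
have Ec : E (b - v *~ Ez b) = 0 :> R by rewrite linearB /= raddfMz /= Ev -EzE // subrr.
have /intrP[n e] := h _ Gc Ec; exists n.
rewrite -e linearB /= raddfMz /= !add_lfunE !opp_lfunE -[(_ - _) *~ _]mulrzr.
by move: (repr g b : R) (repr y b : R) (repr g v - repr y v : R) ((Ez b)%:~R : R) => p q r s; ring.
Qed.

Lemma coset_char (y g : torus Gamma) b : coset y g -> Gamma b ->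
  cexp (0 +i* (2 * pi * repr g b)) = character y b * rho y g ^ Ez b.
Proof.
move=> cg Gb; have [n ->] := coset_line cg Gb.
rewrite /rho -cexpMz /character.
set t : R := (repr g - repr y) v.
have -> : (0 +i* (2 * pi * (repr y b + t * (Ez b)%:~R + n%:~R)) : C) =
    (0 +i* (2 * pi * repr y b)) + (0 +i* (2 * pi * t)) *~ Ez b + (0 +i* (2 * pi * n%:~R)).
  have F (x : R) : (0 +i* x : C) = 'i * x%:C by simpc.
  rewrite !F -[X in _ = _ + X + _]mulrzr -(rmorph_int (real_complex R)) -!mulrA -!mulrDr -!rmorphM -!rmorphD /=.
  by congr (_ * _%:C); ring.
by rewrite !cexpD cexp_int mulr1.
Qed.

Lemma rho_neq0 y g : rho y g != 0.
Proof. exact: cexp_neq0. Qed.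

Lemma charN (y : torus Gamma) b : character y (- b) = (character y b)^-1.
Proof.
have := characterD y b (- b); rewrite subrr char0 => e.
by apply: (mulfI (char_neq0 y b)); rewrite -e divff // char_neq0.
Qed.

Lemma kern_exp (y g : torus Gamma) b z : coset y g -> Gamma b ->
  cexp (pairing b 0 (repr g) E z) = character y b * (rho y g * cexp z) ^ Ez b.
Proof.
move=> cg Gb; rewrite /pairing zero_lfunE add0r cexpD (coset_char cg Gb).
have -> : (rho y g * cexp z) ^ Ez b = rho y g ^ Ez b * cexp (z *~ Ez b).
  by rewrite cexpMz exprzMl // unitfE; [exact: rho_neq0|exact: cexp_neq0].
rewrite -mulrA; do 2 congr (_ * _); congr cexp.
by rewrite EzE // rmorph_int mulrzr.
Qed.

Lemma kfac_ratfac (y g : torus Gamma) psi z : coset y g -> Gamma psi ->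
  kfac E (repr g) z psi 0 = ratfac (Ez psi, character y (- psi)) (rho y g * cexp z).
Proof.
move=> cg Gp; rewrite /kfac cexpN (kern_exp z cg Gp) /ratfac /= invfM charN invr_expz //.
Qed.

(** With [u = rho e^z], the kernel at [x = 0] is a function of the
    single variable [u]. *)
Lemma kern_ratfun (y g : torus Gamma) z Psi a : coset y g -> guard Psi a ->
  kern E (repr g) z 0 Psi a = character y a * ratfun (Lz y Psi) (Ez a) (rho y g * cexp z).
Proof.
move=> cg [sP Ga]; rewrite /kern /para_kernel (kern_exp z cg Ga) /ratfun [RHS]mulrA; congr (_ / _).
rewrite /Lz big_map; apply: eq_big_seq => psi pP.
by rewrite -(kfac_ratfac z cg) //; apply/PG/sP.
Qed.

Lemma good_Lz (y : torus Gamma) Psi : {subset Psi <= Psi0} -> all (@nz_pair R) (Lz y Psi).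
Proof.
move=> sP; rewrite all_map; apply/allP => psi pP; rewrite /= /nz_pair /= char_neq0 andbT.
have := Psi0E (sP _ pP); rewrite EzE; last by apply/PG/sP.
by rewrite intr_eq0.
Qed.

Lemma kern_mero (y g : torus Gamma) Psi a : coset y g -> guard Psi a ->
  mero (fun z => kern E (repr g) z 0 Psi a).
Proof.
move=> cg ok; rewrite (_ : (fun z => _) = fun z => character y a * ratfun (Lz y Psi) (Ez a) (rho y g * cexp z)); last first.
  by apply/funext => z; exact: kern_ratfun.
apply: mero_mul; first exact: (hol_mero (hol_cst _)).
by apply: ratfun_mero; [apply: good_Lz; case: ok|exact: rho_neq0].
Qed.

Definition kres (g : torus Gamma) Psi a : C := residue0 (fun z => kern E (repr g) z 0 Psi a).

Lemma kres_res (y g : torus Gamma) Psi a : coset y g -> guard Psi a ->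
  kres g Psi a = character y a * res (ratfun (Lz y Psi) (Ez a)) (rho y g).
Proof.
move=> cg ok; apply: residue0E.
rewrite (_ : (fun z => _) = fun z => character y a * ratfun (Lz y Psi) (Ez a) (rho y g * cexp z)); last first.
  by apply/funext => z; exact: kern_ratfun.
apply: is_residueZ; apply: mero_residue; apply: ratfun_mero; last exact: rho_neq0.
by apply: good_Lz; case: ok.
Qed.

Lemma rho_inj y g g' : coset y g -> coset y g' -> rho y g = rho y g' -> g = g'.
Proof.
move=> cg cg' e; rewrite -[g]reprK -[g']reprK; apply/torus_eqP/dual_memP => b Gb.
have [n en] := coset_line cg Gb; have [n' en'] := coset_line cg' Gb.
set t : R := (repr g - repr y) v in en e; set t' : R := (repr g' - repr y) v in en' e.
have /cexp_period /intrP[m em] : cexp (0 +i* (2 * pi * (t - t')) : C) = 1.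
  have -> : (0 +i* (2 * pi * (t - t')) : C) = (0 +i* (2 * pi * t)) - (0 +i* (2 * pi * t')).
    by simpc; rewrite mulrBr.
  rewrite cexpD cexpN; move: e; rewrite /rho -/t -/t' => ->.
  by rewrite divff // cexp_neq0.
rewrite add_lfunE opp_lfunE en en'.
have -> : repr y b + t * (Ez b)%:~R + n%:~R - (repr y b + t' * (Ez b)%:~R + n'%:~R) =
    (m * Ez b + n - n')%:~R :> R.
  rewrite intrB intrD intrM -em; move: (repr y b : R) => q; ring.
exact: intr_int.
Qed.

Lemma rho_surj y (r : C) : `|r| = 1 -> exists2 g, coset y g & rho y g = r.
Proof.
move=> /unit_circle_arg[t ->]; pose x := repr y + t *: E.
exists (\pi_(torus Gamma)%qT x).
  apply/cosetP => b Gb Eb.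
  have /dual_memP/(_ b Gb) := repr_pi x.
  rewrite /x !add_lfunE !opp_lfunE !add_lfunE scale_lfunE Eb.
  by rewrite -[t *: 0]/(t * 0) mulr0 addr0.
rewrite /rho; have /dual_memP/(_ v Gv)/intrP[n] := repr_pi x.
rewrite /x !add_lfunE !opp_lfunE !add_lfunE scale_lfunE Ev -[t *: 1]/(t * 1) mulr1 => e.
have -> : (repr (\pi_(torus Gamma)%qT x) v : R) - repr y v = t + n%:~R.
  by rewrite -e; move: (repr y v : R) => q; ring.
have -> : (0 +i* (2 * pi * (t + n%:~R)) : C) = (0 +i* (2 * pi * t)) + (0 +i* (2 * pi * n%:~R)).
  by simpc; rewrite mulrDr.
by rewrite cexpD cexp_int mulr1.
Qed.

Lemma norm_char (y : torus Gamma) b : `|character y b| = 1.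
Proof. exact: norm_cexp_i. Qed.

(** The points of the coset are in bijection with the unit circle, which
    contains all the poles of the function of [u]: the sum is a sum of
    residues over all nonzero [u], and [defect_eq0] applies. *)
Theorem coset_sum (y : torus Gamma) Psi a : guard Psi a ->
  finite_set (coset y `&` [set g | kres g Psi a != 0]) /\
  \sum_(g \in coset y) kres g Psi a = wall_jump (character y) Psi a.
Proof.
move=> ok; have [sP Ga] := ok; have gL := good_Lz y sP.
have [_ fin] := ratfun_res_finite (Ez a) gL.
have inj : set_inj (coset y) (rho y).
  by move=> g g'; rewrite !inE => cg cg'; exact: rho_inj.
split.
  have fin' : finite_set ((coset y `&` [set g | kres g Psi a != 0])).
    apply: (@finite_preimage_sub (torus Gamma) C _ (rho y) (@units0 R `&` [set r | res (ratfun (Lz y Psi) (Ez a)) r != 0])) => //.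
    - by move=> g g'; rewrite !inE => -[cg _] [cg' _]; exact: rho_inj.
    - move=> g [cg /=]; rewrite (kres_res cg ok) mulf_eq0 negb_or => /andP[_ h].
      by split=> //; exact: rho_neq0.
  exact: fin'.
have e g : coset y g -> kres g Psi a = character y a * res (ratfun (Lz y Psi) (Ez a)) (rho y g).
  by move=> cg; exact: kres_res.
rewrite (eq_fsbigr (fun g => character y a * res (ratfun (Lz y Psi) (Ez a)) (rho y g))); last first.
  by move=> g; rewrite inE; exact: e.
rewrite -mulr_fsumr -(fsbig_image (coset y) (rho y) (res (ratfun (Lz y Psi) (Ez a))) inj).
have -> : \sum_(r \in rho y @` coset y) res (ratfun (Lz y Psi) (Ez a)) r = ressum (ratfun (Lz y Psi) (Ez a)).
  apply: fsbig_widen; first by move=> r [g cg <-]; exact: rho_neq0.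
  move=> r [/= r0 nr]; apply: ratfun_res0 => // p /mapP[psi pP ->] /=.
  apply/negP => /eqP e1; apply: nr.
  have n1 : `|r| = 1.
    have : `|r ^ (- Ez psi)| = 1.
      by have := congr1 Num.norm e1; rewrite normrM norm_char mul1r normr1.
    apply: norm_expz_eq1 => //; rewrite oppr_eq0.
    have := Psi0E (sP _ pP); rewrite EzE; last by apply/PG/sP.
    by rewrite intr_eq0.
  by have [g cg <-] := rho_surj y n1; exists g.
have := defect_eq0 (Ez a) gL; rewrite /defect => /eqP; rewrite subr_eq0 => /eqP ->.
rewrite /jump mulrBr /wall_jump.
have h1 := @invnabs_char y Ef (@int_up R) Psi a (fun b Gb => EzE Gb) sP Ga.
have h2 : invnabs Efn (ones Psi) (on_wall Ef (character y)) a =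
    character y a * invnabs (@int_down R) (Lz y Psi) (@delta0 R) (Ez a).
  apply: invnabs_char => // b Gb; by rewrite /Efn /int_down EzE.
by rewrite h1 h2.
Qed.

Lemma kgood_punct y g : coset y g -> \forall z \near (0 : C^o)^', kgood E (repr g) z Psi0 0.
Proof.
move=> cg; rewrite /kgood.
suff gen (s : seq V) : {subset s <= Psi0} -> \forall z \near (0 : C^o)^',
    forall psi, psi \in s -> kfac E (repr g) z psi 0 != 0 by exact: gen.
elim: s => [|psi s ih] sP.
  by apply: punct0; apply: near_all => z q.
have pP : psi \in Psi0 by apply: sP; rewrite mem_head.
have {}ih := ih (fun q qs => sP q (ltac:(by rewrite in_cons qs orbT))).
have gp : nz_pair (Ez psi, character y (- psi)).
  have sub : {subset [:: psi] <= Psi0} by move=> q; rewrite inE => /eqP ->.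
  by have /andP[] := good_Lz y sub.
apply: punct_imp2 (ratfac_neq0 gp (rho_neq0 y g)) ih => z z0 h1 h2 q.
rewrite in_cons => /orP[/eqP ->|]; last exact: h2.
by rewrite (kfac_ratfac z cg) //; exact: PG.
Qed.

(** Both sides are obtained from the case [P = 1] by the operators [dops]
    attached to the monomials of [P]. *)
Theorem para_coset (y : torus Gamma) (P : mpoly.mpoly (\dim {:V}) C) a : Gamma a ->
  \sum_(g \in coset y) residue0 (fun z => polyfun_diff P
      (fun x => para_kernel Psi0 E (repr g) a x z) 0) =
  wall_jump (fun b => character y b * polyfun_val P b) Psi0 a.
Proof.
move=> Ga; have ok : guard Psi0 a by split.
rewrite (wall_jump_poly P (character y) ok).
pose D m := dirs m (enum 'I_(\dim {:V})).
have rg g : coset y g -> residue0 (fun z => polyfun_diff P (fun x => para_kernel Psi0 E (repr g) a x z) 0) =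
    \sum_(m <- mpoly.msupp P) mpoly.mcoeff m P * dops (D m) (kres g) Psi0 a.
  move=> cg; apply: residue0E.
  have h m : is_residue (fun z => dops (D m) (kern E (repr g) z 0) Psi0 a) (dops (D m) (kres g) Psi0 a).
    apply: (dops_residue GB PG _ _ ok) => Psi b okb.
    by apply: mero_residue; exact: (kern_mero cg okb).
  have hs (s : seq _) : is_residue (fun z => \sum_(m <- s) mpoly.mcoeff m P * dops (D m) (kern E (repr g) z 0) Psi0 a)
      (\sum_(m <- s) mpoly.mcoeff m P * dops (D m) (kres g) Psi0 a).
    elim: s => [|m s ih].
      rewrite big_nil; apply: is_residue_congr (is_residue_hol (hol_cst 0)).
      by apply: punct0; apply: near_all => z; rewrite big_nil.
    rewrite big_cons; apply: is_residue_congr (is_residueD (is_residueZ (mpoly.mcoeff m P) (h m)) ih).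
    by apply: punct0; apply: near_all => z; rewrite big_cons.
  apply: is_residue_congr (hs (mpoly.msupp P)).
  apply: punct_imp (kgood_punct cg) => z z0 gz.
  by rewrite (polyfun_diff_kern GB PG P ok gz).
rewrite (eq_fsbigr (fun g => \sum_(m <- mpoly.msupp P) mpoly.mcoeff m P * dops (D m) (kres g) Psi0 a)); last first.
  by move=> g; rewrite inE; exact: rg.
have cf Psi b : guard Psi b -> finite_set (coset y `&` [set g | kres g Psi b != 0]).
  by move=> okb; exact: (coset_sum y okb).1.
have h m := dops_fsum GB PG (D m) cf ok.
rewrite (@fsbig_lin_in _ _ (coset y) _ (mpoly.msupp P) (fun m => mpoly.mcoeff m P)
  (fun m g => dops (D m) (kres g) Psi0 a) (fun m _ => (h m).1)).2.
apply: eq_bigr => m _; congr (_ * _); rewrite (h m).2.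
by apply: (dops_congr GB PG) ok => Psi b okb; exact: (coset_sum y okb).2.
Qed.

Theorem para_convolution (Q : quasipoly Gamma) a : Gamma a ->
  para W Q Psi0 E a = wall_jump (qp_val Q) Psi0 a.
Proof.
move=> Ga; have ok : guard Psi0 a by split.
have [r [ur [r0 hr]]] := qp_val_seq Q.
have term y : \sum_(g \in coset y) residue0 (fun z => polyfun_diff (qp_coef Q y)
      (fun x => para_kernel Psi0 E (repr g) a x z) 0) =
    wall_jump (fun b => character y b * polyfun_val (qp_coef Q y) b) Psi0 a by exact: para_coset.
have -> : para W Q Psi0 E a = \sum_(y \in [set: torus Gamma])
    wall_jump (fun b => character y b * polyfun_val (qp_coef Q y) b) Psi0 a.
  by apply: eq_fsbigr => y _; exact: term.
have -> : qp_val Q = fun b => \sum_(y <- r) 1 * (character y b * polyfun_val (qp_coef Q y) b).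
  by apply/funext => b; rewrite hr; apply: eq_bigr => y _; rewrite mul1r.
rewrite wall_jump_lin //; under [RHS]eq_bigr do rewrite mul1r.
rewrite [RHS]fsbig_seq //; apply/esym/fsbig_widen => // y [_ /= ny].
have -> : (fun b => character y b * polyfun_val (qp_coef Q y) b) = fun b => \sum_(j <- [::] : seq nat) 0 * (0 : C).
  by apply/funext => b; rewrite big_nil r0; [rewrite /polyfun_val mpoly.meval0 mulr0|apply/negP].
by rewrite (wall_jump_lin [::] (fun=> 0) (fun=> fun=> 0) ok) big_nil.
Qed.

End Para.

(** * The wall-crossing formula *)

Section Assembly.
Variables (R : realType) (V : vectType R).

Lemma zspan_subr (s : seq V) a b : zspan s a -> zspan s b -> zspan s (a - b).
Proof.
move=> [m ->] [n ->]; exists (fun i => m i - n i).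
by rewrite -sumrB; apply: eq_bigr => i _; rewrite mulrzBr.
Qed.

Lemma mem_zspan (s : seq V) x : x \in s -> zspan s x.
Proof.
move=> xs; have i0 : (index x s < size s)%N by rewrite index_mem.
exists (fun i => (i == Ordinal i0)%:Z).
rewrite (bigD1 (Ordinal i0)) //= eqxx nth_index // big1 ?addr0 // => i /negbTE ->.
by rewrite mulr0z.
Qed.

(** By Euclidean division the values on the lattice are the multiples of the
    least positive one, and [E] divided by this value is still in the dual
    lattice. *)
Lemma primitive_dual_onto (Gamma : set V) (E : 'Hom(V, R^o)) (a0 : V) :
  (forall a b, Gamma a -> Gamma b -> Gamma (a - b)) ->
  primitive_dual Gamma E -> Gamma a0 -> 0 < E a0 :> R ->
  exists2 v, Gamma v & E v = 1.
Proof.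
move=> GB [/dual_memP Eint prim] Ga0 a0pos.
pose P (n : nat) := `[< exists2 v, Gamma v & E v = n.+1%:R :> R >].
have pos a : Gamma a -> 0 < E a :> R -> exists n : nat, E a = n.+1%:R :> R.
  move=> /Eint /intrP[[[|n]|n] ->] //; first by rewrite ltxx.
    by exists n.
  by rewrite ltr0z.
have exP : exists n, P n.
  by have [n en] := pos _ Ga0 a0pos; exists n; apply/asboolP; exists a0.
case: (ex_minnP exP) => d /asboolP[v Gv Ev] dmin.
have d0 : d.+1%:R != 0 :> R by rewrite pnatr_eq0.
exists v => //; rewrite Ev.
suff Fdual : (d.+1%:R^-1 : R) *: E \in dual_lattice Gamma.
  have -> : d.+1 = 1%N by apply: prim Fdual _; rewrite -scaler_nat scalerA mulfV ?scale1r.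
  by [].
apply/dual_memP => a Ga; rewrite scale_lfunE -[_ *: _]/(d.+1%:R^-1 * (E a : R)).
have /intrP[m em] := Eint _ Ga.
have Gr : Gamma (a - v *~ (m %/ d.+1)%Z) by apply: (GB _ _ Ga); exact: (subgroupMz GB).
have er : E (a - v *~ (m %/ d.+1)%Z) = ((m %% d.+1)%Z)%:~R :> R.
  by rewrite linearB /= raddfMz /= Ev em [d.+1%:R]pmulrn -[X in _ - X]mulrzr -intrM -intrB /modz mulrC.
have r0 : (m %% d.+1)%Z = 0.
  have := modz_ge0 m (isT : d.+1%:Z != 0); have := ltz_pmod m (isT : 0 < d.+1%:Z).
  move: er; case: (m %% d.+1)%Z => [[|k]|k] // er kd _.
  have : P k by apply/asboolP; exists (a - v *~ (m %/ d.+1)%Z).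
  by move=> /dmin; rewrite leqNgt => /negP[].
have -> : (E a : R) = d.+1%:R * ((m %/ d.+1)%Z)%:~R.
  by rewrite em {1}(divz_eq m d.+1) r0 addr0 intrM mulrC.
by rewrite mulrA mulVf // mul1r intr_int.
Qed.

Lemma partition_fun_out (s : seq V) a : ~ cone s a -> partition_fun s a = 0%N.
Proof.
move=> na; rewrite /partition_fun (_ : [set m | _] = set0) ?fset_set0 ?cardfs0 //.
apply/seteqP; split=> m //= ma; apply: na; exists (fun i => (m i)%:R) => //.
by rewrite ma; apply: eq_bigr => i _; rewrite scaler_nat.
Qed.

(** Also valid in the exterior chamber, where both sides vanish. *)
Lemma chamber_qpE (Gamma : set V) (Phi : seq V) (c : set V) (Q : quasipoly Gamma) a :
  is_chamber_qp Phi c Q -> Gamma a -> c a -> qp_val Q a = (partition_fun Phi a)%:R.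
Proof.
move=> [h1 h2] Ga ca; have [ce|ce] := pselect (c = ext_chamber Phi).
  by rewrite h1 // partition_fun_out //; move: ca; rewrite ce.
by apply: h2 => //; exact: (@subset_closure (vtop V)).
Qed.

End Assembly.
Theorem theorem42 (R : realType) (V : vectType R) (Gamma : set V)
  (Phi : seq V) (W : {vspace V}) (E : 'Hom(V, R^o)) (c1 c2 : set V)
  (c12 : set (subvs_of W)) (k1 k2 : quasipoly Gamma)
  (k12 : quasipoly (lattice_in W Gamma)) (Q : quasipoly Gamma)
  (hGamma : full_lattice Gamma)
  (hPhi0 : 0 \notin Phi)
  (hPhi_half : exists u : 'Hom(V, R^o), forall phi, phi \in Phi -> 0 < u phi :> R)
  (hPhi_span : zspan Phi = Gamma)
  (hW : is_wall W Phi)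
  (hE : primitive_dual Gamma E)
  (hWE : W = lker E)
  (hc1 : chamber Phi c1)
  (hc2 : chamber Phi c2)
  (hc : separated_by W Phi E c1 c2)
  (hpos : exists2 phi, phi \in vectors_out W Phi & 0 < E phi :> R)
  (hc12 : chamber (vectors_in W Phi) c12)
  (hc12_cl : vsval @^-1` (vclosure c1 `&` vclosure c2) `<=` vclosure c12)
  (hk1 : is_chamber_qp Phi c1 k1)
  (hk2 : is_chamber_qp Phi c2 k2)
  (hk12 : is_chamber_qp (vectors_in W Phi) c12 k12)
  (hQ : forall b : subvs_of W,
     lattice_in W Gamma b -> qp_val Q (vsval b) = qp_val k12 b) :
  forall a : V, Gamma a ->
    qp_val k1 a - qp_val k2 a = para W Q (vectors_out W Phi) E a.
Proof.
have GB a b : Gamma a -> Gamma b -> Gamma (a - b).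
  by rewrite -hPhi_span; exact: zspan_subr.
have GPhi x : x \in Phi -> Gamma x by rewrite -hPhi_span; exact: mem_zspan.
set Psi := vectors_out W Phi.
have PsiPhi x : x \in Psi -> x \in Phi by rewrite mem_filter => /andP[].
have GPsi x : x \in Psi -> Gamma x by move=> /PsiPhi; exact: GPhi.
have /dual_memP Eint := hE.1.
have EPsi x : x \in Psi -> E x != 0 :> R.
  by rewrite mem_filter hWE memv_ker => /andP[].
have [phi phiPsi Ephi] := hpos.
have [v Gv Ev] := primitive_dual_onto GB hE (GPsi _ phiPsi) Ephi.
have hpos' : exists2 phi, phi \in Phi & 0 < E phi :> R by exists phi => //; exact: PsiPhi.
have [w [Gw Ew w1 w2 w12]] := wall_germ GB GPhi hPhi_half hW hWE hc1 hc2 hc hpos' hc12 hc12_cl.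
have [u hu] := hPhi_half.
have Gwn a n : Gamma a -> Gamma (a + w *+ n).
  by move=> Ga; apply: (subgroupD GB Ga); exact: (subgroupMn GB).
have memWE a : (a \in W) = (Ef E a == 0) by rewrite hWE memv_ker.
move=> a Ga; rewrite (para_convolution GB hWE GPsi Eint EPsi Gv Ev) // /wall_jump.
apply: (@wall_crossing_convolution V R[i] R Gamma GB (ones Psi) w (pfC Phi)
  (fun b => pfC (vectors_in W Phi) (vsproj W b)) (qp_val Q) _ Gw (Ef E) v) => //.
- by move=> p /mapP[x xP ->]; exact: GPsi.
- by move=> x y; rewrite /Ef linearB.
- apply: good_ones => x xP; rewrite -[X in _ <= X]/`|E x : R|.
  have := EPsi x xP; have /intrP[m ->] := Eint x (GPsi x xP).
  by rewrite intr_eq0 -intr_norm ler1z -gtz0_ge1 normr_gt0.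
- by rewrite /Ef Ev ltr01.
- by rewrite (nabs_partition W hu) /on_wall; apply/funext => b; rewrite memWE.
- move=> b Gb Eb; have bW : b \in W by rewrite memWE Eb eqxx.
  apply: filterS (w12 b bW) => n cn.
  have nW : b + w *+ n \in W.
    by rewrite rpredD // rpredMn // memWE /Ef Ew eqxx.
  have Gn : lattice_in W Gamma (vsproj W (b + w *+ n)).
    by rewrite /lattice_in /preimage /= vsprojK //; exact: Gwn.
  by rewrite -[in RHS](vsprojK nW) hQ // (chamber_qpE hk12).
- by move=> b x; exact: qp_val_rec.
- by move=> b x; exact: qp_val_rec.
- by move=> b x; exact: qp_val_rec.
- by move=> b Gb Eb; apply: filterS (w1 b Eb) => n cn; rewrite (chamber_qpE hk1) //; exact: Gwn.
- by move=> b Gb Eb; apply: filterS (w2 b Eb) => n cn; rewrite (chamber_qpE hk2) //; exact: Gwn.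
Qed.
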